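(* Let $A=\begin{pmatrix}1&-1\\0&1\end{pmatrix}$, $B=\begin{pmatrix}1&0\\1&1\end{pmatrix}$, $S=ABA=\begin{pmatrix}0&-1\\1&0\end{pmatrix}$, and for $n\in\mathbb{Z}$ let $f_n=A^{-(n+3)}SA^{n}\in SL(2,\mathbb{Z})$. Let $G=PSL(2,\mathbb{Z})=SL(2,\mathbb{Z})/\{\pm I\}$. Then: 1. The derived group $G'$ of $G$ is generated by the images of $f_{-2}$ and $f_{-1}$ in $G$, and has index $6$ in $G$. 2. The quotient $\mathbb{H}/G'$ is a once-punctured torus $\mathcal{T}$ (the modular torus), obtained as follows: the union $\tilde H=\bigcup_{n\in\mathbb{Z}}\mathcal{B}_n$, quotiented by the image in $G$ of $\langle A^{-6}S^2\rangle$, is a punctured hyperbolic hexagon, and $\mathcal{T}$ is obtained from it by identifying opposite sides by the images in $G$ of the elements $f_n$. The parabolic element of the cusp of $\mathcal{T}$ is the image of $A^{-6}S^2=[f_{-1}^{-1},f_{-2}]$. 3. The quotient map $SL(2,\mathbb{Z})\to G$ is injective on the derived group $SL(2,\mathbb{Z})'$, and $SL(2,\mathbb{Z})'$ is freely generated by $$f_{-2}=BA^{-1}=\begin{pmatrix}1&1\\1&2\end{pmatrix}\quad\text{and}\quad f_{-1}=A^{-1}B=\begin{pmatrix}2&1\\1&1\end{pmatrix}.$$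
   Context: $\mathbb{H}=\{z\in\mathbb{C}\mid\Im(z)>0\}$ is the Poincaré half-plane, on which $SL(2,\mathbb{Z})$ and $G$ act by homographies. For $n\in\mathbb{Z}$, $\mathcal{B}_n=A^{-n}\bigl(\{z\in\mathbb{C}\mid \Im(z)>0,\ -\tfrac12\le\Re(z)\le\tfrac12,\ |z|\ge1\}\bigr)$ is the translate by $A^{-n}$ of the usual fundamental domain of $G$. Commutator convention: $[x,y]=x^{-1}y^{-1}xy$. *)

(* Defs.v *)
From HB Require Import structures.
From mathcomp Require Import all_boot all_order all_algebra.
From mathcomp Require Import all_classical all_reals all_analysis.
From mathcomp Require Import complex ring.
From Stdlib Require Relations.
Import Order.TTheory GRing.Theory Num.Theory.
Import numFieldNormedType.Exports.

Set Implicit Arguments.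
Unset Strict Implicit.
Unset Printing Implicit Defensive.

Local Open Scope classical_set_scope.
Local Open Scope ring_scope.

Section Groups.
Variable gT : groupType.

Definition expgz (x : gT) (n : int) : gT :=
  match n with Posz m => (x ^+ m)%g | Negz m => (x ^- m.+1)%g end.

Definition is_subgroup (K : set gT) : Prop := group_closed [in K].

Definition generated (X : set gT) : set gT := smallest is_subgroup X.

Definition derived_subgroup : set gT :=
  generated [set g | exists x y : gT, g = [~ x, y]%g].

Definition left_cosets (K : set gT) : set (set gT) :=
  [set [set (x * k)%g | k in K] | x in [set: gT]].

Definition has_index (K : set gT) (n : nat) : Prop := (left_cosets K #= `I_n)%card.

(* The letter (i, true) stands for x i and (i, false) for its inverse. *)
Definition word_eval (I : eqType) (x : I -> gT) (w : seq (I * bool)) : gT :=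
  (\prod_(l <- w) (if l.2 then x l.1 else (x l.1)^-1))%g.

Definition reduced_word (I : eqType) (w : seq (I * bool)) : bool :=
  sorted (fun l l' => l' != (l.1, ~~ l.2)) w.

(* The canonical map from the free group on I, realized as reduced words,
   to gT is a bijection onto K. *)
Definition freely_generated (I : eqType) (K : set gT) (x : I -> gT) : Prop :=
  set_bij [set w | reduced_word w] K (word_eval x).

End Groups.

Arguments derived_subgroup : clear implicits.

Lemma det_mx22 (M : 'M[int]_2) : \det M = M 0 0 * M 1 1 - M 0 1 * M 1 0.
Proof.
rewrite (expand_det_row _ 0) !big_ord_recl big_ord0 /cofactor !det_mx11 !mxE.
rewrite addr0 expr0 mul1r expr1 mulN1r mulrN.
by congr (M _ _ * M _ _ - M _ _ * M _ _); apply: val_inj.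
Qed.

Definition SL2Z := {M : 'M[int]_2 | \det M == 1}.

HB.instance Definition _ := SubChoice.on SL2Z.

Section SL2Zgroup.

Lemma SL2Z_mul_subproof (M N : SL2Z) : \det (val M *m val N) == 1.
Proof. by rewrite det_mulmx (eqP (valP M)) (eqP (valP N)) mulr1. Qed.

Lemma SL2Z_one_subproof : \det (1%:M : 'M[int]_2) == 1.
Proof. by rewrite det1. Qed.

Lemma SL2Z_inv_subproof (M : SL2Z) : \det (invmx (val M)) == 1.
Proof. by rewrite det_inv (eqP (valP M)) invr1. Qed.

Definition SL2Z_mul (M N : SL2Z) : SL2Z :=
  exist _ (val M *m val N) (SL2Z_mul_subproof M N).
Definition SL2Z_one : SL2Z := exist _ 1%:M SL2Z_one_subproof.
Definition SL2Z_inv (M : SL2Z) : SL2Z :=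
  exist _ (invmx (val M)) (SL2Z_inv_subproof M).

Lemma SL2Z_unitmx (M : SL2Z) : val M \in unitmx.
Proof. by rewrite unitmxE (eqP (valP M)) unitr1. Qed.

Lemma SL2Z_mulA : associative SL2Z_mul.
Proof. by move=> M N P; apply: val_inj; rewrite /= mulmxA. Qed.
Lemma SL2Z_mul1 : left_id SL2Z_one SL2Z_mul.
Proof. by move=> M; apply: val_inj; rewrite /= mul1mx. Qed.
Lemma SL2Z_mulr1 : right_id SL2Z_one SL2Z_mul.
Proof. by move=> M; apply: val_inj; rewrite /= mulmx1. Qed.
Lemma SL2Z_mulV : left_inverse SL2Z_one SL2Z_inv SL2Z_mul.
Proof. by move=> M; apply: val_inj; rewrite /= mulVmx ?SL2Z_unitmx. Qed.
Lemma SL2Z_mulrV : right_inverse SL2Z_one SL2Z_inv SL2Z_mul.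
Proof. by move=> M; apply: val_inj; rewrite /= mulmxV ?SL2Z_unitmx. Qed.

HB.instance Definition _ := isGroup.Build SL2Z
  SL2Z_mulA SL2Z_mul1 SL2Z_mulr1 SL2Z_mulV SL2Z_mulrV.

End SL2Zgroup.

Section PSL2Zgroup.
Local Open Scope quotient_scope.

Definition eq_up_to_sign (M N : SL2Z) : bool :=
  (val M == val N) || (val M == - val N).

Lemma eq_up_to_sign_refl : reflexive eq_up_to_sign.
Proof. by move=> M; rewrite /eq_up_to_sign eqxx. Qed.
Lemma eq_up_to_sign_sym : symmetric eq_up_to_sign.
Proof.
by move=> M N; rewrite /eq_up_to_sign eq_sym -eqr_oppLR [- _ == _]eq_sym.
Qed.
Lemma eq_up_to_sign_trans : transitive eq_up_to_sign.
Proof.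
move=> N M P /orP[] /eqP MN /orP[] /eqP NP; rewrite /eq_up_to_sign MN NP.
- by rewrite eqxx.
- by rewrite eqxx orbT.
- by rewrite eqxx orbT.
- by rewrite opprK eqxx.
Qed.

Canonical sign_equiv := EquivRel eq_up_to_sign
  eq_up_to_sign_refl eq_up_to_sign_sym eq_up_to_sign_trans.

Definition PSL2Z := {eq_quot sign_equiv}.

HB.instance Definition _ := Choice.on PSL2Z.
HB.instance Definition _ := EqQuotient.on PSL2Z.

Definition projG (M : SL2Z) : PSL2Z := \pi_PSL2Z M.

Lemma projG_eq (M N : SL2Z) : projG M = projG N <-> eq_up_to_sign M N.
Proof. by split=> [/eqmodP|MN] //; apply/eqmodP. Qed.

Definition PSL2Z_mul (g h : PSL2Z) : PSL2Z := projG (repr g * repr h)%g.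
Definition PSL2Z_one : PSL2Z := projG 1%g.
Definition PSL2Z_inv (g : PSL2Z) : PSL2Z := projG (repr g)^-1%g.

Lemma repr_projG (M : SL2Z) : eq_up_to_sign (repr (projG M)) M.
Proof. by apply/projG_eq; rewrite /projG reprK. Qed.

Lemma projG_repr (g : PSL2Z) : projG (repr g) = g.
Proof. exact: reprK. Qed.

Lemma projG_mul (M N : SL2Z) : projG (M * N)%g = PSL2Z_mul (projG M) (projG N).
Proof.
apply/projG_eq; rewrite /eq_up_to_sign /=.
have /orP[/eqP->|/eqP->] := repr_projG M;
have /orP[/eqP->|/eqP->] := repr_projG N;
by rewrite ?mulNmx ?mulmxN ?opprK ?eqxx ?orbT.
Qed.

Lemma projG_inv (M : SL2Z) : projG M^-1%g = PSL2Z_inv (projG M).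
Proof.
apply/projG_eq; rewrite /eq_up_to_sign /=.
have invN : invmx (- val M) = - invmx (val M).
  by rewrite -scaleN1r invmxZ ?unitmxZ ?unitrN1 ?SL2Z_unitmx // invrN1 scaleN1r.
by have /orP[/eqP->|/eqP->] := repr_projG M;
  rewrite ?invN ?opprK ?eqxx ?orbT.
Qed.

Lemma PSL2Z_mulA : associative PSL2Z_mul.
Proof.
move=> g h k; rewrite -(projG_repr g) -(projG_repr h) -(projG_repr k).
by rewrite -!projG_mul mulgA.
Qed.
Lemma PSL2Z_mul1 : left_id PSL2Z_one PSL2Z_mul.
Proof. by move=> g; rewrite -(projG_repr g) -projG_mul mul1g. Qed.
Lemma PSL2Z_mulr1 : right_id PSL2Z_one PSL2Z_mul.
Proof. by move=> g; rewrite -(projG_repr g) -projG_mul mulg1. Qed.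
Lemma PSL2Z_mulV : left_inverse PSL2Z_one PSL2Z_inv PSL2Z_mul.
Proof.
by move=> g; rewrite -(projG_repr g) -projG_inv -projG_mul mulVg.
Qed.
Lemma PSL2Z_mulrV : right_inverse PSL2Z_one PSL2Z_inv PSL2Z_mul.
Proof.
by move=> g; rewrite -(projG_repr g) -projG_inv -projG_mul mulgV.
Qed.

HB.instance Definition _ := isGroup.Build PSL2Z
  PSL2Z_mulA PSL2Z_mul1 PSL2Z_mulr1 PSL2Z_mulV PSL2Z_mulrV.

End PSL2Zgroup.

Definition mat2 (a b c d : int) : 'M[int]_2 :=
  \matrix_(i < 2, j < 2)
    (if i == 0 then (if j == 0 then a else b) else (if j == 0 then c else d)).

Lemma matA_det : \det (mat2 1 (-1) 0 1) == 1.
Proof. by rewrite det_mx22 !mxE. Qed.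
Lemma matB_det : \det (mat2 1 0 1 1) == 1.
Proof. by rewrite det_mx22 !mxE. Qed.

Definition matA : SL2Z := exist _ (mat2 1 (-1) 0 1) matA_det.
Definition matB : SL2Z := exist _ (mat2 1 0 1 1) matB_det.
Definition matS : SL2Z := (matA * matB * matA)%g.
Definition fmat (n : int) : SL2Z :=
  (expgz matA (- (n + 3)) * matS * expgz matA n)%g.

Section Gluing.
Context {T : topologicalType} (E : T -> T -> Prop).
Local Open Scope quotient_scope.

Let gluing_rel_bool (x y : T) : bool :=
  `[< Relations.Relation_Operators.clos_refl_sym_trans T E x y >].

Lemma gluing_rel_refl : reflexive gluing_rel_bool.
Proof. by move=> x; apply/asboolP/Relations.Relation_Operators.rst_refl. Qed.
Lemma gluing_rel_sym : symmetric gluing_rel_bool.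
Proof.
by move=> x y; apply/asboolP/asboolP => xy;
  apply: Relations.Relation_Operators.rst_sym.
Qed.
Lemma gluing_rel_trans : transitive gluing_rel_bool.
Proof.
move=> y x z /asboolP xy /asboolP yz; apply/asboolP.
exact: Relations.Relation_Operators.rst_trans yz.
Qed.

(* The equivalence relation generated by E. *)
Definition gluing_rel :=
  EquivRel _ gluing_rel_refl gluing_rel_sym gluing_rel_trans.

Definition gluing := {eq_quot gluing_rel}.
HB.instance Definition _ := Topological.copy gluing (quotient_topology gluing).
HB.instance Definition _ := Quotient.on gluing.

Definition glue_pi (x : T) : gluing := \pi_gluing x.

End Gluing.

Definition homeomorphism (X Y : topologicalType) (f : X -> Y) : Prop :=
  continuous f /\
  exists g : Y -> X, [/\ continuous g, cancel f g & cancel g f].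

Section ComplexTopology.
Variable R : realType.
HB.instance Definition _ := NormedModule.copy R[i] R[i]^o.
End ComplexTopology.

Section HalfPlane.
Variable R : realType.

Definition upper_half_plane : set R[i] := [set z | 0 < complex.Im z].

Definition HH := set_type upper_half_plane.
HB.instance Definition _ := Topological.on HH.

Definition Rez (z : HH) : R := complex.Re (val z).
Definition Imz (z : HH) : R := complex.Im (val z).

Definition homography (M : 'M[int]_2) (z : R[i]) : R[i] :=
  ((M 0 0)%:~R * z + (M 0 1)%:~R) / ((M 1 0)%:~R * z + (M 1 1)%:~R).

Lemma homographyN (M : 'M[int]_2) (z : R[i]) :
  homography (- M) z = homography M z.
Proof.
by rewrite /homography !mxE !rmorphN !mulNr -!opprD invrN mulrNN.
Qed.

Lemma homography_subproof (M : SL2Z) (z : HH) :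
  homography (val M) (val z) \in upper_half_plane.
Proof.
rewrite inE /upper_half_plane /=; have /set_mem := valP z.
have /eqP := valP M; rewrite det_mx22 /homography /=.
move: (sval M) (sval z) => N [x y] /= detN.
rewrite -!(rmorph_int (real_complex R)) /=.
have {detN} : (N 0 0)%:~R * (N 1 1)%:~R - (N 0 1)%:~R * (N 1 0)%:~R = 1 :> R.
  by rewrite -!rmorphM -rmorphB detN.
move: (N 0 0)%:~R (N 0 1)%:~R (N 1 0)%:~R (N 1 1)%:~R => a b c d detM y_gt0.
rewrite /upper_half_plane /=.
have n_gt0 : 0 < (c * x + d) ^+ 2 + (c * y) ^+ 2.
  rewrite lt_def addr_ge0 ?sqr_ge0 // andbT paddr_eq0 ?sqr_ge0 // !sqrf_eq0.
  rewrite mulf_eq0 (gt_eqF y_gt0) orbF; apply/negP => /andP[/eqP cxd /eqP c0].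
  move: detM cxd; rewrite c0 mul0r add0r => + d0; rewrite d0 !mulr0 subrr.
  by move/esym/eqP; rewrite oner_eq0.
simpc.
set n := _ + _ in n_gt0; rewrite -/n.
rewrite [ltRHS](_ : _ = y / n) ?divr_gt0 //.
transitivity ((a * d - b * c) * y / n); last by rewrite detM mul1r.
by field; rewrite gt_eqF.
Qed.

Definition actSL (M : SL2Z) (z : HH) : HH :=
  exist _ (homography (val M) (val z)) (homography_subproof M z).

Definition actG (g : PSL2Z) (z : HH) : HH := actSL (repr g) z.

Lemma actG_projG (M : SL2Z) (z : HH) : actG (projG M) z = actSL M z.
Proof.
apply: val_inj => /=.
by have /orP[/eqP->|/eqP->] := repr_projG M; rewrite ?homographyN.
Qed.

End HalfPlane.

Section OrbitSpaces.
Variable R : realType.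
Local Notation H := (HH R).
Implicit Types (z w : H) (Gam : set PSL2Z) (X D : set H).

Definition orbit_rel Gam z w : Prop := exists2 g, Gam g & actG g z = w.

(* The orbit space of the half-plane under Gam, with the quotient topology. *)
Definition quotient_HH Gam := gluing (orbit_rel Gam).

(* Same for a part X of the half-plane with the subspace topology; X is meant
   to be stable under Gam. *)
Definition quotient_part X Gam :=
  gluing (fun x y : set_type X => orbit_rel Gam (val x) (val y)).

Definition stable_part Gam X : Prop :=
  forall g z, Gam g -> X z -> X (actG g z).

(* Free and properly discontinuous action: the projection to the orbit space is
   a covering, so that the hyperbolic metric descends to the orbit space. *)
Definition covering_action Gam : Prop :=
  is_subgroup Gam /\
  forall z, exists2 U, nbhs z U &
    forall g w, Gam g -> U w -> U (actG g w) -> g = 1%g.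

(* cosh (hdist z w) = 1 + |z - w|^2 / (2 Im z Im w). *)
Definition hdist z w : R :=
  let c := 1 + ((Rez z - Rez w) ^+ 2 + (Imz z - Imz w) ^+ 2)
               / (2 * Imz z * Imz w) in
  ln (c + Num.sqrt (c ^+ 2 - 1)).

Definition geodesic_segment X : Prop :=
  exists (L : R) (gam : R -> H), [/\ 0 <= L,
    forall s t, 0 <= s <= L -> 0 <= t <= L -> hdist (gam s) (gam t) = `|s - t|
    & X = gam @` [set t | 0 <= t <= L]].

(* The trace of a class in PSL(2,Z) is defined up to sign. *)
Definition parabolic (g : PSL2Z) : Prop :=
  g <> 1%g /\ (\tr (val (repr g))) ^+ 2 = 4.

(* Horoballs centred at infinity, and at the real point a. *)
Definition horoball D : Prop :=
  exists2 t : R, 0 < t &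
    D = [set z | t < Imz z] \/
    exists a : R, D = [set z | t * ((Rez z - a) ^+ 2 + Imz z ^+ 2) < Imz z].

(* The image of D in the orbit space of Gam is the cusp region D / <c>. *)
Definition cusp_region Gam (c : PSL2Z) D : Prop :=
  [/\ horoball D, Gam c, parabolic c, actG c @` D = D &
      forall g z, Gam g -> D z -> D (actG g z) -> generated [set c] g].

End OrbitSpaces.

Section Models.
Variable R : realType.

Definition torus : set (R[i] * R[i]) :=
  [set z | `|z| = 1] `*` [set z | `|z| = 1].

Definition hex_vertex (k : int) : R[i] :=
  Complex (cos (k%:~R * pi / 3)) (sin (k%:~R * pi / 3)).

(* The closed regular hexagon in the plane, as a convex hull. *)
Definition hexagon : set R[i] :=
  [set z | exists t : 'I_6 -> R, [/\ forall k, 0 <= t k, \sum_k t k = 1 &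
     z = \sum_k real_complex R (t k) * hex_vertex (k : nat)%:Z]].

(* Edges are indexed modulo 6, edges k and k + 3 being opposite. *)
Definition hex_edge (k : int) : set R[i] :=
  [set z | exists2 t : R, 0 <= t <= 1 &
     z = real_complex R (1 - t) * hex_vertex k
         + real_complex R t * hex_vertex (k + 1)].

(* The quotient of the half-plane by Gam is a hyperbolic once-punctured torus
   whose puncture p is a cusp with parabolic element c. *)
Definition once_punctured_torus_with_cusp (Gam : set PSL2Z) (c : PSL2Z) :
    Prop :=
  covering_action R Gam /\
  exists (p : R[i] * R[i])
         (phi : quotient_HH R Gam -> set_type (torus `\ p)),
    [/\ torus p, homeomorphism phi &
    exists2 D, cusp_region Gam c D &
      \forall x \near p, (torus `\ p) x ->
        exists2 z : HH R, D z & val (phi (glue_pi (orbit_rel Gam) z)) = x].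

(* X / Gam is a hyperbolic surface with boundary, homeomorphic to a closed
   hexagon minus its centre; the k-th edge corresponds to the geodesic segment
   side k of X and the centre to a cusp with parabolic element c. *)
Definition punctured_hyperbolic_hexagon (X : set (HH R)) (Gam : set PSL2Z)
    (side : int -> set (HH R)) (c : PSL2Z) : Prop :=
  [/\ covering_action R Gam, stable_part Gam X,
      forall k, side k `<=` X /\ geodesic_segment (side k) &
  exists psi : quotient_part X Gam -> set_type (hexagon `\ (0 : R[i])),
    let proj (x : set_type X) : R[i] := val (psi (glue_pi _ x)) in
    [/\ homeomorphism psi,
        forall k, set_bij [set x | side k (val x)] (hex_edge k) proj &
    exists2 D, cusp_region Gam c D /\ D `<=` X &
      \forall w \near (0 : R[i]), (hexagon `\ (0 : R[i])) w ->
        exists2 x, D (val x) & proj x = w]].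

(* The identification, in X / Gam, of the point z of side k with (f k) z. *)
Definition side_pairing (X : set (HH R)) (Gam : set PSL2Z)
    (side : int -> set (HH R)) (f : int -> PSL2Z)
    (u v : quotient_part X Gam) : Prop :=
  exists (k : int) (x y : set_type X),
    [/\ side k (val x), val y = actG (f k) (val x), u = glue_pi _ x & v = glue_pi _ y].

End Models.

Section ModularTorus.
Variable R : realType.

Definition fundamental_domain : set (HH R) :=
  [set z | - (1 / 2) <= Rez z <= 1 / 2 /\ 1 <= `|val z|].

Definition Bdom (n : int) : set (HH R) :=
  actSL (expgz matA (- n)) @` fundamental_domain.

Definition Htilde : set (HH R) := \bigcup_(n in [set: int]) Bdom n.

(* The circular arc bounding Bdom n from below. *)
Definition Hside (n : int) : set (HH R) :=
  actSL (expgz matA (- n)) @`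
    [set z | - (1 / 2) <= Rez z <= 1 / 2 /\ `|val z| = 1].

End ModularTorus.

Arguments fundamental_domain : clear implicits.
Arguments Bdom : clear implicits.
Arguments Htilde : clear implicits.
Arguments Hside : clear implicits.

(* Main.v *)
Require Import Defs.
From HB Require Import structures.
From mathcomp Require Import all_boot all_order all_algebra.
From mathcomp Require Import all_classical all_reals all_analysis.
From mathcomp Require Import complex.
From mathcomp Require Import ring lra zify.
From Stdlib Require Relations.
Import Order.TTheory GRing.Theory Num.Theory.
Import numFieldNormedType.Exports.
Local Open Scope classical_set_scope.
Local Open Scope ring_scope.
Set Implicit Arguments.
Unset Strict Implicit.
Unset Printing Implicit Defensive.

(** Groups. Conjugation by A shifts the index of f_n, and
    f_(n+1) = f_n f_(n-1)^-1; hence the group F generated by f_(-2) and f_(-1)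
    contains all the f_n and is normalized by A. Since S A^n = A^(n+3) f_n,
    Euclid's algorithm writes every matrix as A^n k with k in F ([SL_coset]);
    so F contains all the commutators, and F is the derived subgroup
    ([derived_SL2Z]). Reduced words in the two generators are told apart by
    ping-pong on the four half-planes cut off by the ideal quadrilateral with
    vertices -1, 0, 1 and infinity ([ping_pong], [word_eval_inj]). As this only
    sees the action on the half-plane, it works up to sign and also shows that
    the projection to PSL(2,Z) is injective on F. Two congruence conditions,
    modulo 2 and 3, show that A^n is in F up to sign only if 6 divides n
    ([derived_expA]), which gives the index.

    Geometry. For z in the strip |Re z - n| <= 1/2 put rho z = |z - n|^2; the
    set H~ is defined by rho z >= 1, and its sides by rho z = 1. The map
    [hexmap] sends z to b (Re z) / rho z, where b runs along the boundary of a
    hexagon of the plane with period 6. It identifies H~ modulo z -> z + 6 with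
    the hexagon without its centre, and it turns f_n on side n into the lattice
    translation between two opposite edges ([fmat_side_hexmap]). The hexagon is
    a Voronoi cell of the lattice Z^2 ([lattice_hexagon]), so that, after
    composition with the projection of the plane to the torus, two points of H~
    have the same image exactly when they are related by translations by
    multiples of 6 and side pairings ([tmap_inj]). On the other hand, two
    points of H~ in the same orbit of the derived subgroup are related in the
    same way ([derived_pair]), and every orbit meets H~ ([reduce_derived]).
    Therefore the map from H~ to the torus extends to a map [umap] on the
    half-plane whose fibres are the orbits. It is continuous because near a
    point of H~ the half-plane is covered by finitely many tiles
    ([continuous_umap_Htilde]). All the maps in play are quotient maps for
    reasons of compactness ([compact_covering_quotient_map]); this yields the
    homeomorphisms of the punctured hexagon, of the orbit space and of the
    glued hexagon with their models.

    The action of the derived subgroup is free and properly discontinuous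
    because its elements are not elliptic ([derived_not_elliptic]), and the
    displacement of the other ones is bounded below near any given point
    ([displacement_bound]). *)

(** * Quotient maps, gluings and closed covers *)

Definition quotient_map (X Y : topologicalType) (f : X -> Y) : Prop :=
  [/\ continuous f, (forall y, exists x, f x = y) &
      forall V : set Y, open (f @^-1` V) -> open V].

Section QuotientMaps.
Import Relations.Relation_Operators.

Lemma glue_pi_eq (T : topologicalType) (E : T -> T -> Prop) (x y : T) :
  glue_pi E x = glue_pi E y <-> clos_refl_sym_trans T E x y.
Proof.
rewrite /glue_pi; split => [/eqmodP/asboolP //|xy].
by apply/eqmodP/asboolP.
Qed.

Lemma glue_pi_surj (T : topologicalType) (E : T -> T -> Prop) (q : gluing E) :
  exists x, glue_pi E x = q.
Proof. by exists (repr q); rewrite /glue_pi reprK. Qed.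

Lemma clos_rst_compat (T : Type) (U : Type) (E : T -> T -> Prop) (f : T -> U) :
  (forall x y, E x y -> f x = f y) ->
  forall x y, clos_refl_sym_trans T E x y -> f x = f y.
Proof. by move=> fE x y; elim=> {x y} [x y /fE|x|x y _ ->|x y z _ -> _ ->]. Qed.

(** The inverse picks any preimage of a point; since f is a quotient map,
    continuity of the inverse can be tested after composing with f, where it
    becomes the gluing projection. *)
Lemma gluing_homeo (T Y : topologicalType) (E : T -> T -> Prop) (f : T -> Y) :
  quotient_map f -> (forall x y, E x y -> f x = f y) ->
  (forall x y, f x = f y -> clos_refl_sym_trans T E x y) ->
  exists2 Phi : gluing E -> Y, homeomorphism Phi &
    forall x, Phi (glue_pi E x) = f x.
Proof.
move=> [fc fs fq] fE fI.
pose Phi (q : gluing E) := f (repr q).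
have PhiE x : Phi (glue_pi E x) = f x.
  apply: (clos_rst_compat fE); apply/glue_pi_eq.
  by rewrite /glue_pi reprK.
exists Phi => //; split.
  apply/quotient_continuous; rewrite (_ : _ \o _ = f) //.
  by apply/funext => x /=; exact: PhiE.
have [s sK] := choice fs.
exists (fun y => glue_pi E (s y)); split.
- apply/continuousP => A oA; apply: fq.
  rewrite (_ : _ @^-1` _ = glue_pi E @^-1` A) //.
  apply/funext => x; rewrite /preimage /= (_ : glue_pi E (s (f x)) = glue_pi E x) //.
  by apply/glue_pi_eq/fI; rewrite sK.
- move=> q; have [x <-] := glue_pi_surj q.
  by apply/glue_pi_eq/fI; rewrite sK PhiE.
- by move=> y; rewrite PhiE sK.
Qed.

Lemma quotient_map_factor (X Y Z : topologicalType) (p : X -> Y) (f : Y -> Z)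
    (g : X -> Z) :
  continuous p -> continuous f -> (forall x, f (p x) = g x) -> quotient_map g ->
  quotient_map f.
Proof.
move=> pc fc fpE [gc gs gq]; split=> //.
  by move=> z; have [x <-] := gs z; exists (p x); rewrite fpE.
move=> V oV; apply: gq; rewrite (_ : g = f \o p); last by apply/funext => x; rewrite /= fpE.
by rewrite comp_preimage; apply: open_comp.
Qed.

Lemma gluing_factor (X Z : topologicalType) (E : X -> X -> Prop) (g : X -> Z) :
  quotient_map g -> (forall x y, E x y -> g x = g y) ->
  exists2 f : gluing E -> Z, quotient_map f & forall x, f (glue_pi E x) = g x.
Proof.
move=> gq gE.
pose f (q : gluing E) := g (repr q).
have fE x : f (glue_pi E x) = g x.
  by apply: (clos_rst_compat gE); apply/glue_pi_eq; rewrite /glue_pi reprK.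
exists f => //; apply: (@quotient_map_factor _ _ _ (glue_pi E) f g) => //.
  exact: pi_continuous.
apply/quotient_continuous; rewrite (_ : _ \o _ = g); first by case: gq.
by apply/funext => x /=; exact: fE.
Qed.

Lemma homeomorphism_comp_inv (X Y Z : topologicalType) (f : X -> Z) (g : Y -> Z) :
  homeomorphism f -> homeomorphism g ->
  exists2 h : X -> Y, homeomorphism h & forall x, g (h x) = f x.
Proof.
move=> [fc [f1 [f1c fK f1K]]] [gc [g1 [g1c gK g1K]]].
exists (g1 \o f); last by move=> x /=; rewrite g1K.
split; first by move=> x; exact: (@continuous_comp _ _ _ f g1 x (fc x) (g1c _)).
exists (f1 \o g); split.
- by move=> x; exact: (@continuous_comp _ _ _ g f1 x (gc x) (f1c _)).
- by move=> x /=; rewrite g1K fK.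
- by move=> x /=; rewrite f1K gK.
Qed.

(** Suppose that the preimage of C is closed and that y adheres to C. Near y,
    the set C is contained in the image of the compact part of K that lies
    over C; this image is compact, hence closed, so it contains y. *)
Lemma compact_covering_quotient_map (X Y : topologicalType) (f : X -> Y) :
  hausdorff_space Y -> continuous f -> (forall y, exists x, f x = y) ->
  (forall y : Y, exists2 K : set X, compact K & nbhs y (f @` K)) ->
  quotient_map f.
Proof.
move=> hY fc fs fK; split=> // V oV.
rewrite -(setCK V) openC; set C := ~` V.
have cC : closed (f @^-1` C) by rewrite -preimage_setC closedC.
move=> y Cy; have [K cK nK] := fK y.
have cKC : closed (f @` (K `&` f @^-1` C)).
  apply: (compact_closed hY); apply: continuous_compact.
    exact: continuous_subspaceT.
  exact: compact_closedI.
have [x [_ /= Cfx] <-] : (f @` (K `&` f @^-1` C)) y; last by [].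
apply: cKC => U nU.
have [z [Cz [[x Kx xz] Uz]]] := Cy _ (filterI nK nU).
by exists z; split=> //; exists x => //; split=> //; rewrite /preimage /= xz.
Qed.
End QuotientMaps.

(** A finite closed cover near x0: the pieces that miss x0 can be avoided in a
    neighbourhood of x0, and on each of the others f agrees with a function
    that is continuous at x0. *)
Lemma continuous_at_patch (X Y : topologicalType) (I : Type) (r : seq I)
    (A : I -> set X) (h : I -> X -> Y) (f : X -> Y) (x0 : X) :
  (forall i, List.In i r -> closed (A i)) ->
  (forall i, List.In i r -> A i x0 -> {for x0, continuous (h i)}) ->
  (forall i x, List.In i r -> A i x -> f x = h i x) ->
  (\forall x \near x0, exists2 i, List.In i r & A i x) ->
  {for x0, continuous f}.
Proof.
move=> cA hc fh cov V nV.
have near_i i : List.In i r -> \forall x \near x0, A i x -> V (f x).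
  move=> ri; have [Ax0|nAx0] := pselect (A i x0).
    have nV' : nbhs (h i x0) V by rewrite -(fh i).
    have := hc _ ri Ax0 _ nV'; rewrite nbhs_simpl /=.
    apply: filter_app; apply: nearW => x Vx Ax; by rewrite (fh i).
  have : nbhs x0 (~` A i) by apply: open_nbhs_nbhs; split=> //; apply/closed_openC/cA.
  by apply: filter_app; apply: nearW => x.
have all_i : \forall x \near x0, forall i, List.In i r -> A i x -> V (f x).
  elim: r {cA hc cov fh} near_i => [|i r IH] near_i.
    by apply: nearW => x i [].
  have := IH (fun j rj => near_i j (or_intror rj)).
  have := near_i i (or_introl erefl).
  apply: filter_app2; apply: nearW => x Vi Vr j [<-//|].
  exact: Vr.
rewrite nbhs_simpl /=; move: all_i cov; apply: filter_app2.
by apply: nearW => x Vx [i ri Ai]; exact: Vx Ai.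
Qed.

Section SetTypes.
Lemma continuous_val (X : topologicalType) (A : set X) :
  continuous (val : set_type A -> X).
Proof. by have := @initial_continuous (set_type A) X set_val. Qed.

Lemma continuous_to_set_type (X Y : topologicalType) (A : set X)
    (f : Y -> set_type A) :
  continuous (fun y => val (f y)) -> continuous f.
Proof. by move=> fc; apply: continuous_comp_initial. Qed.

Lemma nbhs_set_type (X : topologicalType) (A : set X) (x : set_type A) (U : set X) :
  nbhs (val x) U -> nbhs x [set y | U (val y)].
Proof. by move=> nU; exact: (@continuous_val X A x). Qed.
End SetTypes.

Section ComplexContinuity.
Variable R : realType.

Lemma continuous_Re : continuous (fun z : R[i] => complex.Re z).
Proof.
move=> z; apply/(@cvgrPdist_lt R R _ _ (nbhs_filter z)) => e e0.
near=> w.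
have : `|z - w| < real_complex R e.
  near: w; apply: (@cvgr_dist_lt R[i] R[i] _ (nbhs z)) => //.
  by rewrite ltcR.
move=> h; rewrite -ltcR; apply: le_lt_trans h.
rewrite -raddfB; exact: normc_ge_Re.
Unshelve. all: by end_near. Qed.

Lemma continuous_Im : continuous (fun z : R[i] => complex.Im z).
Proof.
move=> z; apply/(@cvgrPdist_lt R R _ _ (nbhs_filter z)) => e e0.
near=> w.
have : `|z - w| < real_complex R e.
  near: w; apply: (@cvgr_dist_lt R[i] R[i] _ (nbhs z)) => //.
  by rewrite ltcR.
move=> h; rewrite -ltcR; apply: le_lt_trans h.
rewrite -raddfB; case: (z - w) => a b /=; rewrite normc_def lecR /=.
by rewrite -sqrtr_sqr ler_wsqrtr // lerDr sqr_ge0.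
Unshelve. all: by end_near. Qed.

Lemma continuous_Complex (T : topologicalType) (a b : T -> R) :
  continuous a -> continuous b -> continuous (fun p => Complex (a p) (b p)).
Proof.
move=> ac bc p; apply/(@cvgrPdist_lt R[i] R[i] _ _ (nbhs_filter p)) => -[e e'].
rewrite ltcE /= => /andP[/eqP -> e0].
have e20 : 0 < e / 2 by rewrite divr_gt0.
near=> q.
rewrite (_ : _ - _ = Complex (a p - a q) (b p - b q)); last by simpc.
rewrite normc_def ltcR /= -(ger0_norm (ltW e0)) -sqrtr_sqr ltr_sqrt ?exprn_gt0 //.
have : `|a p - a q| < e / 2.
  by near: q; apply: (@cvgr_dist_lt R R _ (nbhs p) _ a) => //; exact: ac.
have : `|b p - b q| < e / 2.
  by near: q; apply: (@cvgr_dist_lt R R _ (nbhs p) _ b) => //; exact: bc.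
rewrite !ltr_norml; move: (a p - a q) (b p - b q) => x y.
move=> /andP[y1 y2] /andP[x1 x2].
nra.
Unshelve. all: by end_near. Qed.

Lemma continuous_to_complex (T : topologicalType) (f : T -> R[i]) :
  continuous (fun p => complex.Re (f p)) -> continuous (fun p => complex.Im (f p)) ->
  continuous f.
Proof.
move=> rc ic; rewrite (_ : f = fun p => Complex (complex.Re (f p)) (complex.Im (f p))).
  exact: continuous_Complex.
by apply/funext => p; case: (f p).
Qed.

Lemma complex_hausdorff : hausdorff_space R[i].
Proof. exact: (@norm_hausdorff R[i] R[i]). Qed.
Lemma complex2_hausdorff : hausdorff_space (R[i] * R[i])%type.
Proof.
move=> [x1 x2] [y1 y2] xy; congr pair; apply: complex_hausdorff => U V nU nV.
- have [|| [z1 z2] [/= zU zV]] := xy [set z | U z.1] [set z | V z.1].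
  + exact: (@cvg_fst _ _ (nbhs x1) (nbhs x2)).
  + exact: (@cvg_fst _ _ (nbhs y1) (nbhs y2)).
  + by exists z1.
- have [|| [z1 z2] [/= zU zV]] := xy [set z | U z.2] [set z | V z.2].
  + exact: (@cvg_snd _ _ (nbhs x1) (nbhs x2)).
  + exact: (@cvg_snd _ _ (nbhs y1) (nbhs y2)).
  + by exists z2.
Qed.

Lemma set_type_hausdorff (X : topologicalType) (A : set X) :
  hausdorff_space X -> hausdorff_space (set_type A).
Proof.
move=> hX x y xy; apply: val_inj; apply: hX => U V nU nV.
have [z [zU zV]] := xy _ _ (nbhs_set_type nU) (nbhs_set_type nV).
by exists (val z).
Qed.
End ComplexContinuity.

(** * Subgroups, integer powers and derived subgroups *)

Section Subgroups.
Variable gT : groupType.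
Implicit Types (K X : set gT) (x y : gT).

Lemma is_subgroupP K : is_subgroup K <->
  K 1%g /\ forall x y, K x -> K y -> K (x * y^-1)%g.
Proof.
rewrite /is_subgroup /group_closed; split=> -[h1 h2]; split.
- by move: h1; rewrite inE.
- by move=> x y Kx Ky; have := h2 x y; rewrite !inE; apply.
- by rewrite inE.
- by move=> x y; rewrite !inE => Kx Ky; exact: h2.
Qed.

Lemma subgroup1 K : is_subgroup K -> K 1%g.
Proof. by move=> /is_subgroupP[]. Qed.

Lemma subgroupV K x : is_subgroup K -> K x -> K x^-1%g.
Proof. by move=> /is_subgroupP[K1 KD] Kx; rewrite -[_^-1%g]mul1g; apply: KD. Qed.

Lemma subgroupM K x y : is_subgroup K -> K x -> K y -> K (x * y)%g.
Proof.
move=> KG Kx Ky; have /is_subgroupP[K1 KD] := KG.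
by rewrite -[y]invgK; apply: KD => //; exact: subgroupV.
Qed.

Lemma generated_subgroup X : is_subgroup (generated X).
Proof.
apply/is_subgroupP; split; first by move=> K [/subgroup1 ? _].
move=> x y gx gy K [KG XK]; apply: subgroupM => //; first exact: gx.
by apply: subgroupV => //; exact: gy.
Qed.

Lemma sub_generated X : X `<=` generated X.
Proof. by move=> x Xx K [_]; apply. Qed.

Lemma generated_sub X K : is_subgroup K -> X `<=` K -> generated X `<=` K.
Proof. by move=> KG XK x; apply. Qed.

Lemma derived_is_subgroup : is_subgroup (derived_subgroup gT).
Proof. exact: generated_subgroup. Qed.

Lemma derived_commg x y : derived_subgroup gT [~ x, y]%g.
Proof. by apply: sub_generated; exists x, y. Qed.

Lemma derived_conj x y : derived_subgroup gT x -> derived_subgroup gT (y^-1 * x * y)%g.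
Proof.
move=> dx; have -> : (y^-1 * x * y = x * [~ x, y])%g.
  by rewrite commgEl conjgE !mulgA mulgV mul1g.
exact: subgroupM derived_is_subgroup dx (derived_commg _ _).
Qed.

Lemma expgzS x (n : int) : expgz x (n + 1) = (expgz x n * x)%g.
Proof.
case: n => [n|[|n]]; rewrite ?NegzE /expgz.
- by rewrite -PoszD addn1 expgSr.
- by rewrite /= mulVg.
- rewrite (_ : - _ + 1 = Negz n); last by rewrite NegzE; lia.
  rewrite -NegzE /= (expgS _ n.+1) invgM.
  by rewrite -mulgA mulVg mulg1.
Qed.

Lemma expgzP x (n : int) : expgz x (n - 1) = (expgz x n * x^-1)%g.
Proof. by rewrite -{2}(subrK 1 n) expgzS mulgK. Qed.

Lemma expgzD x (m n : int) : expgz x (m + n) = (expgz x m * expgz x n)%g.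
Proof.
elim/int_ind: n => [|n IH|n IH]; first by rewrite addr0 mulg1.
  by rewrite -addn1 PoszD addrA !expgzS IH mulgA.
by rewrite -addn1 PoszD opprD addrA !expgzP IH mulgA.
Qed.

Lemma expgzN x (n : int) : expgz x (- n) = (expgz x n)^-1%g.
Proof. by apply: (mulgI (expgz x n)); rewrite -expgzD subrr mulgV. Qed.

Lemma expgz_subgroup K x n : is_subgroup K -> K x -> K (expgz x n).
Proof.
move=> KG Kx; elim/int_ind: n => [|n IH|n IH]; first exact: subgroup1.
  by rewrite -addn1 PoszD expgzS; apply: subgroupM.
by rewrite -addn1 PoszD opprD expgzP; apply: subgroupM => //; apply: subgroupV.
Qed.

Lemma generated_set1 x : generated [set x] = [set expgz x n | n in [set: int]].
Proof.
apply/seteqP; split; last first.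
  move=> _ [n _ <-]; apply: (expgz_subgroup n (generated_subgroup _)).
  exact: sub_generated.
apply: generated_sub => [|_ ->]; last by exists 1.
apply/is_subgroupP; split; first by exists 0.
by move=> _ _ [m _ <-] [n _ <-]; exists (m - n) => //; rewrite expgzD expgzN.
Qed.

End Subgroups.

Section Images.
Variables (gT hT : groupType) (f : gT -> hT).
Hypothesis fM : {morph f : x y / (x * y)%g}.

Lemma morph1g : f 1%g = 1%g.
Proof. by apply: (mulgI (f 1%g)); rewrite -fM !mulg1. Qed.
Lemma morphVg x : f x^-1%g = (f x)^-1%g.
Proof. by apply: (mulgI (f x)); rewrite -fM !mulgV morph1g. Qed.
Lemma morph_expgz x n : f (expgz x n) = expgz (f x) n.
Proof.
elim/int_ind: n => [|n IH|n IH]; first by rewrite morph1g.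
  by rewrite -addn1 PoszD !expgzS fM IH.
by rewrite -addn1 PoszD opprD !expgzP fM IH morphVg.
Qed.

Lemma image_generated X : f @` generated X = generated (f @` X).
Proof.
apply/seteqP; split.
  suff : generated X `<=` f @^-1` generated (f @` X) by move=> h _ [x /h ? <-].
  have G := generated_subgroup (f @` X).
  apply: generated_sub => [|x Xx]; last by apply: sub_generated; exists x.
  apply/is_subgroupP; split; first by rewrite /preimage /= morph1g; exact: subgroup1.
  move=> x y; rewrite /preimage /= => gx gy; rewrite fM morphVg.
  by apply: (subgroupM G) => //; exact: (subgroupV G).
have G := generated_subgroup X.
apply: generated_sub => [|_ [x Xx <-]]; last by exists x => //; exact: sub_generated.
apply/is_subgroupP; split; first by exists 1%g; [exact: subgroup1|exact: morph1g].
move=> _ _ [x gx <-] [y gy <-]; exists (x * y^-1)%g; last by rewrite fM morphVg.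
by apply: (subgroupM G) => //; exact: (subgroupV G).
Qed.

Lemma image_derived : (forall y, exists x, f x = y) ->
  f @` derived_subgroup gT = derived_subgroup hT.
Proof.
move=> fs; rewrite /derived_subgroup image_generated; congr generated.
have fR x y : f [~ x, y]%g = [~ f x, f y]%g.
  by rewrite !commgEl !conjgE !fM !morphVg.
apply/seteqP; split=> [_ [_ [x [y ->]] <-]|_ [x [y ->]]].
  by exists (f x), (f y).
have [[x' <-] [y' <-]] := (fs x, fs y).
by exists [~ x', y']%g => //; exists x', y'.
Qed.
End Images.

(** * Matrices of determinant one *)

Section ModularGroup.
Implicit Types M N : SL2Z.

Lemma ord2P (P : 'I_2 -> Prop) : P 0 -> P 1 -> forall i, P i.
Proof.
move=> P0 P1 [[|[|//]] i]; [move: P0|move: P1];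
  by congr P; apply: val_inj.
Qed.

Lemma detSL M : val M 0 0 * val M 1 1 - val M 0 1 * val M 1 0 = 1.
Proof. by have /eqP := valP M; rewrite det_mx22. Qed.

Lemma mat2_eta (M : 'M[int]_2) : M = mat2 (M 0 0) (M 0 1) (M 1 0) (M 1 1).
Proof. by apply/matrixP; apply: ord2P; apply: ord2P; rewrite !mxE. Qed.

Lemma mat2_mul a b c d a' b' c' d' : mat2 a b c d *m mat2 a' b' c' d' =
  mat2 (a * a' + b * c') (a * b' + b * d') (c * a' + d * c') (c * b' + d * d').
Proof.
apply/matrixP; apply: ord2P; apply: ord2P; rewrite !mxE !big_ord_recl big_ord0 addr0 !mxE //=.
Qed.

Lemma mat2_opp a b c d : - mat2 a b c d = mat2 (- a) (- b) (- c) (- d).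
Proof. by apply/matrixP; apply: ord2P; apply: ord2P; rewrite !mxE. Qed.

Lemma mulSLE M N : val (M * N)%g = val M *m val N. Proof. by []. Qed.

(** Matrix identities below are checked entry by entry in this form, which
    reduces them to ring identities between integers. *)
Lemma mulSL_mat2 M N a b c d a' b' c' d' :
  val M = mat2 a b c d -> val N = mat2 a' b' c' d' -> val (M * N)%g =
  mat2 (a * a' + b * c') (a * b' + b * d') (c * a' + d * c') (c * b' + d * d').
Proof. by move=> hM hN; rewrite mulSLE hM hN mat2_mul. Qed.

Lemma invSL_mat2 M a b c d : val M = mat2 a b c d -> val M^-1%g = mat2 d (- b) (- c) a.
Proof.
move=> hM; have := detSL M; rewrite hM !mxE /= => dM.
have e : val M *m mat2 d (- b) (- c) a = 1%:M.
  rewrite hM mat2_mul; apply/matrixP; apply: ord2P; apply: ord2P; rewrite !mxE /=.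
  - by rewrite -dM; ring.
  - ring.
  - ring.
  - by rewrite -dM; ring.
by rewrite -[RHS]mul1mx -(mulVmx (SL2Z_unitmx M)) -mulmxA e mulmx1.
Qed.

Lemma val_expA n : val (expgz matA n) = mat2 1 (- n) 0 1.
Proof.
elim/int_ind: n => [|n IH|n IH].
- by rewrite [LHS]mat2_eta /= !mxE.
- rewrite (_ : Posz n.+1 = n%:Z + 1); last by rewrite -PoszD addn1.
  rewrite expgzS (mulSL_mat2 IH (erefl (val matA))); congr mat2; ring.
- rewrite (_ : - Posz n.+1 = - n%:Z - 1); last by rewrite -opprD -PoszD addn1.
  rewrite expgzP (mulSL_mat2 IH (invSL_mat2 (erefl (val matA)))).
  congr mat2; ring.
Qed.

Lemma val_matS : val matS = mat2 0 (-1) 1 0.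
Proof.
rewrite /matS (mulSL_mat2 (mulSL_mat2 (erefl (val matA)) (erefl (val matB))) (erefl (val matA))).
by congr mat2.
Qed.

Lemma val_fmat n : val (fmat n) = mat2 (n + 3) (- n * (n + 3) - 1) 1 (- n).
Proof.
rewrite /fmat (mulSL_mat2 (mulSL_mat2 (val_expA _) val_matS) (val_expA n)).
congr mat2; ring.
Qed.

Lemma val_fm2 : val (fmat (- 2)) = mat2 1 1 1 2. Proof. by rewrite val_fmat. Qed.
Lemma val_fm1 : val (fmat (- 1)) = mat2 2 1 1 1. Proof. by rewrite val_fmat. Qed.

Lemma fm2E : fmat (- 2) = (matB * matA^-1)%g.
Proof.
apply: val_inj; rewrite val_fm2.
by rewrite (mulSL_mat2 (erefl (val matB)) (invSL_mat2 (erefl (val matA)))); congr mat2.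
Qed.

Lemma fm1E : fmat (- 1) = (matA^-1 * matB)%g.
Proof.
apply: val_inj; rewrite val_fm1.
by rewrite (mulSL_mat2 (invSL_mat2 (erefl (val matA))) (erefl (val matB))); congr mat2.
Qed.

(** The parabolic element of the cusp: it acts on the half-plane by the
    translation by 6. *)
Definition cuspSL : SL2Z := (expgz matA (- 6) * matS ^+ 2)%g.

Lemma val_cuspSL : val cuspSL = mat2 (-1) (-6) 0 (-1).
Proof.
rewrite /cuspSL expgS expg1 (mulSL_mat2 (val_expA _) (mulSL_mat2 val_matS val_matS)).
by congr mat2.
Qed.

Lemma cuspSLE : cuspSL = [~ (fmat (- 1))^-1, fmat (- 2)]%g.
Proof.
rewrite commgEl conjgE invgK; apply: val_inj; rewrite val_cuspSL.
have i1 := invSL_mat2 val_fm1; have i2 := invSL_mat2 val_fm2.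
rewrite (mulSL_mat2 val_fm1 (mulSL_mat2 i2 (mulSL_mat2 i1 val_fm2))).
by congr mat2.
Qed.

Lemma fmat_conj n : (matA * fmat n * matA^-1)%g = fmat (n - 1).
Proof.
have iA := invSL_mat2 (erefl (val matA)).
apply: val_inj; rewrite (mulSL_mat2 (mulSL_mat2 (erefl (val matA)) (val_fmat n)) iA).
by rewrite val_fmat; congr mat2; ring.
Qed.

Lemma fmat_conjV n : (matA^-1 * fmat n * matA)%g = fmat (n + 1).
Proof.
have iA := invSL_mat2 (erefl (val matA)).
apply: val_inj; rewrite (mulSL_mat2 (mulSL_mat2 iA (val_fmat n)) (erefl (val matA))).
by rewrite val_fmat; congr mat2; ring.
Qed.

Lemma fmat_rec n : fmat (n + 1) = (fmat n * (fmat (n - 1))^-1)%g.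
Proof.
apply: val_inj; rewrite (mulSL_mat2 (val_fmat n) (invSL_mat2 (val_fmat _))) val_fmat.
congr mat2; ring.
Qed.

Lemma oppSL_S2 M : val (M * (matS * matS))%g = - val M.
Proof.
by rewrite mulSLE (mulSL_mat2 val_matS val_matS) [val M]mat2_eta mat2_mul mat2_opp; congr mat2; ring.
Qed.

Lemma projGM : {morph projG : M N / (M * N)%g}.
Proof. exact: projG_mul. Qed.
Lemma projG_surj g : exists M, projG M = g.
Proof. by exists (repr g); exact: projG_repr. Qed.

End ModularGroup.

(** * The derived subgroup of SL(2,Z) *)

Lemma mulz_eq1 (a d : int) : a * d = 1 -> (a = 1 /\ d = 1) \/ (a = -1 /\ d = -1).
Proof.
move=> ad; have := intUnitRing.unitzPl ad; rewrite qualifE /= => /orP[] /eqP a1.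
  by left; split=> //; move: ad; rewrite a1; lia.
by right; split=> //; move: ad; rewrite a1; lia.
Qed.

Section DerivedSL2Z.
Implicit Types M N : SL2Z.

Definition fgen (b : bool) : SL2Z := if b then fmat (- 2) else fmat (- 1).

Definition fgroup : set SL2Z := generated [set fmat (- 2); fmat (- 1)].

Let fG : is_subgroup fgroup := generated_subgroup _.
Local Notation SL' := (derived_subgroup SL2Z).
Let dG : is_subgroup SL' := derived_is_subgroup SL2Z.

(** Since S A S^-1 = B, the matrix f_(-2) = B A^-1 is a commutator; the other
    f_n are its conjugates by powers of A. *)
Lemma fmat_in_derived n : SL' (fmat n).
Proof.
have d0 : SL' (fmat (- 2)).
  have -> : fmat (- 2) = [~ matS^-1, matA^-1]%g.
    apply: val_inj; rewrite val_fm2 commgEl conjgE !invgK.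
    have iA := invSL_mat2 (erefl (val matA)).
    rewrite (mulSL_mat2 val_matS (mulSL_mat2 (erefl (val matA))
      (mulSL_mat2 (invSL_mat2 val_matS) iA))).
    by congr mat2.
  exact: derived_commg.
have up m : SL' (fmat m) -> SL' (fmat (m + 1)).
  by move=> h; rewrite -fmat_conjV; apply: derived_conj.
have dn m : SL' (fmat m) -> SL' (fmat (m - 1)).
  by move=> h; rewrite -fmat_conj -{1}(invgK matA); apply: derived_conj.
rewrite (_ : n = (n + 2) - 2); last by rewrite addrK.
elim/int_ind: (n + 2) => [|m IH|m IH]; first by rewrite add0r.
  by rewrite -addn1 PoszD addrAC; exact: up.
by rewrite -addn1 PoszD opprD addrAC; exact: dn.
Qed.

(** The recursion f_(n+1) = f_n f_(n-1)^-1 can be run in both directions. *)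
Lemma fmat_in_fgroup n : fgroup (fmat n).
Proof.
have b1 : fgroup (fmat (- 1)) by apply: sub_generated; right.
have b2 : fgroup (fmat (- 2)) by apply: sub_generated; left.
suff : fgroup (fmat (n + 2 - 2)) /\ fgroup (fmat (n + 2 - 1)) by rewrite addrK => -[].
elim/int_ind: (n + 2) => [|m [IH1 IH2]|m [IH1 IH2]]; first by rewrite !add0r.
- rewrite (_ : Posz m.+1 - 2 = m%:Z - 1); last by lia.
  split=> //; rewrite (_ : Posz m.+1 - 1 = m%:Z - 1 + 1); last by lia.
  rewrite fmat_rec; apply: (subgroupM fG) => //; apply: (subgroupV fG).
  by rewrite (_ : _ - _ = m%:Z - 2) //; lia.
- rewrite (_ : - Posz m.+1 - 1 = - m%:Z - 2); last by lia.
  split=> //.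
  have := fmat_rec (- m%:Z - 2).
  rewrite (_ : - m%:Z - 2 + 1 = - m%:Z - 1); last by lia.
  rewrite (_ : - m%:Z - 2 - 1 = - Posz m.+1 - 2); last by lia.
  have e (x y z : SL2Z) : (x = y * z^-1 -> z = x^-1 * y)%g.
    by move=> ->; rewrite invgM invgK mulgVK.
  move=> /e ->.
  by apply: (subgroupM fG) => //; apply: (subgroupV fG).
Qed.

Lemma fgroup_conjA n k : fgroup k -> fgroup (expgz matA (- n) * k * expgz matA n)%g.
Proof.
rewrite expgzN; set a := expgz matA n.
suff : fgroup `<=` [set k | fgroup (a^-1 * k * a)%g] by apply.
apply: generated_sub => [|x].
  apply/is_subgroupP; split; first by rewrite /= mulg1 mulVg; exact: subgroup1.
  move=> x y /= fx fy.
  rewrite (_ : (_ * _ * _ = (a^-1 * x * a) * (a^-1 * y * a)^-1)%g).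
    by apply: (subgroupM fG) => //; exact: (subgroupV fG).
  by rewrite !invgM invgK !mulgA mulgK.
suff h j : fgroup (a^-1 * fmat j * a)%g by case=> /= ->.
rewrite (_ : (_ * _ * _)%g = fmat (j + n)); first exact: fmat_in_fgroup.
apply: val_inj; rewrite val_fmat.
rewrite (mulSL_mat2 (mulSL_mat2 (invSL_mat2 (val_expA n)) (val_fmat j)) (val_expA n)).
congr mat2; ring.
Qed.

(** Euclidean division on the first column reduces a matrix to a power of A,
    up to sign, by left multiplications by A and S. These preserve the set of
    the A^n k with k in the group generated by f_(-2) and f_(-1): indeed S A^n
    = A^(n+3) f_n, and conjugation by A stabilizes that group. *)
Lemma SL_coset M : exists n, fgroup (expgz matA (- n) * M)%g.
Proof.
pose X := [set M | exists n, fgroup (expgz matA (- n) * M)%g].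
have XA m N : X N -> X (expgz matA m * N)%g.
  move=> [n h]; exists (n + m).
  by rewrite mulgA -expgzD (_ : - (n + m) + m = - n) //; lia.
have XS N : X N -> X (matS * N)%g.
  move=> [n h]; exists (n + 3).
  rewrite (_ : expgz matA (- (n + 3)) * (matS * N) = fmat n * (expgz matA (- n) * N))%g.
    by apply: (subgroupM fG) => //; exact: fmat_in_fgroup.
  by rewrite /fmat !mulgA -(mulgA _ (expgz _ n)) -expgzD subrr mulg1.
have X1 : X 1%g by exists 0; rewrite mulg1; exact: subgroup1.
have XN N N' : val N' = - val N -> X N -> X N'.
  move=> e; have -> : N' = (matS * (matS * N))%g.
    apply: val_inj; rewrite e mulgA mulSLE (mulSL_mat2 val_matS val_matS).
    by rewrite [val N]mat2_eta mat2_mul mat2_opp; congr mat2; ring.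
  by move=> XN; do 2! apply: (XS _).
(* Induction on the absolute value of the lower left entry. *)
suff : forall n M, (absz (val M 1%R 0%R) <= n)%N -> X M by move=> /(_ _ M (leqnn _)).
elim=> [|n IH] {}M Mn.
  have c0 : val M 1 0 = 0 by lia.
  have := detSL M; rewrite c0 mulr0 subr0 => ad.
  have X2 N : val N 1 0 = 0 -> val N 0 0 = 1 -> val N 1 1 = 1 -> X N.
    move=> n10 n00 n11; rewrite -[N]mulg1.
    rewrite (_ : N = expgz matA (- val N 0 1)); first exact: XA.
    by apply: val_inj; rewrite val_expA [val N]mat2_eta n10 n00 n11 !mxE /= opprK.
  have [[a1 d1]|[a1 d1]] : (val M 0 0 = 1 /\ val M 1 1 = 1) \/ (val M 0 0 = -1 /\ val M 1 1 = -1).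
    exact: mulz_eq1.
  + exact: X2.
  + apply: (XN (M * (matS * matS))%g).
      by rewrite oppSL_S2 opprK.
    by apply: X2; rewrite oppSL_S2 mxE ?c0 ?a1 ?d1.
have [c0|c0] := eqVneq (val M 1 0) 0; first by apply: IH; rewrite c0.
pose q := divz (val M 0 0) (val M 1 0).
have e : val (matS * (expgz matA q * M))%g 1 0 = modz (val M 0 0) (val M 1 0).
  rewrite (mulSL_mat2 val_matS (mulSL_mat2 (val_expA q) (mat2_eta (val M)))) !mxE /=.
  rewrite [in LHS](divz_eq (val M 0 0) (val M 1 0)) -/q; ring.
have XM : X (matS * (expgz matA q * M))%g.
  apply: IH; rewrite e.
  have := modz_ge0 (val M 0 0) c0.
  have := ltz_mod (val M 0 0) c0.
  lia.
have -> : M = (expgz matA (- q) * (matS * (matS * (matS * (matS * (expgz matA q * M))))))%g.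
  (* S has order 4, so that S^-1 can be avoided. *)
  have S4 (N : SL2Z) : (matS * (matS * (matS * (matS * N))))%g = N.
    apply: val_inj; do 4! rewrite mulSLE.
    by rewrite val_matS [val N]mat2_eta !mat2_mul; congr mat2; ring.
  by rewrite S4 mulgA -expgzD addNr mul1g.
by apply: XA; do 3! apply: (XS _).
Qed.

(** Modulo the group generated by f_(-2) and f_(-1), every matrix is a power
    of A, so that all commutators become trivial. *)
Lemma derived_SL2Z : SL' = fgroup.
Proof.
apply/seteqP; split; last first.
  by apply: generated_sub => // _ [->|->]; exact: fmat_in_derived.
apply: generated_sub => // _ [x [y ->]].
have [m fx] := SL_coset x; have [n fy] := SL_coset y.
set k := (_ * x)%g in fx; set l := (_ * y)%g in fy.
have xE : x = (expgz matA m * k)%g by rewrite /k mulgA -expgzD subrr mul1g.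
have yE : y = (expgz matA n * l)%g by rewrite /l mulgA -expgzD subrr mul1g.
have e (u v : SL2Z) (i j : int) : (expgz matA i * u * (expgz matA j * v) =
    expgz matA (i + j) * (expgz matA (- j) * u * expgz matA j * v))%g.
  by rewrite !mulgA -expgzD -addrA subrr addr0.
rewrite (_ : [~ x, y]%g = (y * x)^-1 * (x * y))%g; last first.
  by rewrite commgEl conjgE invgM !mulgA.
have c (a u v : SL2Z) : ((a * u)^-1 * (a * v) = u^-1 * v)%g.
  by rewrite invgM -mulgA (mulgA _ a) mulVg mul1g.
rewrite xE yE !e (addrC n m) c.
by apply: (subgroupM fG); [apply: (subgroupV fG)|];
  apply: (subgroupM fG) => //; exact: fgroup_conjA.
Qed.

Lemma cuspSL_derived : SL' cuspSL.
Proof. rewrite cuspSLE; exact: derived_commg. Qed.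

(** For a matrix of determinant one over the field with two elements:
    membership in the subgroup of index 2. *)
Definition cong2 (F : comNzRingType) (a b c d : F) : bool :=
  (a + d == 1) || ((b == 0) && (c == 0)).
(** For a matrix of determinant one over the field with three elements:
    membership in the quaternion subgroup, of index 3. *)
Definition cong3 (F : comNzRingType) (a b c d : F) : bool :=
  (a + d == 0) || ((b == 0) && (c == 0)).

(** The four products are those by f_(-2), its inverse, f_(-1) and its inverse
    on the right. *)
Lemma cong2_step (a b c d : 'F_2) : a * d - b * c = 1 -> cong2 a b c d ->
  [/\ cong2 (a + b) (a + 2%:R * b) (c + d) (c + 2%:R * d),
      cong2 (2%:R * a - b) (b - a) (2%:R * c - d) (d - c),
      cong2 (2%:R * a + b) (a + b) (2%:R * c + d) (c + d) &
      cong2 (a - b) (2%:R * b - a) (c - d) (2%:R * d - c)].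
Proof.
move=> /eqP h1 h2; apply/and4P; move: h1 h2; rewrite /cong2.
by move: a b c d => [[|[|//]] ?] [[|[|//]] ?] [[|[|//]] ?] [[|[|//]] ?].
Qed.

Lemma cong3_step (a b c d : 'F_3) : a * d - b * c = 1 -> cong3 a b c d ->
  [/\ cong3 (a + b) (a + 2%:R * b) (c + d) (c + 2%:R * d),
      cong3 (2%:R * a - b) (b - a) (2%:R * c - d) (d - c),
      cong3 (2%:R * a + b) (a + b) (2%:R * c + d) (c + d) &
      cong3 (a - b) (2%:R * b - a) (c - d) (2%:R * d - c)].
Proof.
move=> /eqP h1 h2; apply/and4P; move: h1 h2; rewrite /cong3.
by move: a b c d => [[|[|[|//]]] ?] [[|[|[|//]]] ?] [[|[|[|//]]] ?] [[|[|[|//]]] ?].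
Qed.

Definition congruent6 (M : SL2Z) : Prop :=
  cong2 ((val M 0 0)%:~R : 'F_2) (val M 0 1)%:~R (val M 1 0)%:~R (val M 1 1)%:~R /\
  cong3 ((val M 0 0)%:~R : 'F_3) (val M 0 1)%:~R (val M 1 0)%:~R (val M 1 1)%:~R.

(** Both congruence conditions hold for the identity and are preserved by
    right multiplication by the two generators and their inverses. *)
Lemma derived_congruent6 M : SL' M -> congruent6 M.
Proof.
pose K := [set M | forall N, congruent6 N -> congruent6 (N * M)%g /\ congruent6 (N * M^-1)%g].
suff : fgroup `<=` K.
  rewrite derived_SL2Z => h /h /(_ 1%g) []; last by rewrite mul1g.
  by split; rewrite !mxE.
apply: generated_sub.
  apply/is_subgroupP; split; first by move=> N cN; rewrite invg1 !mulg1.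
  move=> x y Kx Ky N cN; split.
    by rewrite mulgA; apply: (proj2 (Ky _ _)); apply: (proj1 (Kx _ _)).
  by rewrite invgM invgK mulgA; apply: (proj2 (Kx _ _)); apply: (proj1 (Ky _ _)).
have det F N : ((val N 0 0)%:~R * (val N 1 1)%:~R - (val N 0 1)%:~R * (val N 1 0)%:~R = 1 :> 'F_F).
  by rewrite -!rmorphM -rmorphB detSL.
move=> M' [->|->] N [c2 c3].
- have [c21 c22 _ _] := cong2_step (det 2%N N) c2.
  have [c31 c32 _ _] := cong3_step (det 3%N N) c3.
  split; rewrite /congruent6.
    rewrite (mulSL_mat2 (mat2_eta (val N)) val_fm2) !mxE /=.
    by split; [move: c21|move: c31]; congr is_true; congr (_ _ _ _ _); rewrite rmorphD !rmorphM /=; ring.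
  rewrite (mulSL_mat2 (mat2_eta (val N)) (invSL_mat2 val_fm2)) !mxE /=.
  by split; [move: c22|move: c32]; congr is_true; congr (_ _ _ _ _); rewrite rmorphD !rmorphM /=; ring.
- have [_ _ c21 c22] := cong2_step (det 2%N N) c2.
  have [_ _ c31 c32] := cong3_step (det 3%N N) c3.
  split; rewrite /congruent6.
    rewrite (mulSL_mat2 (mat2_eta (val N)) val_fm1) !mxE /=.
    by split; [move: c21|move: c31]; congr is_true; congr (_ _ _ _ _); rewrite rmorphD !rmorphM /=; ring.
  rewrite (mulSL_mat2 (mat2_eta (val N)) (invSL_mat2 val_fm1)) !mxE /=.
  by split; [move: c22|move: c32]; congr is_true; congr (_ _ _ _ _); rewrite rmorphD !rmorphM /=; ring.
Qed.

Lemma intrF_eq0 (p : nat) (n : int) : prime p -> (n%:~R == 0 :> 'F_p) -> exists m, n = m * p%:Z.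
Proof.
move=> pp; have ch : p \in [pchar 'F_p] by exact: pchar_Fp.
by rewrite -(dvdz_pcharf ch) => /dvdzP.
Qed.

(** The condition modulo 2 forces n to be even, and the one modulo 3 forces n
    to be a multiple of 3. *)
Lemma derived_expA M n : SL' M -> eq_up_to_sign M (expgz matA n) -> exists m, n = 6 * m.
Proof.
move=> /derived_congruent6 [c2 c3] h.
have [e e1 eM] : exists2 e : int, e = 1 \/ e = -1 & val M = mat2 e (- e * n) 0 e.
  case/orP: h => /eqP; rewrite val_expA => h.
    by exists 1; [left|rewrite h; congr mat2; ring].
  by exists (-1); [right|rewrite h mat2_opp; congr mat2; ring].
have [k nk] : exists k, n = k * 2.
  apply: (@intrF_eq0 2 _ isT); move: c2; rewrite eM !mxE /cong2 /=.
  by case: e1 => ->; rewrite ?rmorphM //= ?mulN1r ?mul1r ?opprK ?rmorphN ?mulr0z ?mulr1z ?eqxx ?andbT ?oppr_eq0 ?mul1r.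
have [l nl] : exists k, n = k * 3.
  apply: (@intrF_eq0 3 _ isT); move: c3; rewrite eM !mxE /cong3 /=.
  by case: e1 => ->; rewrite ?rmorphM //= ?mulN1r ?mul1r ?opprK ?rmorphN ?mulr0z ?mulr1z ?eqxx ?andbT ?oppr_eq0 ?mul1r.
exists (k - l); lia.
Qed.

(** A matrix of trace 0 satisfying the condition modulo 2 has even
    off-diagonal entries, and its determinant is not 1 modulo 4; for the trace
    1 or -1, the condition modulo 3 similarly contradicts the determinant
    modulo 9. *)
Lemma derived_not_elliptic M : SL' M -> 4 <= (val M 0 0 + val M 1 1) ^+ 2.
Proof.
move=> /derived_congruent6 [c2 c3]; have := detSL M; move: c2 c3; rewrite /cong2 /cong3.
rewrite -!rmorphD /=.
move: (val M 0 0) (val M 0 1) (val M 1 0) (val M 1 1) => a b c d c2 c3 det.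
rewrite leNgt; apply/negP => lt4.
have [t0|[e e1 te]] : a + d = 0 \/ exists2 e, e = 1 \/ e = -1 & a + d = e.
  have : a + d <= 1 by nia.
  have : -1 <= a + d by nia.
  move=> h1 h2; have [h|[h|h]] : a + d = 0 \/ a + d = 1 \/ a + d = -1 by lia.
  - by left.
  - by right; exists 1 => //; left.
  - by right; exists (-1) => //; right.
- move: c2; rewrite t0 => /orP[//|/andP[/(@intrF_eq0 2 _ isT)[b' bE] /(@intrF_eq0 2 _ isT)[c' cE]]].
  have dE : d = - a by lia.
  have [k [kE|kE]] : exists k, a = 2 * k \/ a = 2 * k + 1.
    by exists (a %/ 2)%Z; lia.
  + move: det; rewrite bE cE dE kE; nia.
  + move: det; rewrite bE cE dE kE; nia.
move: c3; rewrite te => /orP[|/andP[/(@intrF_eq0 3 _ isT)[b' bE] /(@intrF_eq0 3 _ isT)[c' cE]]].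
  by case: e1 => ->.
have [k [r [r0 r9 kE]]] : exists k r, [/\ 0 <= r, r < 9 & e * a = 9 * k + r].
  by exists (e * a %/ 9)%Z, (e * a %% 9)%Z; split; lia.
have aE : a = e * (9 * k + r) by case: e1 kE => ->; lia.
have dE : d = e - a by lia.
move: det; rewrite bE cE dE aE => det.
have [m mE] : exists m, r * r - r + 1 = 9 * m.
  exists (k + k * 1 - k - 2 * k * r - 9 * k * k - b' * c' ).
  by case: e1 det => ->; lia.
have : r = 0 \/ r = 1 \/ r = 2 \/ r = 3 \/ r = 4 \/ r = 5 \/ r = 6 \/ r = 7 \/ r = 8 by lia.
move=> [|[|[|[|[|[|[|[|]]]]]]]] rE; move: mE; rewrite rE; lia.
Qed.

End DerivedSL2Z.

(** * Freeness and index *)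

Section FreeGroup.
Implicit Types M N : SL2Z.
Local Notation SL' := (derived_subgroup SL2Z).

(** The next three definitions are the entries p, q, r of the symmetric matrix
    M M^T. They locate the image of the imaginary unit: M i = (q + i) / r and
    |M i|^2 = p / r. They do not see the sign of M. *)
Definition gramp (M : SL2Z) : int := val M 0 0 ^+ 2 + val M 0 1 ^+ 2.
Definition gramq (M : SL2Z) : int := val M 0 0 * val M 1 0 + val M 0 1 * val M 1 1.
Definition gramr (M : SL2Z) : int := val M 1 0 ^+ 2 + val M 1 1 ^+ 2.

(** Whether M i belongs to the half-plane attached to a letter: |z - 1/2| <
    1/2 for f_(-2), Re z < -1 for its inverse, Re z > 1 for f_(-1), and |z +
    1/2| < 1/2 for its inverse. These are the four components of the
    complement of the ideal quadrilateral with vertices -1, 0, 1 and infinity,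
    which contains i. *)
Definition region (l : bool * bool) (M : SL2Z) : bool :=
  match l with
  | (true, true) => gramp M < gramq M
  | (true, false) => gramq M < - gramr M
  | (false, true) => gramr M < gramq M
  | (false, false) => gramp M < - gramq M
  end.

Definition letter (l : bool * bool) : SL2Z :=
  (if l.2 then fgen l.1 else (fgen l.1)^-1)%g.

Lemma gram_spec M : [/\ 0 < gramp M, 0 < gramr M & gramp M * gramr M = gramq M ^+ 2 + 1].
Proof.
rewrite /gramp /gramq /gramr; have := detSL M.
move: (val M 0 0) (val M 0 1) (val M 1 0) (val M 1 1) => a b c d det.
have e : (a ^+ 2 + b ^+ 2) * (c ^+ 2 + d ^+ 2) = (a * c + b * d) ^+ 2 + 1.
  transitivity ((a * c + b * d) ^+ 2 + (a * d - b * c) ^+ 2); first ring.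
  by rewrite det expr1n.
split => //.
- rewrite lt_def addr_ge0 ?sqr_ge0 // andbT; apply/eqP => h.
  by move: e; rewrite h mul0r => h'; have := sqr_ge0 (a * c + b * d); lia.
- rewrite lt_def addr_ge0 ?sqr_ge0 // andbT; apply/eqP => h.
  by move: e; rewrite h mulr0 => h'; have := sqr_ge0 (a * c + b * d); lia.
Qed.

Lemma region_unique l l' M : region l M -> region l' M -> l = l'.
Proof.
have [p0 r0 pr] := gram_spec M.
move: l l' => [[] []] [[] []] //=; move: (gramp M) (gramq M) (gramr M) p0 r0 pr;
 move=> p q r p0 r0 pr h1 h2; exfalso; nia.
Qed.

Lemma region1 l : ~~ region l 1%g.
Proof. by move: l => [[] []]; rewrite /region /gramp /gramq /gramr /= !mxE. Qed.

(** Each letter maps the complement of the closed half-plane of the inverse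
    letter into its own open half-plane; the point i and the other three open
    half-planes lie in that complement. *)
Lemma ping_pong l M : 
  (M = 1%g \/ exists2 l', l' != (l.1, ~~ l.2) & region l' M) ->
  region l (letter l * M)%g.
Proof.
move=> h; have [p0 r0 pr] := gram_spec M.
have {h} hne : is_true (match l with
  | (true, true) => - gramr M < gramq M
  | (true, false) => gramq M < gramp M
  | (false, true) => - gramq M < gramp M
  | (false, false) => gramq M < gramr M
  end).
  case: h => [->|[l']].
    by move: l => [[] []]; rewrite /gramp /gramq /gramr /= !mxE.
  move: l l' => [[] []] [[] []] //= _; move: (gramp M) (gramq M) (gramr M) p0 r0 pr;
  move=> p q r p0 r0 pr h1; nia.
have i1 := invSL_mat2 val_fm1; have i2 := invSL_mat2 val_fm2.
move: hne; clear p0 r0 pr.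
case: l => [[] []]; rewrite /letter /region /gramp /gramq /gramr [fgen _]/=.
- rewrite (mulSL_mat2 val_fm2 (mat2_eta (val M))) !mxE /=; lia.
- rewrite (mulSL_mat2 i2 (mat2_eta (val M))) !mxE /=; lia.
- rewrite (mulSL_mat2 val_fm1 (mat2_eta (val M))) !mxE /=; lia.
- rewrite (mulSL_mat2 i1 (mat2_eta (val M))) !mxE /=; lia.
Qed.

Lemma word_eval_cons l w : word_eval fgen (l :: w) = (letter l * word_eval fgen w)%g.
Proof. by rewrite /word_eval big_cons. Qed.

(** Hence the first letter of a reduced word can be read on the image of i. *)
Lemma reduced_region l w : reduced_word (l :: w) -> region l (word_eval fgen (l :: w)).
Proof.
elim: w l => [|l' w IH] l rw; rewrite word_eval_cons; apply: ping_pong.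
  by left; rewrite /word_eval big_nil.
by right; move: rw; rewrite /reduced_word /= => /andP[ll' rw]; exists l' => //; exact: IH.
Qed.

Lemma eq_up_to_signP M N : eq_up_to_sign M N <-> val M = val N \/ val M = - val N.
Proof.
split=> [/orP[] /eqP|[] /eqP] h; [by left|by right| |]; apply/orP; [by left|by right].
Qed.

Lemma region_sign l M N : eq_up_to_sign M N -> region l M = region l N.
Proof.
move=> /eq_up_to_signP h; rewrite /region /gramp /gramq /gramr.
by case: h => ->; rewrite // !mxE !sqrrN !mulrNN.
Qed.

Lemma eq_up_to_sign_mulg L M N :
  eq_up_to_sign (L * M)%g (L * N)%g -> eq_up_to_sign M N.
Proof. by move=> /projG_eq; rewrite !projG_mul => /(@mulgI PSL2Z) /projG_eq. Qed.

(** The equality is only assumed up to sign: this gives both the freeness and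
    the injectivity of the projection to PSL(2,Z). *)
Lemma word_eval_inj w1 w2 : reduced_word w1 -> reduced_word w2 ->
  eq_up_to_sign (word_eval fgen w1) (word_eval fgen w2) -> w1 = w2.
Proof.
have nil_cons l w : reduced_word (l :: w) ->
    ~ eq_up_to_sign (word_eval fgen (l :: w)) 1%g.
  by move=> /reduced_region h /(region_sign l) e; move: h; rewrite e (negbTE (region1 l)).
elim: w1 w2 => [|l1 w1 IH] [|l2 w2] //.
- move=> _ r2; rewrite eq_up_to_sign_sym {2}/word_eval big_nil => e.
  by have := nil_cons _ _ r2 e.
- move=> r1 _; rewrite {2}/word_eval big_nil => e.
  by have := nil_cons _ _ r1 e.
move=> r1 r2 e; have := reduced_region r1; rewrite (region_sign l1 e).
move=> /(region_unique (reduced_region r2)) l12; subst l2; congr cons.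
apply: IH; [exact: path_sorted r1|exact: path_sorted r2|].
by move: e; rewrite !word_eval_cons => /eq_up_to_sign_mulg.
Qed.

Lemma word_eval_letter l w : reduced_word w ->
  exists2 w', reduced_word w' & word_eval fgen w' = (letter l * word_eval fgen w)%g.
Proof.
case: w => [|l' w] rw.
  by exists [:: l]; rewrite // word_eval_cons.
have [e|ne] := eqVneq l' (l.1, ~~ l.2); last first.
  by exists (l :: l' :: w); rewrite ?word_eval_cons // /reduced_word /= ne.
exists w; first exact: path_sorted rw.
rewrite word_eval_cons e mulgA /letter /=.
by case: (l.2); rewrite /= ?mulgV ?mulVg mul1g.
Qed.

(** The set of the values of reduced words is stable under left multiplication
    by a letter, since either the letter can be added to the word or it
    cancels the first letter. *)
Lemma fgroup_words M : fgroup M <-> exists2 w, reduced_word w & word_eval fgen w = M.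
Proof.
have fG : is_subgroup fgroup := generated_subgroup _.
have gin b : fgroup (fgen b) by apply: sub_generated; case: b; [left|right].
split; last first.
  case=> w _ <-; elim: w => [|l w IH]; first by rewrite /word_eval big_nil; exact: subgroup1.
  rewrite word_eval_cons; apply: (subgroupM fG) => //.
  by rewrite /letter; case: (l.2); [|apply: (subgroupV fG)].
pose W := [set M | exists2 w, reduced_word w & word_eval fgen w = M].
pose K := [set M | forall N, W N -> W (M * N)%g /\ W (M^-1 * N)%g].
suff : fgroup `<=` K.
  move=> h /h /(_ 1%g) []; last by rewrite mulg1.
  by exists [::]; rewrite // /word_eval big_nil.
apply: generated_sub.
  apply/is_subgroupP; split; first by move=> N WN; rewrite invg1 mul1g.
  move=> x y Kx Ky N WN; split.
    by rewrite -mulgA; apply: (proj1 (Kx _ _)); apply: (proj2 (Ky _ _)).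
  by rewrite invgM invgK -mulgA; apply: (proj1 (Ky _ _)); apply: (proj2 (Kx _ _)).
suff h b : K (fgen b) by move=> _ [->|->]; [exact: (h true)|exact: (h false)].
move=> N [w rw <-]; split.
- by have [w' ? ?] := word_eval_letter (b, true) rw; exists w'.
- by have [w' ? ?] := word_eval_letter (b, false) rw; exists w'.
Qed.

Lemma derived_freely_generated : freely_generated SL' fgen.
Proof.
split.
- by move=> w rw; rewrite derived_SL2Z; apply/fgroup_words; exists w.
- move=> w1 w2; rewrite !inE => r1 r2 e; apply: (word_eval_inj r1 r2).
  by rewrite e eq_up_to_sign_refl.
- by move=> M /=; rewrite derived_SL2Z => /fgroup_words[w rw <-]; exists w.
Qed.

Lemma projG_inj_derived : set_inj SL' projG.
Proof.
move=> M N; rewrite !inE derived_SL2Z => /fgroup_words[w1 r1 <-] /fgroup_words[w2 r2 <-].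
by move=> /projG_eq /(word_eval_inj r1 r2) ->.
Qed.

End FreeGroup.

Section DerivedPSL2Z.
Local Notation SL' := (derived_subgroup SL2Z).
Local Notation G' := (derived_subgroup PSL2Z).

Lemma derived_PSL2Z : G' = projG @` SL'.
Proof. by rewrite (image_derived projGM projG_surj). Qed.

Lemma derived_PSL2Z_generated :
  G' = generated [set projG (fmat (- 2)); projG (fmat (- 1))].
Proof.
rewrite derived_PSL2Z derived_SL2Z /fgroup (image_generated projGM).
by rewrite image_setU !image_set1.
Qed.

Lemma derived_projG M : G' (projG M) <-> exists2 N, SL' N & eq_up_to_sign N M.
Proof.
rewrite derived_PSL2Z; split=> [[N dN /projG_eq e]|[N dN e]]; exists N => //.
exact/projG_eq.
Qed.

Lemma projG_cusp_expgz m :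
  expgz (projG cuspSL) (- m) = projG (expgz matA (6 * m)).
Proof.
rewrite (morph_expgz projGM).
have -> : projG cuspSL = expgz (projG matA) (- 6).
  rewrite -(morph_expgz projGM); apply/projG_eq/eq_up_to_signP; right.
  by rewrite val_cuspSL val_expA mat2_opp; congr mat2.
elim/int_ind: m => [|m IH|m IH].
- by rewrite mulr0.
- rewrite (_ : - Posz m.+1 = - m%:Z - 1) ?expgzP ?IH; last by lia.
  by rewrite -expgzN -expgzD; congr expgz; lia.
- rewrite (_ : - (- Posz m.+1) = - - m%:Z + 1) ?expgzS ?IH; last by lia.
  by rewrite -expgzD; congr expgz; lia.
Qed.

Lemma derivedG_expA n : G' (projG (expgz matA n)) <-> exists m, n = 6 * m.
Proof.
split; first by move=> /derived_projG[N dN /(derived_expA dN)].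
case=> m ->; rewrite -projG_cusp_expgz derived_PSL2Z -(morph_expgz projGM).
exists (expgz cuspSL (- m)) => //.
exact: expgz_subgroup (derived_is_subgroup _) cuspSL_derived.
Qed.

(** The cosets of the A^i with i < 6 are all the cosets, because modulo the
    derived subgroup every matrix is a power of A and A^6 is trivial, and they
    are distinct because A^n is in the derived subgroup only if 6 divides n. *)
Lemma derivedG_index : has_index G' 6.
Proof.
rewrite /has_index.
pose cs i := [set (projG (expgz matA i%:Z) * k)%g | k in G'].
have dG := derived_is_subgroup PSL2Z.
have csE g h : G' (h^-1 * g)%g -> [set (g * k)%g | k in G'] `<=` [set (h * k)%g | k in G'].
  move=> gh _ [k Gk <-]; exists (h^-1 * g * k)%g; first exact: (subgroupM dG).
  by rewrite !mulgA mulgV mul1g.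
have csE2 g h : G' (h^-1 * g)%g -> [set (g * k)%g | k in G'] = [set (h * k)%g | k in G'].
  move=> gh; apply/seteqP; split; apply: csE => //.
  by rewrite (_ : (_ * _)%g = (h^-1 * g)^-1%g); [exact: (subgroupV dG)|rewrite invgM invgK].
rewrite (_ : left_cosets G' = cs @` `I_6); last first.
  apply/seteqP; split=> [_ [g _ <-]|_ [i _ <-]]; last by exists (projG (expgz matA i%:Z)).
  have [M <-] := projG_surj g.
  have [n dM] := SL_coset M.
  exists (absz (n %% 6)%Z); first by rewrite /=; lia.
  apply/esym; apply: csE2.
  rewrite gez0_abs; last by lia.
  rewrite (_ : (_ * _)%g = projG (expgz matA (6 * (n %/ 6)%Z)) * projG (expgz matA (- n) * M))%g.
    apply: (subgroupM dG) => //; first by apply/derivedG_expA; exists (n %/ 6)%Z.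
    by rewrite derived_PSL2Z derived_SL2Z; exists (expgz matA (- n) * M)%g.
  rewrite -(morphVg projGM) -!projGM mulgA -expgzN -expgzD; congr (projG (expgz _ _ * _)%g); lia.
apply: inj_card_eq => i j; rewrite !inE /= => i6 j6 e.
have : cs i (projG (expgz matA i)).
  by exists 1%g; [exact: (subgroup1 dG)|rewrite mulg1].
rewrite e => -[k Gk]; rewrite -[RHS]mulg1 -(mulgV (projG (expgz matA j))) => h.
have : G' (projG (expgz matA (i%:Z - j%:Z))).
  rewrite addrC expgzD expgzN projGM (morphVg projGM).
  by rewrite (_ : (_ * _)%g = k) //; move: h; rewrite mulgV mulg1 => <-; rewrite mulgA mulVg mul1g.
move=> /derivedG_expA [m]; lia.
Qed.

End DerivedPSL2Z.

(** * A hexagon and its lattice *)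

Lemma continuous_pair (T U V : topologicalType) (f : T -> U) (g : T -> V) :
  continuous f -> continuous g -> continuous (fun t => (f t, g t)).
Proof. by move=> fc gc x; apply: cvg_pair; [exact: fc|exact: gc]. Qed.

Lemma continuous_maxr (R : realType) (T : topologicalType) (f g : T -> R) : continuous f -> continuous g ->
  continuous (fun t => Num.max (f t) (g t)).
Proof. by move=> fc gc x; apply: continuous_max; [exact: fc|exact: gc]. Qed.

Section HexagonPlane.
Variable R : realType.
Implicit Types (v w : R * R) (x y u r : R) (n m k : int).

(** Coordinates (s, t) stand for the complex number (1 + w)(s + t w) with w =
    exp(i pi / 3). Multiplication by w is the following map, which preserves
    the lattice of the integral points. *)
Definition rot v : R * R := (- v.2, v.1 + v.2).
Definition rotz n v : R * R := iter (absz (modz n 6)) rot v.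
Definition scale r v : R * R := (r * v.1, r * v.2).
(** The gauge of the regular hexagon of circumradius one, in these
    coordinates. *)
Definition hexnorm v : R :=
  Num.max `|2 * v.1 + v.2| (Num.max `|v.1 + 2 * v.2| `|v.1 - v.2|).
(** The first edge of the hexagon, with midpoint at u = 0; u ranges over
    [-1/2, 1/2]. *)
Definition edge0 u : R * R := (1 / 2 - u / 3, 2 * u / 3).
Definition nint x : int := Num.floor (x + 1 / 2).
(** The boundary of the hexagon, run through with period 6; the point of
    parameter n + u is the point u of the n-th edge. *)
Definition hexb x : R * R := rotz (nint x) (edge0 (x - (nint x)%:~R)).
Definition distZ2 x : R := (x - (nint x)%:~R) ^+ 2.

Lemma rot6 v : iter 6 rot v = v.
Proof. by case: v => s t; rewrite /= /rot /=; congr pair; ring. Qed.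

Lemma mod6 n : exists (q : int) (m : nat), (m < 6)%N /\ n = 6 * q + m%:Z.
Proof. exists (divz n 6), (absz (modz n 6)); split; lia. Qed.

Lemma rotz_mod (q : int) (m : nat) v : (m < 6)%N -> rotz (6 * q + m%:Z) v = iter m rot v.
Proof.
move=> m6; rewrite /rotz; congr (iter _ rot v); lia.
Qed.

Lemma rotzS n v : rotz (n + 1) v = rot (rotz n v).
Proof.
have [q [m [m6 ->]]] := mod6 n; rewrite rotz_mod // -iterS.
have [m5|m5] := ltnP m.+1 6.
  by rewrite -addrA -PoszD addn1 rotz_mod.
have -> : m = 5%N by lia.
rewrite rot6 (_ : _ + 1 = 6 * (q + 1) + 0%N%:Z); last by lia.
by rewrite rotz_mod.
Qed.

Lemma rot_inj : injective rot.
Proof.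
move=> [s t] [s' t'] [] /oppr_inj -> /addIr ->; done.
Qed.

Lemma rotzD m n v : rotz (m + n) v = rotz m (rotz n v).
Proof.
elim/int_ind: m => [|m IH|m IH]; first by rewrite add0r.
  by rewrite -addn1 PoszD addrAC !rotzS IH.
apply: rot_inj; rewrite -!rotzS.
rewrite (_ : - Posz m.+1 + n + 1 = - m%:Z + n); last by lia.
by rewrite (_ : - Posz m.+1 + 1 = - m%:Z) //; lia.
Qed.

Lemma rotz0 v : rotz 0 v = v. Proof. by []. Qed.
Lemma rotzK n v : rotz (- n) (rotz n v) = v.
Proof. by rewrite -rotzD addNr. Qed.
Lemma rotzVK n v : rotz n (rotz (- n) v) = v.
Proof. by rewrite -rotzD subrr. Qed.

Lemma rotz6 n (q : int) v : rotz (n + 6 * q) v = rotz n v.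
Proof.
have [p [m [m6 ->]]] := mod6 n.
have -> : 6 * p + m%:Z + 6 * q = 6 * (p + q) + m%:Z by lia.
by rewrite !rotz_mod.
Qed.

Lemma rotz_scale n r v : rotz n (scale r v) = scale r (rotz n v).
Proof.
rewrite /rotz; elim: (absz _) => //= m ->.
by rewrite /rot /scale /=; congr pair; ring.
Qed.

Lemma rotz_sub n v w : rotz n (v - w) = rotz n v - rotz n w.
Proof.
rewrite /rotz; elim: (absz _) => //= m ->; case: (iter _ _ _) (iter m rot w) => s t [s' t'].
by rewrite /rot /=; apply/eqP; rewrite xpair_eqE /=; apply/andP; split; apply/eqP => /=; ring.
Qed.

Lemma rotz_opp n v : rotz n (- v) = - rotz n v.
Proof.
rewrite /rotz; elim: (absz _) => //= m ->; case: (iter _ _ _) => s t.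
by rewrite /rot /=; congr pair; rewrite /= opprD.
Qed.

Lemma rotz3 n v : rotz (n + 3) v = - rotz n v.
Proof.
rewrite rotzD -rotz_opp; congr rotz; case: v => s t.
by rewrite /rotz /= /rot /=; congr pair; rewrite /=; ring.
Qed.

Lemma hexnorm_rot v : hexnorm (rot v) = hexnorm v.
Proof.
rewrite /hexnorm /rot /=.
rewrite (_ : 2 * - v.2 + _ = v.1 - v.2); last by ring.
rewrite (_ : - v.2 + 2 * _ = 2 * v.1 + v.2); last by ring.
rewrite (_ : - v.2 - _ = - (v.1 + 2 * v.2)); last by ring.
by rewrite normrN maxC -maxA [Num.max _ `|v.1 - v.2|]maxC.
Qed.

Lemma hexnorm_rotz n v : hexnorm (rotz n v) = hexnorm v.
Proof. by rewrite /rotz; elim: (absz _) => //= m <-; rewrite hexnorm_rot. Qed.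

Lemma hexnorm_le v r : hexnorm v <= r <->
  [/\ - r <= 2 * v.1 + v.2, 2 * v.1 + v.2 <= r, - r <= v.1 + 2 * v.2, v.1 + 2 * v.2 <= r
    & - r <= v.1 - v.2 <= r].
Proof.
rewrite /hexnorm !ge_max !ler_norml; split.
  by move=> /andP[/andP[-> ->] /andP[/andP[-> ->] ->]].
by move=> [-> -> -> -> ->].
Qed.

Lemma hexnorm_scale r v : 0 <= r -> hexnorm (scale r v) = r * hexnorm v.
Proof.
move=> r0; rewrite /hexnorm /scale /= !maxr_pMr //.
have e a : r * `|a| = `|r * a| by rewrite normrM ger0_norm.
have -> : 2 * (r * v.1) + r * v.2 = r * (2 * v.1 + v.2) by ring.
have -> : r * v.1 + 2 * (r * v.2) = r * (v.1 + 2 * v.2) by ring.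
by rewrite -mulrBr !e.
Qed.

Lemma hexnorm_ge0 v : 0 <= hexnorm v.
Proof. by rewrite /hexnorm le_max normr_ge0. Qed.

Lemma hexnorm_eq0 v : hexnorm v = 0 -> v = (0, 0).
Proof.
move=> h; have /hexnorm_le : hexnorm v <= 0 by rewrite h.
by case: v {h} => s t /= [? ? ? ? /andP[? ?]]; congr pair; lra.
Qed.

Lemma hexnorm0 : hexnorm (0, 0) = 0.
Proof. by apply/eqP; rewrite eq_le hexnorm_ge0 andbT; apply/hexnorm_le => /=; split; try lra. Qed.

Lemma nint_bounds x : - (1 / 2) <= x - (nint x)%:~R /\ x - (nint x)%:~R < 1 / 2.
Proof.
have h1 := floor_le (x + 1 / 2); have h2 := floorD1_gt (x + 1 / 2).
rewrite -/(nint x) in h1 h2; rewrite rmorphD /= in h2.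
by split; lra.
Qed.

Lemma nint_unique x n : - (1 / 2) <= x - n%:~R -> x - n%:~R < 1 / 2 -> nint x = n.
Proof.
move=> h1 h2; apply: floor_def; rewrite rmorphD /=; lra.
Qed.

Lemma nint_closed x n : `|x - n%:~R| <= 1 / 2 ->
  nint x = n \/ (nint x = n + 1 /\ x - n%:~R = 1 / 2).
Proof.
rewrite ler_norml => /andP[h1]; rewrite le_eqVlt => /orP[/eqP h2|h2].
  by right; split=> //; apply: nint_unique; rewrite rmorphD /=; lra.
by left; apply: nint_unique => //; lra.
Qed.

Lemma nint_norm x : `|x - (nint x)%:~R| <= 1 / 2.
Proof. by have [? ?] := nint_bounds x; rewrite ler_norml; lra. Qed.

Lemma edge0_end : rot (edge0 (- (1 / 2))) = edge0 (1 / 2).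
Proof. by rewrite /rot /edge0 /=; congr pair; field. Qed.

(** At a vertex the formulas for the two adjacent edges agree, so that the
    closed interval is allowed here. *)
Lemma hexbE x n : `|x - n%:~R| <= 1 / 2 -> hexb x = rotz n (edge0 (x - n%:~R)).
Proof.
rewrite /hexb => /nint_closed[->//|[-> e]].
rewrite e rotzD -edge0_end; congr rotz.
by rewrite rmorphD /= opprD addrA e (_ : 1 / 2 - 1 = - (1 / 2)) //; field.
Qed.

Lemma distZ2E x n : `|x - n%:~R| <= 1 / 2 -> distZ2 x = (x - n%:~R) ^+ 2.
Proof.
rewrite /distZ2 => /nint_closed[->//|[-> e]].
by rewrite rmorphD /= opprD addrA e; field.
Qed.

Lemma distZ2_bounds x : 0 <= distZ2 x <= 1 / 4.
Proof. have [h1 h2] := nint_bounds x; rewrite /distZ2 sqr_ge0 /=.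
have : 0 <= (1 / 2 - (x - (nint x)%:~R)) * (1 / 2 + (x - (nint x)%:~R)).
  by apply: mulr_ge0; lra.
by move: (x - _) => u; lra. Qed.

Lemma subr_intD x m n : x + n%:~R - (m + n)%:~R = x - m%:~R.
Proof. by rewrite rmorphD /=; ring. Qed.

Lemma nintD x n : nint (x + n%:~R) = nint x + n.
Proof.
have [h1 h2] := nint_bounds x.
by apply: nint_unique; rewrite subr_intD.
Qed.

Lemma hexbD x n : hexb (x + n%:~R) = rotz n (hexb x).
Proof. by rewrite /hexb nintD subr_intD addrC rotzD. Qed.

Lemma hexb6 x (q : int) : hexb (x + (6 * q)%:~R) = hexb x.
Proof. by rewrite hexbD -[6 * q]add0r rotz6. Qed.

Lemma distZ2D x n : distZ2 (x + n%:~R) = distZ2 x.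
Proof. by rewrite /distZ2 nintD subr_intD. Qed.

Lemma hexnorm_edge0 u : `|u| <= 1 / 2 -> hexnorm (edge0 u) = 1.
Proof.
rewrite ler_norml => /andP[h1 h2]; apply/eqP; rewrite eq_le; apply/andP; split.
  by apply/hexnorm_le; rewrite /edge0 /=; split; lra.
rewrite /hexnorm le_max; apply/orP; left.
by rewrite /edge0 /= (_ : 2 * _ + _ = 1) ?normr1 //; field.
Qed.

Lemma hexnorm_hexb x : hexnorm (hexb x) = 1.
Proof. by rewrite hexnorm_rotz hexnorm_edge0 // nint_norm. Qed.

(** The six cones over the edges are distinguished by the signs of s + 2t, s -
    t and 2s + t; a rotation brings v into the cone over the first edge. *)
Lemma hexb_polar v : exists x, v = scale (hexnorm v) (hexb x).
Proof.
have cone w : 0 <= w.1 + 2 * w.2 -> 0 <= w.1 - w.2 ->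
    exists x, w = scale (hexnorm w) (hexb x).
  case: w => s t /= q0 r0.
  have nE : hexnorm (s, t) = 2 * s + t.
    apply/eqP; rewrite eq_le; apply/andP; split.
      by apply/hexnorm_le => /=; split; lra.
    by rewrite /hexnorm le_max /= ler_norm.
  have [p0|p0] := eqVneq (2 * s + t) 0.
    by exists 0; rewrite nE p0 /scale !mul0r; congr pair; lra.
  have p1 : 0 < 2 * s + t by rewrite lt_def p0; lra.
  pose u := 3 / 2 * t / (2 * s + t).
  have hu : `|u - 0%:~R| <= 1 / 2.
    rewrite subr0 ler_norml /u ler_pdivlMr // ler_pdivrMr //; lra.
  exists u; rewrite (hexbE hu) rotz0 subr0 nE /scale /edge0 /u /=; congr pair; field; exact: lt0r_neq0.
have rotated w (m : nat) : (exists x, w = scale (hexnorm w) (hexb x)) ->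
    exists x, iter m rot w = scale (hexnorm (iter m rot w)) (hexb x).
  move=> [x wx]; elim: m => [|m [y IH]]; first by exists x.
  exists (y + 1%:~R); rewrite iterS hexnorm_rot IH hexbD hexnorm_scale ?hexnorm_ge0 //.
  by rewrite hexnorm_hexb mulr1 -(rotz_scale 1).
have rotate (m : nat) : (0 <= (iter m rot v).1 + 2 * (iter m rot v).2) ->
    0 <= (iter m rot v).1 - (iter m rot v).2 -> (m <= 6)%N ->
    exists x, v = scale (hexnorm v) (hexb x).
  move=> h1 h2 m6; have := rotated _ (6 - m)%N (cone _ h1 h2).
  by rewrite -iterD subnK // rot6.
case: v rotate {rotated cone} => s t rotate.
have [q0|q0] := leP 0 (s + 2 * t); have [r0|r0] := leP 0 (s - t).
- by apply: (rotate 0%N).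
- have [p0|p0] := leP 0 (2 * s + t).
    by apply: (rotate 5%N) => //; rewrite /rot /=; lra.
  by apply: (rotate 4%N) => //; rewrite /rot /=; lra.
- have [p0|p0] := leP 0 (2 * s + t).
    by apply: (rotate 1%N) => //; rewrite /rot /=; lra.
  by apply: (rotate 2%N) => //; rewrite /rot /=; lra.
- by apply: (rotate 3%N) => //; rewrite /rot /=; lra.
Qed.

Lemma hexb_inj x y : hexb x = hexb y -> exists q : int, y = x + (6 * q)%:~R.
Proof.
rewrite /hexb; have [u1 u2] := nint_bounds x; have [w1 w2] := nint_bounds y.
set n := nint x in u1 u2 *; set m := nint y in w1 w2 *.
have -> : x = n%:~R + (x - n%:~R) by rewrite addrC subrK.
have -> : y = m%:~R + (y - m%:~R) by rewrite addrC subrK.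
rewrite ![_%:~R + _ - _]addrAC !subrr !add0r.
move: (x - n%:~R) (y - m%:~R) u1 u2 w1 w2 => u w u1 u2 w1 w2.
move=> /(congr1 (rotz (- n))); rewrite rotzK -rotzD addrC.
have [q [k [k6 e]]] := mod6 (m - n).
have -> : m = n + (6 * q + k%:Z) by rewrite -e addrC subrK.
rewrite (addrC n) addrK rotz_mod //.
have uw : edge0 u = iter k rot (edge0 w) -> k = 0%N /\ u = w.
  clear e; case: k k6 => [|[|[|[|[|[|//]]]]]] _; rewrite /rot /edge0 /= => -[e1 e2].
  - by split=> //; lra.
  - by exfalso; lra.
  - by exfalso; lra.
  - by exfalso; lra.
  - by exfalso; lra.
  - by exfalso; lra.
move=> /uw[-> ->]; exists q; rewrite !rmorphD /=; lra.
Qed.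

(** The hexagon is the Voronoi cell of the lattice: if two of its points
    differ by a nonzero lattice vector, this vector is one of the six shortest
    ones, because the three linear forms that define the gauge are at most 2
    in absolute value on it; then the first point is on the corresponding edge
    and the second one is its translate on the opposite edge. *)
Lemma lattice_hexagon v w (i j : int) : hexnorm v <= 1 -> hexnorm w <= 1 ->
  v - w = (i%:~R, j%:~R) -> v <> w ->
  exists (k : int) u, [/\ `|u| <= 1 / 2, v = rotz k (edge0 u) & w = v - rotz k (1, 0)].
Proof.
move=> hv hw e ne.
have zero : (i, j) <> (0, 0).
  by move=> [i0 j0]; apply: ne; apply/eqP; rewrite -subr_eq0 e i0 j0.
have h2 : [/\ - 2 <= 2 * i + j, 2 * i + j <= 2, - 2 <= i + 2 * j, i + 2 * j <= 2
    & - 2 <= i - j <= 2].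
  have [e1 e2] : v.1 - w.1 = i%:~R /\ v.2 - w.2 = j%:~R by move: e => [<- <-].
  have [v1 v2 v3 v4 /andP[v5 v6]] := (hexnorm_le v 1).1 hv.
  have [x1 x2 x3 x4 /andP[x5 x6]] := (hexnorm_le w 1).1 hw.
  split; [| | | |apply/andP; split]; rewrite -(ler_int R) !(rmorphD,rmorphB,rmorphM) /=; lra.
have [k kE] : exists k : nat, (i%:~R, j%:~R) = iter k rot (1, 0) :> R * R.
  have : (i = 1 /\ j = 0) \/ (i = 0 /\ j = 1) \/ (i = -1 /\ j = 1) \/ (i = -1 /\ j = 0)
      \/ (i = 0 /\ j = -1) \/ (i = 1 /\ j = -1).
    have : ~ (i = 0 /\ j = 0) by move=> [i0 j0]; apply: zero; rewrite i0 j0.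
    case: h2 => ? ? ? ? /andP[? ?]; lia.
  move=> [[-> ->]|[[-> ->]|[[-> ->]|[[-> ->]|[[-> ->]|[-> ->]]]]]].
  - by exists 0%N.
  - by exists 1%N; rewrite /= /rot /=; congr pair; ring.
  - by exists 2%N; rewrite /= /rot /=; congr pair; ring.
  - by exists 3%N; rewrite /= /rot /=; congr pair; ring.
  - by exists 4%N; rewrite /= /rot /=; congr pair; ring.
  - by exists 5%N; rewrite /= /rot /=; congr pair; ring.
have kE' : v - w = rotz k%:Z (1, 0).
  rewrite e kE; have [q [m [m6 km]]] := mod6 k; rewrite km rotz_mod //.
  have q0 : 0 <= q by lia.
  have -> : k = (6 * absz q + m)%N by lia.
  elim: (absz q) => [|p IH]; first by rewrite muln0.
  by rewrite mulnS -addnA iterD rot6.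
have wE : w = v - rotz k%:Z (1, 0) by rewrite -kE' opprB addrC subrK.
pose v' := rotz (- k%:Z) v; pose w' := rotz (- k%:Z) w.
have : v' - w' = (1, 0) by rewrite -rotz_sub kE' rotzK.
have : hexnorm v' <= 1 by rewrite hexnorm_rotz.
have : hexnorm w' <= 1 by rewrite hexnorm_rotz.
have vE : v = rotz k%:Z v' by rewrite rotzVK.
clearbody v' w'; case: v' w' vE => [s t] [s' t'] vE.
move=> /hexnorm_le /= [a1 a2 a3 a4 /andP[a5 a6]] /hexnorm_le /= [b1 b2 b3 b4 /andP[b5 b6]] [c1 c2].
exists k%:Z, (3 / 2 * t); split=> //.
  by rewrite ler_norml; lra.
by rewrite vE; congr (rotz _ (_, _)); rewrite /=; lra.
Qed.

Lemma lattice_center (i j : int) v : hexnorm v <= 1 -> v = (i%:~R, j%:~R) -> v = (0, 0).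
Proof.
move=> hv vE; have [//|ne] := EM (v = (0, 0)).
have v0 : v - (0, 0) = (i%:~R, j%:~R).
  by rewrite vE; congr pair; rewrite /= subr0.
have h0 : hexnorm (0, 0) <= 1 by rewrite hexnorm0.
have [k [u [u2 vk e]]] := lattice_hexagon hv h0 v0 ne.
have : v = rotz k (1, 0) by apply/eqP; rewrite -subr_eq0 -e.
rewrite vk => /(congr1 (rotz (- k))); rewrite !rotzK /edge0 => -[e1 e2].
by exfalso; lra.
Qed.

Lemma nint_near x0 x : `|x0 - x| < 1 / 2 ->
  nint x = nint x0 - 1 \/ nint x = nint x0 \/ nint x = nint x0 + 1.
Proof.
move=> xx; have := nint_norm x; have := nint_norm x0; set n := nint x0 => h1 h2.
have : (nint x)%:~R <= (n + 1)%:~R :> R.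
  rewrite leNgt; apply/negP; rewrite ltr_int => h3.
  have : (n + 1)%:~R + 1 <= (nint x)%:~R :> R.
    by rewrite -[X in _ + X]/(1%:~R) -rmorphD ler_int; lia.
  move: h1 h2 xx; rewrite rmorphD /= !ltr_norml !ler_norml; lra.
have : (n - 1)%:~R <= (nint x)%:~R :> R.
  rewrite leNgt; apply/negP; rewrite ltr_int => h3.
  have : (nint x)%:~R + 1 <= (n - 1)%:~R :> R.
    by rewrite -[X in _ + X]/(1%:~R) -rmorphD ler_int; lia.
  move: h1 h2 xx; rewrite rmorphB /= !ltr_norml !ler_norml; lra.
rewrite !ler_int => h3 h4; lia.
Qed.

Lemma continuous_strips (Y : topologicalType) (f : R -> Y) (h : int -> R -> Y) :
  (forall n x, `|x - n%:~R| <= 1 / 2 -> f x = h n x) ->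
  (forall n, continuous (h n)) -> continuous f.
Proof.
move=> fh hc x0; pose n := nint x0; suff : {for x0, continuous f} by [].
refine (@continuous_at_patch R Y int [:: n - 1; n; n + 1]
  (fun m => [set x | `|x - m%:~R| <= 1 / 2]) h f x0 _ _ _ _).
- move=> m _; apply: (@closed_comp _ _ (fun x : R => `|x - m%:~R|) [set y | y <= 1 / 2]).
    move=> x _; apply: cvg_norm; apply: cvgB; [exact: cvg_id|exact: cvg_cst].
  exact: closed_le.
- by move=> m _ _; exact: hc.
- by move=> m x _; exact: fh.
- have : \forall x \near x0, `|x0 - x| < 1 / 2.
    by apply: (@cvgr_dist_lt R R _ (nbhs x0)) => //; exact: cvg_id.
  apply: (@filterS _ _ (nbhs_filter x0)) => x xx; exists (nint x); last exact: nint_norm.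
  by have [->|[->|->]] := nint_near xx; rewrite /= -/n; [left|right; left|right; right; left].
Qed.

Lemma continuous_distZ2 : continuous distZ2.
Proof.
apply: (@continuous_strips _ _ (fun n x => (x - n%:~R) ^+ 2)).
  by move=> n x; exact: distZ2E.
move=> n x; rewrite /continuous_at; under eq_fun do rewrite expr2; rewrite expr2.
by apply: cvgM; apply: cvgB; [exact: cvg_id|exact: cvg_cst|exact: cvg_id|exact: cvg_cst].
Qed.

Lemma continuous_fst_R : continuous (fst : R * R -> R).
Proof. by move=> [x y]; exact: cvg_fst. Qed.
Lemma continuous_snd_R : continuous (snd : R * R -> R).
Proof. by move=> [x y]; exact: cvg_snd. Qed.

Lemma continuous_rot : continuous rot.
Proof.
apply: continuous_pair => v.
  by apply: cvgN; exact: continuous_snd_R.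
by apply: cvgD; [exact: continuous_fst_R|exact: continuous_snd_R].
Qed.

Lemma continuous_rotz n : continuous (rotz n).
Proof.
rewrite /rotz; elim: (absz _) => [|m IH] v; first exact: cvg_id.
exact: (@continuous_comp _ _ _ (iter m rot) rot v (IH v) (@continuous_rot _)).
Qed.

Lemma continuous_hexb : continuous hexb.
Proof.
apply: (@continuous_strips _ _ (fun n x => rotz n (edge0 (x - n%:~R)))).
  by move=> n x; exact: hexbE.
move=> n x.
apply: (@continuous_comp _ _ _ (fun x => edge0 (x - n%:~R)) (rotz n)); last exact: continuous_rotz.
move: x; apply: continuous_pair => x.
  apply: cvgB; first exact: cvg_cst.
  by apply: cvgM; [apply: cvgB; [exact: cvg_id|exact: cvg_cst]|exact: cvg_cst].
apply: cvgM; last exact: cvg_cst.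
by apply: cvgM; [exact: cvg_cst|apply: cvgB; [exact: cvg_id|exact: cvg_cst]].
Qed.

Lemma continuous_hexnorm : continuous hexnorm.
Proof.
have c1 := continuous_fst_R; have c2 := continuous_snd_R.
by do ! (apply: continuous_maxr); move=> v; apply: cvg_norm;
  [apply: cvgD; [apply: cvgM; [exact: cvg_cst|exact: c1]|exact: c2]|
   apply: cvgD; [exact: c1|apply: cvgM; [exact: cvg_cst|exact: c2]]|
   apply: cvgB; [exact: c1|exact: c2]].
Qed.

End HexagonPlane.

(** * The action on the half-plane and the tile H~ *)

Lemma cont_comp (T U V : topologicalType) (f : T -> U) (g : U -> V) :
  continuous f -> continuous g -> continuous (fun t => g (f t)).
Proof. by move=> fc gc t; exact: (@continuous_comp _ _ _ f g t (fc t) (gc (f t))). Qed.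

Section RealContinuity.
Variables (R : realType) (T : topologicalType).
Implicit Types f g : T -> R.

Lemma contD f g : continuous f -> continuous g -> continuous (fun t => f t + g t).
Proof. by move=> fc gc t; apply: cvgD; [exact: fc|exact: gc]. Qed.
Lemma contN f : continuous f -> continuous (fun t => - f t).
Proof. by move=> fc t; apply: cvgN; exact: fc. Qed.
Lemma contM f g : continuous f -> continuous g -> continuous (fun t => f t * g t).
Proof. by move=> fc gc t; apply: cvgM; [exact: fc|exact: gc]. Qed.
Lemma contX2 f : continuous f -> continuous (fun t => f t ^+ 2).
Proof. by move=> fc; exact: (contM fc fc). Qed.
Lemma contV f : (forall t, f t != 0) -> continuous f -> continuous (fun t => (f t)^-1).
Proof. by move=> f0 fc t; apply: cvgV; [exact: f0|exact: fc]. Qed.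
Lemma cont_cst (r : R) : continuous (fun _ : T => r).
Proof. by move=> t; exact: cvg_cst. Qed.
Lemma near_dist_lt f (o : T) (e : R) : continuous f -> 0 < e ->
  \forall t \near o, `|f o - f t| < e.
Proof. by move=> fc e0; apply: (@cvgr_dist_lt R R _ (nbhs o)) => //; exact: fc. Qed.
End RealContinuity.

Lemma distZ2_min (R : realType) (x : R) n : distZ2 x <= (x - n%:~R) ^+ 2.
Proof.
rewrite /distZ2; have [h1 h2] := nint_bounds x; set m := nint x in h1 h2 *.
have [->//|[h|h]] : n = m \/ n + 1 <= m \/ m + 1 <= n by lia.
  have : (n + 1)%:~R <= m%:~R :> R by rewrite ler_int.
  rewrite rmorphD /= => h'.
  have : 0 <= ((x - n%:~R) - (x - m%:~R)) * ((x - n%:~R) + (x - m%:~R)) by apply: mulr_ge0; lra.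
  by move: (x - n%:~R) (x - m%:~R) => u v; lra.
have : (m + 1)%:~R <= n%:~R :> R by rewrite ler_int.
rewrite rmorphD /= => h'.
have : 0 <= ((x - m%:~R) - (x - n%:~R)) * (- (x - n%:~R) - (x - m%:~R)) by apply: mulr_ge0; lra.
by move: (x - n%:~R) (x - m%:~R) => u v; lra.
Qed.

Section HalfPlaneAction.
Variable R : realType.
Local Notation H := (HH R).
Implicit Types (z w : H) (M N : SL2Z).

Lemma Imz_gt0 z : 0 < Imz z. Proof. by have /set_mem := valP z. Qed.

Lemma HH_ext z w : Rez z = Rez w -> Imz z = Imz w -> z = w.
Proof.
move=> r i; apply: val_inj; move: r i; rewrite /Rez /Imz.
by case: (val z) (val w) => a b [a' b'] /= -> ->.
Qed.

Lemma mkH_subproof (x y : R) (y0 : 0 < y) : Complex x y \in upper_half_plane (R:=R).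
Proof. by rewrite inE. Qed.
Definition mkH x y (y0 : 0 < y) : H := exist _ (Complex x y) (mkH_subproof x y0).
Lemma Rez_mkH x y (y0 : 0 < y) : Rez (mkH x y0) = x. Proof. by []. Qed.
Lemma Imz_mkH x y (y0 : 0 < y) : Imz (mkH x y0) = y. Proof. by []. Qed.

Definition entry M (i j : 'I_2) : R := (val M i j)%:~R.
(** The squared modulus |c z + d|^2. *)
Definition den M z : R := (entry M 1 0 * Rez z + entry M 1 1) ^+ 2 + (entry M 1 0 * Imz z) ^+ 2.

Lemma detR M : entry M 0 0 * entry M 1 1 - entry M 0 1 * entry M 1 0 = 1.
Proof. by rewrite /entry -!rmorphM -rmorphB detSL. Qed.

Lemma den_gt0 M z : 0 < den M z.
Proof.
have y0 := Imz_gt0 z; have := detR M; rewrite /den.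
move: (entry M 0 0) (entry M 0 1) (entry M 1 0) (entry M 1 1) => a b c d det.
rewrite lt_def addr_ge0 ?sqr_ge0 // andbT; apply/eqP => h.
have : c * Imz z == 0 by rewrite -sqrf_eq0 eq_le sqr_ge0 -{1}h lerDr sqr_ge0.
rewrite mulf_eq0 (gt_eqF y0) orbF => /eqP c0; move: h det.
rewrite c0 !mul0r !add0r expr0n addr0 mulr0 subr0 => /eqP; rewrite sqrf_eq0 => /eqP ->.
by rewrite mulr0 => /eqP; rewrite eq_sym oner_eq0.
Qed.

Lemma act_formulas M z :
  Rez (actSL M z) = ((entry M 0 0 * Rez z + entry M 0 1) * (entry M 1 0 * Rez z + entry M 1 1)
     + entry M 0 0 * entry M 1 0 * Imz z ^+ 2) / den M z /\
  Imz (actSL M z) = Imz z / den M z.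
Proof.
have := den_gt0 M z; have := detR M; move: z => [[x y] hz].
rewrite /Rez /Imz /den /Rez /Imz /= /homography -!(rmorph_int (real_complex R)) /=.
rewrite -!/(entry M _ _).
move: (entry M 0 0) (entry M 0 1) (entry M 1 0) (entry M 1 1) => a b c d det n0.
simpc; rewrite /=; split; first by field; rewrite lt0r_neq0.
transitivity ((a * d - b * c) * y / ((c * x + d) ^+ 2 + (c * y) ^+ 2)).
  by field; rewrite lt0r_neq0.
by rewrite det mul1r.
Qed.

Lemma Rez_act M z : Rez (actSL M z) =
  ((entry M 0 0 * Rez z + entry M 0 1) * (entry M 1 0 * Rez z + entry M 1 1)
     + entry M 0 0 * entry M 1 0 * Imz z ^+ 2) / den M z.
Proof. by case: (act_formulas M z). Qed.
Lemma Imz_act M z : Imz (actSL M z) = Imz z / den M z.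
Proof. by case: (act_formulas M z). Qed.

Lemma act_mul M N z : actSL (M * N)%g z = actSL M (actSL N z).
Proof.
have nz (L : SL2Z) (w : H) : ((val L 1 0)%:~R * val w + (val L 1 1)%:~R : R[i]) != 0.
  have := den_gt0 L w; rewrite /den /entry /Rez /Imz.
  case: (val w) => x y /= n0; rewrite -!(rmorph_int (real_complex R)) /=; simpc.
  rewrite eq_complex /=; apply/negP => /andP[/eqP e1 /eqP e2].
  by move: n0; rewrite e1 e2 expr0n /= addr0 ltxx.
apply: val_inj; have := nz M (actSL N z); have := nz N z; rewrite /= /homography.
rewrite /= !mxE !big_ord_recl !big_ord0 !addr0.
rewrite (_ : lift _ _ = 1); last exact: val_inj.
move: (sval M 0 0) (sval M 0 1) (sval M 1 0) (sval M 1 1) (sval z) => a b c d x.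
move: (sval N 0 0) (sval N 0 1) (sval N 1 0) (sval N 1 1) => a' b' c' d' n1 n2.
rewrite !rmorphD !rmorphM /=; field; rewrite n1 /=.
move: n2; apply: contra => /eqP e; apply/eqP.
transitivity ((c%:~R * (a'%:~R * x + b'%:~R) + d%:~R * (c'%:~R * x + d'%:~R)) / (c'%:~R * x + d'%:~R)).
  by field.
by rewrite [X in X / _](_ : _ = 0) ?mul0r // -e; ring.
Qed.

Lemma act_1 z : actSL 1%g z = z.
Proof.
by apply: HH_ext; rewrite ?Rez_act ?Imz_act /den /entry !mxE /=; field.
Qed.

Lemma actG_mul g h z : actG (g * h)%g z = actG g (actG h z).
Proof.
by rewrite -(projG_repr g) -(projG_repr h) -projGM !actG_projG act_mul.
Qed.
Lemma actG_1 z : actG 1%g z = z.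
Proof. by rewrite -[1%g]/(projG 1%g) actG_projG act_1. Qed.
Lemma actGK g z : actG g^-1%g (actG g z) = z.
Proof. by rewrite -actG_mul mulVg actG_1. Qed.
Lemma actGVK g z : actG g (actG g^-1%g z) = z.
Proof. by rewrite -actG_mul mulgV actG_1. Qed.
Lemma actK M z : actSL M^-1%g (actSL M z) = z.
Proof. by rewrite -act_mul mulVg act_1. Qed.
Lemma continuous_Rez : continuous (@Rez R).
Proof. exact: (cont_comp (@continuous_val _ _) (@continuous_Re R)). Qed.
Lemma continuous_Imz : continuous (@Imz R).
Proof. exact: (cont_comp (@continuous_val _ _) (@continuous_Im R)). Qed.

Lemma continuous_to_HH (T : topologicalType) (f : T -> H) :
  continuous (fun t => Rez (f t)) -> continuous (fun t => Imz (f t)) -> continuous f.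
Proof.
by move=> rc ic; apply: continuous_to_set_type; apply: continuous_to_complex.
Qed.

Lemma continuous_den M : continuous (den M).
Proof.
have cx := continuous_Rez; have cy := continuous_Imz.
apply: contD; apply: contX2; last by apply: contM => //; exact: cont_cst.
by apply: contD; [apply: contM => //|]; exact: cont_cst.
Qed.

Lemma continuous_act M : continuous (@actSL R M).
Proof.
have nz z : den M z != 0 by rewrite lt0r_neq0 ?den_gt0.
have cx := continuous_Rez; have cy := continuous_Imz.
have cd := contV nz (@continuous_den M).
have lin (p q : R) : continuous (fun z => p * Rez z + q).
  by apply: contD; [apply: contM => //|]; exact: cont_cst.
apply: continuous_to_HH; (under eq_fun do rewrite ?Rez_act ?Imz_act); apply: contM => //.
apply: contD; first exact: contM.
by apply: contM; [exact: cont_cst|exact: contX2].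
Qed.

Lemma act_entries M (a b c d : int) z : val M = mat2 a b c d ->
  [/\ entry M 0 0 = a%:~R, entry M 0 1 = b%:~R, entry M 1 0 = c%:~R & entry M 1 1 = d%:~R].
Proof. by move=> hM; rewrite /entry hM !mxE. Qed.

Lemma Rez_expA n z : Rez (actSL (expgz matA n) z) = Rez z - n%:~R.
Proof.
have [e1 e2 e3 e4] := act_entries z (val_expA n).
by rewrite Rez_act /den e1 e2 e3 e4 rmorphN /=; field.
Qed.
Lemma Imz_expA n z : Imz (actSL (expgz matA n) z) = Imz z.
Proof.
have [e1 e2 e3 e4] := act_entries z (val_expA n).
by rewrite Imz_act /den e3 e4 /=; field.
Qed.

Lemma Rez_S z : Rez (actSL matS z) = - Rez z / (Rez z ^+ 2 + Imz z ^+ 2).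
Proof.
have [e1 e2 e3 e4] := act_entries z val_matS.
rewrite Rez_act /den e1 e2 e3 e4 /=; congr (_ / _); ring.
Qed.
Lemma Imz_S z : Imz (actSL matS z) = Imz z / (Rez z ^+ 2 + Imz z ^+ 2).
Proof.
have [e1 e2 e3 e4] := act_entries z val_matS.
rewrite Imz_act /den e3 e4 /=; congr (_ / _); ring.
Qed.

(** For z in a vertical strip of width one centred at the integer n, this is
    |z - n|^2. *)
Definition rho z : R := distZ2 (Rez z) + Imz z ^+ 2.
(** The map to the plane that straightens H~. Vertical half-lines go to
    segments ending at the centre, the lower boundary of H~, where rho = 1,
    goes to the boundary of the hexagon, and the translation by 1 becomes the
    rotation of order 6. *)
Definition hexmap z : R * R := scale (rho z)^-1 (hexb (Rez z)).

Lemma rho_gt0 z : 0 < rho z.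
Proof.
by have /andP[d0 _] := distZ2_bounds (Rez z); rewrite /rho ltr_wpDl // exprn_gt0 // Imz_gt0.
Qed.

Lemma rhoE z n : `|Rez z - n%:~R| <= 1 / 2 -> rho z = (Rez z - n%:~R) ^+ 2 + Imz z ^+ 2.
Proof. by move=> h; rewrite /rho (distZ2E h). Qed.

Lemma rho_expA n z : rho (actSL (expgz matA n) z) = rho z.
Proof. by rewrite /rho Rez_expA Imz_expA -rmorphN distZ2D. Qed.

Lemma hexmap_expA n z : hexmap (actSL (expgz matA n) z) = rotz (- n) (hexmap z).
Proof. by rewrite /hexmap rho_expA Rez_expA -rmorphN hexbD rotz_scale. Qed.

Lemma continuous_rho : continuous rho.
Proof.
apply: contD; first exact: (cont_comp continuous_Rez (@continuous_distZ2 R)).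
exact: contX2 continuous_Imz.
Qed.

Lemma continuous_hexmap : continuous hexmap.
Proof.
have ir : continuous (fun z => (rho z)^-1).
  by apply: contV continuous_rho => z; rewrite lt0r_neq0 ?rho_gt0.
have hb := cont_comp continuous_Rez (@continuous_hexb R).
by apply: continuous_pair; apply: contM => //; apply: cont_comp hb _;
  [exact: continuous_fst_R|exact: continuous_snd_R].
Qed.

Lemma hexnorm_hexmap z : hexnorm (hexmap z) = (rho z)^-1.
Proof. by rewrite hexnorm_scale ?hexnorm_hexb ?mulr1 // invr_ge0 ltW ?rho_gt0. Qed.

Lemma norm_val_ge1 z : (1 <= `|val z|) = (1 <= Rez z ^+ 2 + Imz z ^+ 2).
Proof.
rewrite normc_def -[1]/(real_complex R 1) lecR -/(Rez z) -/(Imz z) -{1}sqrtr1 ler_sqrt //.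
by rewrite addr_ge0 ?sqr_ge0.
Qed.
Lemma norm_val_eq1 z : `|val z| = 1 <-> Rez z ^+ 2 + Imz z ^+ 2 = 1.
Proof.
rewrite normc_def -/(Rez z) -/(Imz z); split.
  move=> /(congr1 (fun x => complex.Re x ^+ 2)) /=.
  by rewrite sqr_sqrtr ?expr1n // addr_ge0 ?sqr_ge0.
by move=> ->; rewrite sqrtr1.
Qed.

Lemma HtildeP z : Htilde R z <-> 1 <= rho z.
Proof.
split.
  case=> n _ [w [/andP[w1 w2]]]; rewrite norm_val_ge1 => h <-.
  by rewrite rho_expA (@rhoE _ 0) ?subr0 // ler_norml w1.
move=> h; pose n := nint (Rez z); exists n => //.
exists (actSL (expgz matA n) z); last by rewrite -act_mul expgzN mulVg act_1.
have := nint_norm (Rez z); rewrite -/n ler_norml => hn; split.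
  by rewrite Rez_expA.
by rewrite norm_val_ge1 Rez_expA Imz_expA -(rhoE (nint_norm _)).
Qed.

Lemma HsideP n z : Hside R n z <-> `|Rez z - n%:~R| <= 1 / 2 /\ rho z = 1.
Proof.
split.
  case=> w [/= hw /norm_val_eq1 e] <-; rewrite rho_expA Rez_expA rmorphN opprK addrK ler_norml.
  by split=> //; rewrite (@rhoE _ 0) ?subr0 // ler_norml.
move=> [h r1]; exists (actSL (expgz matA n) z); last by rewrite -act_mul expgzN mulVg act_1.
split; first by rewrite Rez_expA -ler_norml.
by apply/norm_val_eq1; rewrite Rez_expA Imz_expA -(rhoE h).
Qed.

Lemma fmat_side n z : Hside R n z ->
  Rez (actSL (fmat n) z) = n%:~R + 3 - (Rez z - n%:~R) /\ Imz (actSL (fmat n) z) = Imz z.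
Proof.
move=> /HsideP[h]; rewrite (rhoE h) => r1.
rewrite /fmat (act_mul _ (expgz matA n)) (act_mul (expgz matA _) matS) Rez_expA Imz_expA Rez_S Imz_S Rez_expA Imz_expA r1 !divr1.
by split=> //; rewrite rmorphN rmorphD /=; ring.
Qed.

(** On side n, with Re z = n + u, f_n acts by u -> - u followed by the
    translation by 3; since the points u and - u of the first edge add up to
    (1, 0), it becomes a lattice translation in the plane. *)
Lemma fmat_side_hexmap n z : Hside R n z ->
  Hside R (n + 3) (actSL (fmat n) z) /\
  hexmap (actSL (fmat n) z) = hexmap z - rotz n (1, 0).
Proof.
move=> hz; have [rE iE] := fmat_side hz; have [h r1] := (HsideP n z).1 hz.
have h' : `|Rez (actSL (fmat n) z) - (n + 3)%:~R| <= 1 / 2.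
  rewrite rE rmorphD /= (_ : _ - _ = - (Rez z - n%:~R)) ?normrN //; ring.
have r1' : rho (actSL (fmat n) z) = 1.
  by rewrite -r1 (rhoE h) (rhoE h') iE rE rmorphD /=; ring.
split; first exact/HsideP.
have s1 v : scale 1 v = v :> R * R by case: v => a b; rewrite /scale !mul1r.
rewrite /hexmap r1 r1' invr1 !s1 (hexbE h) (hexbE h') rotz3 -rotz_opp -rotz_sub; congr rotz.
by rewrite rE /edge0 rmorphD /=; congr pair; rewrite /=; field.
Qed.

Lemma act_sign M N z : eq_up_to_sign M N -> actSL M z = actSL N z.
Proof. by move=> /projG_eq e; rewrite -!actG_projG e. Qed.

Lemma side_fmat_image n : actG (projG (fmat n)) @` Hside R n = Hside R (n + 3).
Proof.
apply/seteqP; split=> [_ [z hz <-]|w hw].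
  by rewrite actG_projG; case: (fmat_side_hexmap hz).
have [h r1] := (HsideP (n + 3) w).1 hw.
exists (actSL (expgz matA 6) (actSL (fmat (n + 3)) w)).
  have [/HsideP[h' r'] _] := fmat_side_hexmap hw.
  apply/HsideP; rewrite rho_expA Rez_expA; split=> //.
  have e3 : (n + 3 + 3)%:~R = n%:~R + 6 :> R by rewrite -addrA rmorphD.
  by move: h'; rewrite e3 !ler_norml; lra.
rewrite actG_projG -!act_mul.
have e : eq_up_to_sign (fmat n * (expgz matA 6 * fmat (n + 3)))%g 1%g.
  apply/eq_up_to_signP; right.
  rewrite (mulSL_mat2 (val_fmat n) (mulSL_mat2 (val_expA _) (val_fmat _))).
  rewrite [X in _ = - X](_ : _ = mat2 1 0 0 1); last by rewrite [LHS]mat2_eta !mxE.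
  by rewrite mat2_opp; congr mat2; ring.
by rewrite -mulgA (act_sign w e) act_1.
Qed.

(** Im (M z) = Im z / |c z + d|^2, where |c z + d|^2 is at least (c Im z)^2. *)
Lemma Imz_high M z : Imz (actSL M z) * Imz z * entry M 1 0 ^+ 2 <= 1.
Proof.
have y0 := Imz_gt0 z; have n0 := den_gt0 M z.
rewrite Imz_act mulrAC mulrAC -mulrA mulrAC ler_pdivrMr // mul1r /den.
have -> : Imz z * (Imz z * entry M 1 0 ^+ 2) = (entry M 1 0 * Imz z) ^+ 2 by ring.
by rewrite lerDr sqr_ge0.
Qed.

Lemma lower0_expA M : val M 1 0 = 0 -> exists n, eq_up_to_sign M (expgz matA n).
Proof.
move=> c0; have := detSL M; rewrite c0 mulr0 subr0 => /mulz_eq1[[a1 d1]|[a1 d1]].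
  exists (- val M 0 1); apply/eq_up_to_signP; left.
  by rewrite val_expA opprK [LHS]mat2_eta a1 d1 c0.
exists (val M 0 1); apply/eq_up_to_signP; right.
by rewrite val_expA [LHS]mat2_eta mat2_opp a1 d1 c0; congr mat2; ring.
Qed.

Lemma high_expA M z : 1 < Imz z -> 1 < Imz (actSL M z) -> exists n, eq_up_to_sign M (expgz matA n).
Proof.
move=> h1 h2; apply: lower0_expA; have := Imz_high M z.
have [//|c0] := eqVneq (val M 1 0) 0.
have c1 : 1 <= entry M 1 0 ^+ 2.
  rewrite /entry -rmorphXn /= -[1]/(1%:~R) ler_int.
  by move: (val M 1 0) c0 => c c0; rewrite expr2; nia.
move=> h; exfalso; move: h c1 h1 h2; move: (Imz z) (Imz _) (_ ^+ 2) => y y' c h c1 h1 h2.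
have p1 : 1 < y' * y by nra.
have := ler_wpM2l (ltW (lt_trans ltr01 p1)) c1.
by move: (y' * y) p1 h => p p1 h; lra.
Qed.

Lemma Htilde_high z : Htilde R z -> 3 / 4 <= Imz z ^+ 2.
Proof.
move=> /HtildeP; rewrite /rho; have /andP[_ h] := distZ2_bounds (Rez z); lra.
Qed.

Lemma Htilde_far z n : Htilde R z -> 1 <= (Rez z - n%:~R) ^+ 2 + Imz z ^+ 2.
Proof.
move=> /HtildeP h; apply: (le_trans h); rewrite /rho lerD2r; exact: distZ2_min.
Qed.

(** Both z and M z have imaginary part at least sqrt 3 / 2, so |c| <= 1. If c
    = 1 up to sign, then M z = a - 1 / (z + d), and |z + d| >= 1 and |M z - a|
    >= 1 force |z + d| = 1. *)
Lemma Htilde_pair M z : Htilde R z -> Htilde R (actSL M z) ->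
  (exists n, eq_up_to_sign M (expgz matA n)) \/
  (exists k n, Hside R k z /\ eq_up_to_sign M (expgz matA n * fmat k)%g).
Proof.
move=> hz hw.
have [c0|c0] := eqVneq (val M 1 0) 0; first by left; exact: lower0_expA.
right.
have c1 : val M 1 0 = 1 \/ val M 1 0 = -1.
  have h1 := Htilde_high hz; have h2 := Htilde_high hw; have h := Imz_high M z.
  have c2 : entry M 1 0 ^+ 2 < 4.
    have y0 := Imz_gt0 z; have y1 := Imz_gt0 (actSL M z).
    rewrite ltNge; apply/negP => c4.
    have : 3 / 4 * (3 / 4) <= (Imz (actSL M z) * Imz z) ^+ 2.
      by rewrite exprMn; apply: ler_pM => //; lra.
    have p0 : 0 < Imz (actSL M z) * Imz z by exact: mulr_gt0.
    move: h c4 p0; move: (_ * _) (_ ^+ 2) => p c h c4 p0 hp.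
    have : p * 4 <= 1 by apply: le_trans h; rewrite ler_pM2l.
    by move=> p4; nra.
  move: c2; rewrite /entry -rmorphXn /= -[4]/(4%:~R) ltr_int.
  by move: (val M 1 0) c0 => c c0; rewrite expr2 => c2; nia.
(* Choose the sign of M so that c = 1. *)
have [N MN n10] : exists2 N, eq_up_to_sign M N & val N 1 0 = 1.
  case: c1 => c1; first by exists M; rewrite // eq_up_to_sign_refl.
  exists (M * (matS * matS))%g; last by rewrite oppSL_S2 mxE c1.
  by apply/eq_up_to_signP; right; rewrite oppSL_S2 opprK.
rewrite (act_sign z MN) in hw.
set k := - val N 1 1; set a := val N 0 0; exists k, (k + 3 - a); split; last first.
  rewrite (_ : (_ * _)%g = N) //; apply: val_inj.
  rewrite (mulSL_mat2 (val_expA _) (val_fmat k)) [RHS]mat2_eta n10.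
  have := detSL N; rewrite n10 /k /a => det.
  by congr mat2; rewrite ?opprK; [ring| |ring|ring]; move: det; 
    move: (val N 0 0) (val N 0 1) (val N 1 1) => p q r; rewrite mulr1; lia.
have e10 : entry N 1 0 = 1 by rewrite /entry n10.
have denE : den N z = (Rez z - k%:~R) ^+ 2 + Imz z ^+ 2.
  by rewrite /den e10 !mul1r /k rmorphN opprK.
have hd (m : int) : 1 <= (Rez z - m%:~R) ^+ 2 + Imz z ^+ 2 := Htilde_far m hz.
have d0 := den_gt0 N z; have d1 : 1 <= den N z by rewrite denE.
have det := detR N; rewrite e10 mulr1 in det.
have d2 : den N z <= 1.
  have := Htilde_far a hw; rewrite Rez_act Imz_act e10 !mul1r -/(entry N 0 0).
  have -> : ((entry N 0 0 * Rez z + entry N 0 1) * (Rez z + entry N 1 1) +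
     entry N 0 0 * 1 * Imz z ^+ 2) / den N z - entry N 0 0 =
     - (Rez z - k%:~R) / den N z.
    have -> : entry N 0 1 = entry N 0 0 * entry N 1 1 - 1 by lra.
    have kE : k%:~R = - entry N 1 1 by rewrite /k rmorphN.
    apply: (mulIf (lt0r_neq0 d0)); rewrite mulrBl !divfK ?lt0r_neq0 //.
    by rewrite denE kE; ring.
  rewrite !exprMn sqrrN -mulrDl -denE exprVn expr2 invfM mulrA divff ?lt0r_neq0 // mul1r.
  by rewrite -invr_ge1 ?unitfE ?lt0r_neq0.
have r1 : (Rez z - k%:~R) ^+ 2 + Imz z ^+ 2 = 1.
  by rewrite -denE; apply/eqP; rewrite eq_le d1 d2.
have hk : `|Rez z - k%:~R| <= 1 / 2.
  have := hd (k + 1); have := hd (k - 1).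
  have -> : (k + 1)%:~R = k%:~R + 1 :> R by rewrite rmorphD.
  have -> : (k - 1)%:~R = k%:~R - 1 :> R by rewrite rmorphB.
  move=> h1 h2.
  rewrite ler_norml; move: r1 h1 h2; move: (Rez z) (k%:~R) => x t r1 h1 h2.
  by apply/andP; split; lra.
by apply/HsideP; split=> //; rewrite (rhoE hk).
Qed.

(** One has to see that |- 1 / z - m| >= 1 for every integer m, that is 1 + 2
    m x + (m^2 - 1) |z|^2 >= 0. This is clear for |m| <= 1; for |m| >= 2 use
    |z|^2 >= x^2 + 1 / 9 and complete the square. *)
Lemma act_S_Htilde z : 1 / 3 < Imz z -> `|Rez z| <= 1 / 2 -> Rez z ^+ 2 + Imz z ^+ 2 <= 1 ->
  Htilde R (actSL matS z).
Proof.
move=> y3 x2 n1; apply/HtildeP; rewrite /rho /distZ2.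
set m := nint _; rewrite Rez_S Imz_S.
move: y3 x2 n1; have y0 := Imz_gt0 z; rewrite ler_norml => y3 /andP[x1 x2] n1.
set n := Rez z ^+ 2 + _ in n1 *.
have nE : n = Rez z ^+ 2 + Imz z ^+ 2 by [].
have n0 : 0 < n by rewrite nE ltr_wpDl ?sqr_ge0 // exprn_gt0.
clearbody n.
have -> : (- Rez z / n - m%:~R) ^+ 2 + (Imz z / n) ^+ 2 =
    (1 + 2 * m%:~R * Rez z + m%:~R ^+ 2 * n) / n.
  transitivity ((Rez z ^+ 2 + Imz z ^+ 2 + 2 * m%:~R * Rez z * n + m%:~R ^+ 2 * n ^+ 2) / n ^+ 2).
    by field; rewrite lt0r_neq0.
  by rewrite -nE; field; rewrite lt0r_neq0.
rewrite ler_pdivlMr // mul1r.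
clearbody m; move: (Rez z) (Imz z) y0 y3 x1 x2 nE => x y y0 y3 x1 x2 nE.
have [->|[->|[->|m2]]] : m = 0 \/ m = 1 \/ m = -1 \/ 4 <= m ^+ 2.
- have [|] := leP (absz m) 1%N; first by lia.
  by move=> h; right; right; right; rewrite expr2; nia.
- by rewrite mulr0z; lra.
- by rewrite mulr1z; lra.
- by rewrite (_ : (-1)%:~R = -1 :> R) //; lra.
have m4 : 4 <= m%:~R ^+ 2 :> R.
  by rewrite -rmorphXn /= -[4]/(4%:~R) ler_int.
move: (m%:~R : R) m4 => t m4.
have n9 : x ^+ 2 + 1 / 9 <= n by rewrite nE; nra.
suff : 0 <= 1 + 2 * t * x + (t ^+ 2 - 1) * (x ^+ 2 + 1 / 9).
  by move=> h; have := @ler_wpM2l _ (t ^+ 2 - 1) _ _ _ n9; lra.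
have k0 : 0 < t ^+ 2 - 1 by lra.
rewrite -(pmulr_rge0 _ k0).
have -> : (t ^+ 2 - 1) * (1 + 2 * t * x + (t ^+ 2 - 1) * (x ^+ 2 + 1 / 9)) =
  ((t ^+ 2 - 1) * x + t) ^+ 2 + ((t ^+ 2 - 1) ^+ 2 / 9 - 1) by field.
apply: addr_ge0; first exact: sqr_ge0.
by move: (t ^+ 2) m4 {k0 n9} => s m4; nra.
Qed.

Lemma shift_strip z : exists n, `|Rez (actSL (expgz matA n) z)| <= 1 / 2.
Proof. by exists (nint (Rez z)); rewrite Rez_expA nint_norm. Qed.

Lemma reduce_high z : 1 / 3 < Imz z -> exists M, Htilde R (actSL M z).
Proof.
move=> y3; have [n hn] := shift_strip z.
set w := actSL _ z in hn.
have [h|h] := leP (Rez w ^+ 2 + Imz w ^+ 2) 1.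
  exists (matS * expgz matA n)%g; rewrite act_mul; apply: act_S_Htilde => //.
  by rewrite Imz_expA.
by exists (expgz matA n); apply/HtildeP; rewrite (@rhoE _ 0) ?subr0 // ltW.
Qed.

(** After a translation, either the imaginary part is above 1 / 3 and one
    inversion is enough, or the inversion at least doubles it. *)
Lemma reduce_SL z : exists M, Htilde R (actSL M z).
Proof.
suff : forall n z, 1 / 3 < 2 ^+ n * Imz z -> exists M, Htilde R (actSL M z).
  have y0 := Imz_gt0 z.
  move=> /(_ (Num.bound (Imz z)^-1) z); apply.
  have : (Imz z)^-1 < (Num.bound (Imz z)^-1)%:R.
    by rewrite archi_boundP // invr_ge0 ltW.
  move: (Num.bound _) => n h.
  have : n%:R <= 2 ^+ n :> R by rewrite -natrX ler_nat ltnW // ltn_expl.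
  move=> h2; have h3 : (Imz z)^-1 < 2 ^+ n by exact: lt_le_trans h2.
  have : 1 < 2 ^+ n * Imz z by rewrite -ltr_pdivrMr // div1r.
  by move=> h4; lra.
elim=> [|n IH] {}z hz; first by rewrite expr0 (mul1r (Imz z)) in hz; exact: reduce_high.
have [y3|y3] := ltP (1 / 3) (Imz z); first exact: reduce_high.
have [m hm] := shift_strip z; set w := actSL _ z in hm.
have wy : Imz w = Imz z by rewrite Imz_expA.
have y0 := Imz_gt0 w.
have [M hM] : exists M, Htilde R (actSL M (actSL matS w)).
  apply: IH; apply: (lt_le_trans hz); rewrite exprSr -mulrA ler_pM2l ?exprn_gt0 //.
  rewrite Imz_S -wy; set n2 := _ + _.
  have n0 : 0 < n2 by rewrite ltr_wpDl ?sqr_ge0 // exprn_gt0.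
  rewrite ler_pdivlMr // mulrC mulrA -[leRHS]mul1r ler_pM2r // /n2.
  move: hm; rewrite ler_norml => /andP[h1 h2]; rewrite -wy in y3.
  by move: (Rez w) (Imz w) h1 h2 y0 y3 => x y h1 h2 y0 y3; nra.
by exists (M * matS * expgz matA m)%g; rewrite (act_mul _ (expgz matA m)) (act_mul M).
Qed.

Lemma Htilde_expA n z : Htilde R (actSL (expgz matA n) z) <-> Htilde R z.
Proof. by split=> /HtildeP h; apply/HtildeP; move: h; rewrite rho_expA. Qed.

Lemma reduce_derived z : exists2 M, derived_subgroup SL2Z M & Htilde R (actSL M z).
Proof.
have [M hM] := reduce_SL z; have [n fn] := SL_coset M.
exists (expgz matA (- n) * M)%g; first by rewrite derived_SL2Z.
by rewrite act_mul; apply/Htilde_expA.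
Qed.

(** Combine the description of the matrices mapping a point of H~ into H~ with
    the divisibility by 6 of the exponents of the powers of A in the derived
    subgroup. *)
Lemma derived_pair M z : derived_subgroup SL2Z M -> Htilde R z -> Htilde R (actSL M z) ->
  (exists q, actSL M z = actSL (expgz matA (6 * q)) z) \/
  (exists k q, Hside R k z /\ actSL M z = actSL (expgz matA (6 * q)) (actSL (fmat k) z)).
Proof.
move=> dM hz hw; case: (Htilde_pair hz hw) => [[n e]|[k [n [hk e]]]].
  by left; have [q nq] := derived_expA dM e; exists q; rewrite -nq; exact: act_sign.
right; exists k.
have dG := derived_is_subgroup SL2Z.
have e' : eq_up_to_sign (M * (fmat k)^-1)%g (expgz matA n).
  apply/projG_eq; rewrite !projGM; move/projG_eq: e => ->.
  by rewrite -projGM -mulgA mulgV mulg1.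
have [|q nq] := derived_expA _ e'.
  by apply: (subgroupM dG) => //; apply: (subgroupV dG); exact: fmat_in_derived.
by exists q; split=> //; rewrite -nq -act_mul; exact: act_sign.
Qed.

End HalfPlaneAction.

(** * Covering action, cusp and geodesic sides *)

Section CuspAndCovering.
Variable R : realType.
Local Notation H := (HH R).
Local Notation G' := (derived_subgroup PSL2Z).
Local Notation SL' := (derived_subgroup SL2Z).
Implicit Types (z w : H) (M N : SL2Z).
Local Notation cusp := (projG cuspSL).

Lemma tr_mat2 (a b c d : int) : \tr (mat2 a b c d) = a + d.
Proof.
rewrite /mxtrace !big_ord_recl big_ord0 addr0 !mxE /=; congr (_ + _).
Qed.

Lemma parabolic_cusp : parabolic cusp.
Proof.
split.
  move=> /projG_eq /eq_up_to_signP; rewrite val_cuspSL.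
  by case=> /matrixP /(_ 0 1); rewrite !mxE.
have /eq_up_to_signP h := repr_projG cuspSL.
by case: h => ->; rewrite val_cuspSL ?mat2_opp tr_mat2.
Qed.

Lemma hexgroupE : projG @` generated [set cuspSL] = generated [set cusp].
Proof. by rewrite (image_generated projGM) image_set1. Qed.

Lemma hexgroupP g : generated [set cusp] g <-> exists q, g = projG (expgz matA (6 * q)).
Proof.
rewrite generated_set1; split.
  by case=> m _ <-; exists (- m); rewrite -projG_cusp_expgz opprK.
by case=> q ->; exists (- q) => //; rewrite projG_cusp_expgz.
Qed.

Lemma hexgroup_derived : generated [set cusp] `<=` G'.
Proof.
by move=> g /hexgroupP[q ->]; apply/derivedG_expA; exists q.
Qed.

Lemma actG_expA n z : actG (projG (expgz matA n)) z = actSL (expgz matA n) z.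
Proof. exact: actG_projG. Qed.

(** An element that maps a point above height 1 above height 1 has a zero
    lower left entry, hence is a translation. *)
Lemma cusp_region_high (Gam : set PSL2Z) (t : R) : 1 <= t -> Gam cusp -> Gam `<=` G' ->
  cusp_region Gam cusp [set z | t < Imz z].
Proof.
move=> t1 Gc GG; have t0 : 0 < t by lra.
have cE : cusp = projG (expgz matA (6 * (- 1))) by rewrite -projG_cusp_expgz opprK.
split=> //.
- by exists t => //; left.
- exact: parabolic_cusp.
- apply/seteqP; split=> [_ [z /= hz <-]|z /= hz].
    by rewrite cE actG_expA Imz_expA.
  exists (actG cusp^-1%g z); last by rewrite actGVK.
  by rewrite cE -(morphVg projGM) -expgzN actG_expA Imz_expA.
- move=> g z /GG; rewrite derived_PSL2Z => -[M dM <-] /= hz; rewrite actG_projG => hw.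
  have [n e] : exists n, eq_up_to_sign M (expgz matA n).
    by apply: (@high_expA R M z); lra.
  have [q nq] := derived_expA dM e.
  by apply/hexgroupP; exists q; rewrite -nq; apply/projG_eq.
Qed.

Lemma int_sqr_gap (t : int) : 4 <= t ^+ 2 -> t ^+ 2 = 4 \/ 9 <= t ^+ 2.
Proof.
rewrite !expr2; have [h|h] := leqP (absz t) 2; last by right; nia.
have t2 : t = -2 \/ t = -1 \/ t = 0 \/ t = 1 \/ t = 2 by lia.
by case: t2 => [->|[->|[->|[->|->]]]]; auto.
Qed.

(** The real equation of the axis of M when M is hyperbolic. *)
Definition fixform M z : R := entry R M 1 0 * (Rez z ^+ 2 + Imz z ^+ 2)
  + (entry R M 1 1 - entry R M 0 0) * Rez z - entry R M 0 1.

(** With the determinant equal to 1 this is |c z^2 + (d - a) z - b|^2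
    expanded, since M z - z = - (c z^2 + (d - a) z - b) / (c z + d). *)
Lemma displacement M z :
  ((Rez (actSL M z) - Rez z) ^+ 2 + (Imz (actSL M z) - Imz z) ^+ 2) * den M z =
  fixform M z ^+ 2 + ((entry R M 0 0 + entry R M 1 1) ^+ 2 - 4) * Imz z ^+ 2.
Proof.
have d0 : den M z != 0 by rewrite lt0r_neq0 ?den_gt0.
rewrite Rez_act Imz_act /fixform; apply: (mulIf d0); move: d0 (detR R M).
rewrite /den; move: (entry R M 0 0) (entry R M 0 1) (entry R M 1 0) (entry R M 1 1).
move: (Rez z) (Imz z) => x y a b c d; set n := (_ ^+ 2 + _) => n0 det.
(* The discriminant of the quadratic form fixed by M. *)
have e4 : (a + d) ^+ 2 - 4 = (d - a) ^+ 2 + 4 * b * c.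
  by rewrite -[4]mulr1 -{1}det; ring.
have -> : y / n - y = (y * (a * d - b * c) - y * n) / n by rewrite det; field.
have -> : ((a * x + b) * (c * x + d) + a * c * y ^+ 2) / n - x =
  ((a * x + b) * (c * x + d) + a * c * y ^+ 2 - x * n) / n by field.
have cl (p q : R) : ((p / n) ^+ 2 + (q / n) ^+ 2) * n * n = p ^+ 2 + q ^+ 2 by field.
by rewrite cl e4 /n; ring.
Qed.

(** The first case is that of hyperbolic elements, with squared trace at least
    9; the second one is that of parabolic elements that move infinity, the
    third one that of translations. *)
Lemma displacement_bound M z : SL' M -> ~ eq_up_to_sign M 1%g ->
  let Q := fixform M z ^+ 2 + ((entry R M 0 0 + entry R M 1 1) ^+ 2 - 4) * Imz z ^+ 2 in
  [\/ 5 * Imz z ^+ 2 <= Q, Imz z ^+ 4 <= Q | 1 <= Q].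
Proof.
move=> dM M1 Q; have y0 := Imz_gt0 z.
have := derived_not_elliptic dM.
set t := val M 0 0 + val M 1 1 => t4.
have tE : entry R M 0 0 + entry R M 1 1 = t%:~R by rewrite /entry -rmorphD.
have [t2|t2] : t ^+ 2 = 4 \/ 9 <= t ^+ 2.
  exact: int_sqr_gap.
  have tR : (entry R M 0 0 + entry R M 1 1) ^+ 2 - 4 = 0.
    by rewrite tE -rmorphXn /= t2 subrr.
  have QE : Q = fixform M z ^+ 2 by rewrite /Q tR mul0r addr0.
  have [c0|c0] := eqVneq (val M 1 0) 0.
    apply: Or33; rewrite QE /fixform.
    have := detSL M; rewrite c0 mulr0 subr0 => /mulz_eq1 ad.
    have -> : entry R M 1 0 = 0 by rewrite /entry c0.
    have -> : entry R M 1 1 - entry R M 0 0 = 0.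
      by rewrite /entry; case: ad => -[-> ->]; rewrite subrr.
    rewrite !mul0r !add0r sqrrN /entry -rmorphXn /= -[1]/(1%:~R) ler_int.
    have b0 : val M 0 1 != 0.
      apply/eqP => b0; apply: M1; apply/eq_up_to_signP.
      rewrite [val M]mat2_eta [X in _ \/ _ = - X](_ : _ = mat2 1 0 0 1); last by rewrite [LHS]mat2_eta !mxE.
      rewrite [X in _ = X \/ _](_ : _ = mat2 1 0 0 1); last by rewrite [LHS]mat2_eta !mxE.
      by rewrite mat2_opp c0 b0; case: ad => -[-> ->]; [left|right]; congr mat2.
    by rewrite expr2; move: (val M 0 1) b0 => b b0; nia.
  apply: Or32; rewrite QE.
  have c1 : 1 <= entry R M 1 0 ^+ 2.
    rewrite /entry -rmorphXn /= -[1]/(1%:~R) ler_int.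
    by move: (val M 1 0) c0 => c c0; rewrite expr2; nia.
  have det := detR R M.
  have e : entry R M 1 0 * fixform M z =
     (entry R M 1 0 * Rez z + (entry R M 1 1 - entry R M 0 0) / 2) ^+ 2
      + entry R M 1 0 ^+ 2 * Imz z ^+ 2.
    rewrite /fixform; move: tR det.
    move: (entry R M 0 0) (entry R M 0 1) (entry R M 1 0) (entry R M 1 1) => a b c d tR det.
    have bc : b * c = - (d - a) ^+ 2 / 4 by lra.
    have -> : c * (c * (Rez z ^+ 2 + Imz z ^+ 2) + (d - a) * Rez z - b) =
      c * (c * (Rez z ^+ 2 + Imz z ^+ 2) + (d - a) * Rez z) - b * c by ring.
    by rewrite bc; field.
  have h1 : entry R M 1 0 ^+ 2 * Imz z ^+ 2 <= entry R M 1 0 * fixform M z.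
    by rewrite e lerDr sqr_ge0.
  have h2 : 0 <= entry R M 1 0 ^+ 2 * Imz z ^+ 2 by rewrite mulr_ge0 ?sqr_ge0.
  have h3 : (entry R M 1 0 ^+ 2 * Imz z ^+ 2) ^+ 2 <= (entry R M 1 0 * fixform M z) ^+ 2.
    by rewrite ler_pXn2r // nnegrE ?(le_trans h2 h1).
  rewrite [X in _ <= X]exprMn in h3.
  move: (entry R M 1 0 ^+ 2) c1 h3 => C c1 h3.
  have C0 : 0 < C by lra.
  have : C * (C * Imz z ^+ 4) <= C * fixform M z ^+ 2 by apply: le_trans h3; rewrite le_eqVlt; apply/orP; left; apply/eqP; ring.
  rewrite ler_pM2l //; apply: le_trans.
  by rewrite ler_peMl // exprn_ge0 // ltW.
apply: Or31; rewrite /Q tE -rmorphXn /=.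
have : 5 <= (t ^+ 2)%:~R - 4 :> R.
  have : 9%:~R <= (t ^+ 2)%:~R :> R by rewrite ler_int.
  by rewrite (_ : 9%:~R = 9 :> R) //; lra.
move=> h; have := ler_wpM2r (sqr_ge0 (Imz z)) h.
by have := sqr_ge0 (fixform M z); lra.
Qed.

(** A nontrivial element of the derived subgroup moves every point w by an
    amount that is bounded below by a continuous positive function of Im w, so
    that it cannot map a point of a small neighbourhood into this
    neighbourhood. *)
Lemma covering_derived : covering_action R G'.
Proof.
split; first exact: derived_is_subgroup.
move=> z; have y0 := Imz_gt0 z.
(* The radius e makes 16 e^2 smaller than each of the three lower bounds of
   displacement_bound on the ball, where Im w is at least 3 / 4 of Im z. *)
pose e := Num.min (Imz z / 4) (Num.min (Imz z ^+ 2 / 16) (1 / 16)).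
have e0 : 0 < e by rewrite /e !lt_min !divr_gt0 ?exprn_gt0.
have [e1 e2 e3] : [/\ e <= Imz z / 4, e <= Imz z ^+ 2 / 16 & e <= 1 / 16].
  by rewrite /e !ge_min !lexx !orbT.
exists [set w | `|Rez z - Rez w| < e /\ `|Imz z - Imz w| < e].
  apply: (@filterI _ _ (nbhs_filter z)).
    exact: near_dist_lt (@continuous_Rez R) e0.
  exact: near_dist_lt (@continuous_Imz R) e0.
move=> g w; rewrite derived_PSL2Z => -[M dM <-] [/= r1 i1] []; rewrite actG_projG => r2 i2.
have [/projG_eq -> //|M1] := EM (eq_up_to_sign M 1%g).
exfalso; have d0 := den_gt0 M w; have y1 := Imz_gt0 w.
have dI : den M w * Imz (actSL M w) = Imz w by rewrite Imz_act mulrC divfK ?lt0r_neq0.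
have D := displacement M w.
have B := displacement_bound w dM M1.
rewrite /= -D in B.
move: B r1 i1 r2 i2 dI; rewrite !ltr_norml.
move: (Rez (actSL M w)) (Imz (actSL M w)) (Rez w) (Imz w) (den M w) y1 d0.
move: (Rez z) (Imz z) e y0 e0 e1 e2 e3 => {D dM M1 M w z}.
move=> x0 y0 e y00 e0 e1 e2 e3 X Y x y n y1 n0 B /andP[r1 r1'] /andP[i1 i1'] /andP[r2 r2'] /andP[i2 i2'] dI.
have n2 : n <= 2.
  rewrite leNgt; apply/negP => n2.
  have Y0 : 0 < Y by lra.
  by have := ltr_pM2r Y0 2 n; rewrite n2 dI; lra.
have q1 : (X - x) ^+ 2 <= (2 * e) ^+ 2.
  by rewrite -ler_sqrt ?sqrtr_sqr ?sqr_ge0 // [X in _ <= X]ger0_norm ?ler_norml; lra.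
have q2 : (Y - y) ^+ 2 <= (2 * e) ^+ 2.
  by rewrite -ler_sqrt ?sqrtr_sqr ?sqr_ge0 // [X in _ <= X]ger0_norm ?ler_norml; lra.
have q : ((X - x) ^+ 2 + (Y - y) ^+ 2) * n <= 16 * e ^+ 2.
  apply: (@le_trans _ _ ((2 * e) ^+ 2 * 2 * 2)); last by rewrite exprMn; lra.
  apply: ler_pM; [|exact: ltW| |exact: n2]; first by rewrite addr_ge0 ?sqr_ge0.
  by lra.
have yy : 3 / 4 * y0 <= y by lra.
have y00' : 0 <= 3 / 4 * y0 by lra.
have y2 : (3 / 4 * y0) ^+ 2 <= y ^+ 2 by rewrite ler_pXn2r // nnegrE; lra.
have y4 : (3 / 4 * y0) ^+ 4 <= y ^+ 4 by rewrite ler_pXn2r // nnegrE; lra.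
have ee1 : e ^+ 2 <= (y0 / 4) ^+ 2 by rewrite ler_pXn2r // nnegrE; lra.
have ee2 : e ^+ 2 <= (y0 ^+ 2 / 16) ^+ 2 by rewrite ler_pXn2r // nnegrE; lra.
have ee3 : e ^+ 2 <= (1 / 16) ^+ 2 by rewrite ler_pXn2r // nnegrE; lra.
have p2 : 0 < y0 ^+ 2 by rewrite exprn_gt0.
have p4 : 0 < y0 ^+ 4 by rewrite exprn_gt0.
case: B => B; move: (le_trans B q) => {}B.
- by move: y2 ee1; rewrite !expr_div_n !exprMn; lra.
- move: y4 ee2; rewrite expr_div_n -exprM !exprMn (_ : 2 * 2 = 4)%N //.
  by lra.
- by move: ee3; rewrite expr_div_n; lra.
Qed.

Lemma covering_sub (K : set PSL2Z) : is_subgroup K -> K `<=` G' -> covering_action R K.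
Proof.
move=> KG KK; split=> // z; have [_ /(_ z)[U nU hU]] := covering_derived.
by exists U => // g w /KK; exact: hU.
Qed.

End CuspAndCovering.

Section Geodesics.
Variable R : realType.
Local Notation H := (HH R).

Lemma arc_subproof (t : R) : 0 < 2 * expR t / (expR t ^+ 2 + 1).
Proof. by rewrite divr_gt0 ?mulr_gt0 ?expR_gt0 // addr_gt0 ?exprn_gt0 ?expR_gt0. Qed.

(** The unit half-circle centred at x0 with its hyperbolic arc length
    parameter: the real and imaginary parts are x0 + tanh t and 1 / cosh t. *)
Definition arc_point (x0 t : R) : H :=
  mkH (x0 + (expR t ^+ 2 - 1) / (expR t ^+ 2 + 1)) (arc_subproof t).

(** The argument of cosh^-1 simplifies to (e^(s-t) + e^(t-s)) / 2. *)
Lemma hdist_arc x0 s t : hdist (arc_point x0 s) (arc_point x0 t) = `|s - t|.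
Proof.
rewrite /hdist /arc_point !Rez_mkH !Imz_mkH.
set a := expR s; set b := expR t.
have a0 : 0 < a := expR_gt0 s; have b0 : 0 < b := expR_gt0 t.
have a1 : a ^+ 2 + 1 != 0 by rewrite lt0r_neq0 // addr_gt0 ?exprn_gt0.
have b1 : b ^+ 2 + 1 != 0 by rewrite lt0r_neq0 // addr_gt0 ?exprn_gt0.
have na := lt0r_neq0 a0; have nb := lt0r_neq0 b0.
set c := 1 + _.
have cE : c = (a / b + b / a) / 2.
  by rewrite /c; field; rewrite na nb a1 b1.
rewrite {}cE {c}.
have -> : ((a / b + b / a) / 2) ^+ 2 - 1 = ((a / b - b / a) / 2) ^+ 2.
  by field; rewrite na nb.
rewrite sqrtr_sqr.
have ab : a / b = expR (s - t) by rewrite expRD expRN.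
have ba : b / a = expR (t - s) by rewrite expRD expRN.
have [st|st] := leP s t.
  have h : a / b <= b / a by rewrite ab ba ler_expR; lra.
  rewrite ler0_norm; last by lra.
  rewrite (_ : _ + _ = b / a); last by lra.
  by rewrite ba expRK ler0_norm; lra.
have h : b / a <= a / b by rewrite ab ba ler_expR; lra.
rewrite ger0_norm; last by lra.
rewrite (_ : _ + _ = a / b); last by lra.
by rewrite ab expRK gtr0_norm; lra.
Qed.

(** The arc where |tanh t| <= 1 / 2 has length ln 3. *)
Lemma geodesic_Hside k : geodesic_segment (Hside R k).
Proof.
(* The parameter is shifted by l so that the arc starts at 0. *)
pose l := ln 3 / 2 : R.
have ln3 : 0 <= ln 3 :> R by rewrite ln_ge0 //; lra.
have e2 t : expR (t - l) ^+ 2 = expR (2 * t) / 3.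
  rewrite expr2 -expRD (_ : t - l + (t - l) = 2 * t - ln 3); last by rewrite /l; field.
  by rewrite expRD expRN lnK // posrE.
exists (ln 3), (fun t => arc_point k%:~R (t - l)); split=> //.
  by move=> s t _ _; rewrite hdist_arc; congr `|_|; ring.
apply/seteqP; split=> [z /HsideP[h]|_ [t /= /andP[t0 t1] <-]]; last first.
  set p := arc_point _ _; set E := expR (t - l) ^+ 2.
  have rE : Rez p - k%:~R = (E - 1) / (E + 1) by rewrite Rez_mkH addrAC subrr add0r.
  have E13 : 1 / 3 <= E <= 3.
    have h0 : 1 <= expR (2 * t) by rewrite -[X in X <= _]expR0 ler_expR; lra.
    have h1 : expR (2 * t) <= 9.
      rewrite (_ : 9 = expR (ln 3 + ln 3)); first by rewrite ler_expR; lra.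
      by rewrite expRD lnK ?posrE //; lra.
    by rewrite /E e2; apply/andP; split; lra.
  case/andP: E13 => E1 E3.
  have hr : `|Rez p - k%:~R| <= 1 / 2.
    by rewrite rE ler_norml ler_pdivlMr ?ler_pdivrMr; lra.
  apply/HsideP; split=> //; rewrite (rhoE hr) rE Imz_mkH /E.
  by field; rewrite lt0r_neq0 // addr_gt0 ?exprn_gt0 ?expR_gt0.
rewrite (rhoE h); set x := Rez z - _ in h *; set y := Imz z => xy.
have y0 : 0 < y := Imz_gt0 z.
move: h; rewrite ler_norml => /andP[x1 x2].
have q0 : 0 < y / (1 - x) by rewrite divr_gt0 //; lra.
have qq : (y / (1 - x)) ^+ 2 = (1 + x) / (1 - x).
  have nx : 1 - x != 0 by rewrite lt0r_neq0 //; lra.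
  have -> : (1 + x) / (1 - x) = (1 - x ^+ 2) / (1 - x) ^+ 2 by field.
  by rewrite expr_div_n -xy [x ^+ 2 + _]addrC addrK.
have lq : ln (y / (1 - x)) = ln ((1 + x) / (1 - x)) / 2.
  have e (q : R) : 0 < q -> ln (q ^+ 2) = 2 * ln q.
    by move=> ?; rewrite expr2 lnM ?posrE //; lra.
  by rewrite -qq e //; lra.
have p0 : 0 < (1 + x) / (1 - x) by rewrite -qq exprn_gt0.
exists (ln (y / (1 - x)) + l).
  rewrite /= /l lq; apply/andP; split.
    have : ln (1 / 3) <= ln ((1 + x) / (1 - x)) by rewrite ler_ln ?posrE // ler_pdivlMr; lra.
    by rewrite div1r lnV ?posrE //; lra.
  have : ln ((1 + x) / (1 - x)) <= ln 3 by rewrite ler_ln ?posrE // ler_pdivrMr; lra.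
  by lra.
have nx : 1 - x != 0 by rewrite lt0r_neq0 //; lra.
apply: HH_ext; rewrite ?Rez_mkH ?Imz_mkH addrK lnK ?posrE // qq.
  rewrite (_ : Rez z = k%:~R + x); last by rewrite /x addrC subrK.
  by congr (_ + _); field; rewrite nx /= lt0r_neq0 //; lra.
by rewrite -/y; field; rewrite nx /= lt0r_neq0 //; lra.
Qed.

End Geodesics.

(** * The torus as a quotient of the plane *)

Section Torus.
Variable R : realType.
Implicit Types (v w : R * R) (s t : R).

Definition circ s : R[i] := Complex (cos (2 * pi * s)) (sin (2 * pi * s)).
Definition torus_map v : R[i] * R[i] := (circ v.1, circ v.2).
Definition puncture : R[i] * R[i] := torus_map (0, 0).

Lemma circ_norm s : `|circ s| = 1.
Proof. by rewrite normc_def /= cos2Dsin2 sqrtr1. Qed.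

Lemma cosD2piz (x : R) (n : int) : cos (x + 2 * pi * n%:~R) = cos x /\ sin (x + 2 * pi * n%:~R) = sin x.
Proof.
have step (y : R) : cos (y + 2 * pi) = cos y /\ sin (y + 2 * pi) = sin y.
  by rewrite mulr_natl cosD2pi sinD2pi.
elim/int_ind: n => [|n [IH1 IH2]|n [IH1 IH2]]; first by rewrite mulr0 addr0.
  have -> : x + 2 * pi * (n.+1%:~R) = x + 2 * pi * n%:~R + 2 * pi.
    by rewrite (_ : Posz n.+1 = n%:Z + 1) ?rmorphD /=; [ring|lia].
  by have [-> ->] := step (x + 2 * pi * n%:~R).
have [<- <-] := step (x + 2 * pi * (- n.+1%:Z)%:~R).
have -> : x + 2 * pi * (- n.+1%:Z)%:~R + 2 * pi = x + 2 * pi * (- n%:Z)%:~R.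
  by rewrite (_ : - Posz n.+1 = - n%:Z - 1) ?rmorphB /=; [ring|lia].
by [].
Qed.

Lemma circ_eq s t : circ s = circ t <-> exists n : int, s - t = n%:~R.
Proof.
have pi0 := pi_gt0 R.
split=> [|[n st]]; last first.
  have [c1 c2] := cosD2piz (2 * pi * t) n.
  have e : 2 * pi * s = 2 * pi * t + 2 * pi * n%:~R by rewrite -mulrDr -st addrC subrK.
  by rewrite /circ e c1 c2.
(* The nearest integer reduces to an angle in [- pi, pi], where cos = 1 only at 0. *)
move=> [e1 e2]; pose n := nint (s - t); exists n.
set r := s - t in n *; have [h1 h2] := nint_bounds r; rewrite -/n in h1 h2.
have c1 : cos (2 * pi * (r - n%:~R)) = 1.
  have [h _] := cosD2piz (2 * pi * (r - n%:~R)) n.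
  rewrite -h -mulrDr subrK /r mulrBr cosB e1 e2 -!expr2; exact: cos2Dsin2.
suff : r - n%:~R = 0 by move/eqP; rewrite subr_eq0 => /eqP.
have h3 : `|2 * pi * (r - n%:~R)| <= pi.
  by rewrite ler_norml; apply/andP; split; nra.
have : `|2 * pi * (r - n%:~R)| = 0.
  apply: cos_inj; rewrite ?in_itv /= ?lexx ?normr_ge0 ?(ltW pi0) //.
  by rewrite cos_norm c1 cos0.
move/eqP; rewrite normr_eq0 mulf_eq0 => /orP[/eqP h|/eqP //]; lra.
Qed.

Lemma circ_surj (z : R[i]) : `|z| = 1 -> exists s, circ s = z.
Proof.
have pi0 := pi_gt0 R.
case: z => a b; rewrite normc_def => /(congr1 (fun x => complex.Re x ^+ 2)) /=.
rewrite sqr_sqrtr ?expr1n ?addr_ge0 ?sqr_ge0 // => ab.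
have a1 : -1 <= a <= 1 by have := sqr_ge0 b => hb; apply/andP; split; nra.
have ca : cos (acos a) = a by apply: acosK; rewrite in_itv.
have sa := sin_acos a1.
have [b0|b0] := leP 0 b.
  exists (acos a / (2 * pi)); rewrite /circ mulrC divfK; last by rewrite lt0r_neq0 //; lra.
  by rewrite ca sa -ab [a ^+ 2 + _]addrC addrK sqrtr_sqr ger0_norm.
exists (- acos a / (2 * pi)); rewrite /circ mulrC divfK; last by rewrite lt0r_neq0 //; lra.
by rewrite cosN sinN ca sa -ab [a ^+ 2 + _]addrC addrK sqrtr_sqr ltr0_norm ?opprK.
Qed.

Lemma continuous_circ : continuous circ.
Proof.
have l : continuous (fun s : R => 2 * pi * s).
  by apply: contM; [exact: cont_cst|move=> s; exact: cvg_id].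
by apply: continuous_Complex; apply: (cont_comp l); [exact: continuous_cos|exact: continuous_sin].
Qed.

Lemma continuous_torus_map : continuous torus_map.
Proof.
by apply: continuous_pair; [apply: (cont_comp (@continuous_fst_R R))|apply: (cont_comp (@continuous_snd_R R))];
  exact: continuous_circ.
Qed.

Lemma torus_mapP v : torus (R:=R) (torus_map v).
Proof. by split; exact: circ_norm. Qed.

Lemma torus_map_eq v w : torus_map v = torus_map w <->
  exists i j : int, v - w = (i%:~R, j%:~R).
Proof.
case: v w => [a b] [a' b']; split.
  by move=> h; have [i e1] := (circ_eq _ _).1 (congr1 fst h);
    have [j e2] := (circ_eq _ _).1 (congr1 snd h); exists i, j; rewrite -e1 -e2.
by move=> [i [j [e1 e2]]]; congr pair; apply/circ_eq; [exists i|exists j].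
Qed.

(** If s and t have opposite signs, the point is already in the hexagon;
    otherwise when needed, the one with the larger absolute value is shifted
    by one towards the other side of 0. *)
Lemma square_to_hexagon s t : - (1 / 2) <= s -> s <= 1 / 2 -> - (1 / 2) <= t -> t <= 1 / 2 ->
  exists i j : int, hexnorm (s - i%:~R, t - j%:~R) <= 1.
Proof.
move=> s1 s2 t1 t2.
have ok (s' t' : R) (i j : int) : s - i%:~R = s' -> t - j%:~R = t' ->
    [/\ - 1 <= 2 * s' + t', 2 * s' + t' <= 1, - 1 <= s' + 2 * t', s' + 2 * t' <= 1
    & - 1 <= s' - t' <= 1] -> exists i j : int, hexnorm (s - i%:~R, t - j%:~R) <= 1.
  by move=> e1 e2 h; exists i, j; rewrite e1 e2; apply/hexnorm_le.
have t00 := @ok s t 0 0 (subr0 _) (subr0 _).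
have t10 := @ok (s - 1) t 1 0 erefl (subr0 _); have t01 := @ok s (t - 1) 0 1 (subr0 _) erefl.
have tn0 := @ok (s + 1) t (-1) 0 (congr1 (+%R s) (opprK 1)) (subr0 _).
have t0n := @ok s (t + 1) 0 (-1) (subr0 _) (congr1 (+%R t) (opprK 1)).
have [s0|s0] := leP 0 s; have [t0|t0] := leP 0 t.
- have [st|st] := leP t s.
    have [h|h] := leP (2 * s + t) 1.
      by apply: t00; clear - s1 s2 t1 t2 s0 t0 st h; split; lra.
    by apply: t10; clear - s1 s2 t1 t2 s0 t0 st h; split; lra.
  have [h|h] := leP (s + 2 * t) 1.
    by apply: t00; clear - s1 s2 t1 t2 s0 t0 st h; split; lra.
  by apply: t01; clear - s1 s2 t1 t2 s0 t0 st h; split; lra.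
- by apply: t00; clear - s1 s2 t1 t2 s0 t0; split; lra.
- by apply: t00; clear - s1 s2 t1 t2 s0 t0; split; lra.
- have [st|st] := leP s t.
    have [h|h] := leP (- 1) (2 * s + t).
      by apply: t00; clear - s1 s2 t1 t2 s0 t0 st h; split; lra.
    by apply: tn0; clear - s1 s2 t1 t2 s0 t0 st h; split; lra.
  have [h|h] := leP (- 1) (s + 2 * t).
    by apply: t00; clear - s1 s2 t1 t2 s0 t0 st h; split; lra.
  by apply: t0n; clear - s1 s2 t1 t2 s0 t0 st h; split; lra.
Qed.

Lemma lattice_reduction (a b : R) : exists i j : int, hexnorm (a - i%:~R, b - j%:~R) <= 1.
Proof.
have [a1 a2] := nint_bounds a; have [b1 b2] := nint_bounds b.
have [i [j h]] := square_to_hexagon a1 (ltW a2) b1 (ltW b2).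
exists (nint a + i), (nint b + j).
by rewrite !rmorphD /= !opprD !addrA.
Qed.

Lemma torus_map_surj x : torus (R:=R) x -> exists2 v, hexnorm v <= 1 & torus_map v = x.
Proof.
case: x => x y [/= /circ_surj[a <-] /circ_surj[b <-]].
have [i [j h]] := lattice_reduction a b; exists (a - i%:~R, b - j%:~R) => //.
rewrite -[RHS]/(torus_map (a, b)); apply/torus_map_eq; exists (- i), (- j).
by rewrite !rmorphN; congr pair; rewrite /= addrAC subrr add0r.
Qed.

Lemma rotz10_int k : exists i j : int, rotz k ((1, 0) : R * R) = (i%:~R, j%:~R).
Proof.
rewrite /rotz; elim: (absz _) => [|m [i [j IH]]]; first by exists 1, 0.
by exists (- j), (i + j); rewrite /= IH /rot /= rmorphN rmorphD.
Qed.

Lemma torus_map_puncture v : hexnorm v <= 1 -> torus_map v = puncture -> v = (0, 0).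
Proof.
move=> hv /torus_map_eq[i [j e]]; apply: (lattice_center hv (i := i) (j := j)).
by rewrite -e; case: v {hv e} => a b; congr pair; rewrite /= subr0.
Qed.

Lemma compact_hex (A : set (R * R)) : closed A -> (forall v, A v -> hexnorm v <= 1) -> compact A.
Proof.
move=> cA A1; pose I := [set` `[- 1, (1 : R)]].
apply: (@subclosed_compact _ A (I `*` I)) => //.
  by apply: compact_setX; exact: segment_compact.
move=> [s t] /A1 /hexnorm_le /= [? ? ? ? /andP[? ?]].
by split; rewrite /I /= in_itv /=; apply/andP; split; lra.
Qed.

Lemma closed_torus_image (A : set (R * R)) : closed A -> (forall v, A v -> hexnorm v <= 1) ->
  closed (torus_map @` A).
Proof.
move=> cA A1; apply: compact_closed; first exact: complex2_hausdorff.
apply: continuous_compact; last exact: compact_hex.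
by apply: continuous_subspaceT; exact: continuous_torus_map.
Qed.

Lemma closed_hexnorm_le r : closed [set v : R * R | hexnorm v <= r].
Proof.
by apply: (@closed_comp _ _ (@hexnorm R) [set y | y <= r]);
  [move=> v _; exact: continuous_hexnorm|exact: closed_le].
Qed.
Lemma closed_hexnorm_ge r : closed [set v : R * R | r <= hexnorm v].
Proof.
by apply: (@closed_comp _ _ (@hexnorm R) [set y | r <= y]);
  [move=> v _; exact: continuous_hexnorm|exact: closed_ge].
Qed.

(** A point of the hexagon at gauge at most half that of v is not congruent to
    v, and the image of the set of these points is compact, hence closed. *)
Lemma torus_far v : hexnorm v <= 1 -> 0 < hexnorm v ->
  \forall x \near torus_map v, torus (R:=R) x ->
    exists w, [/\ hexnorm v / 2 < hexnorm w, hexnorm w <= 1 & torus_map w = x].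
Proof.
move=> v1 v0; set r := hexnorm v / 2.
have h : nbhs (torus_map v) (~` (torus_map @` [set w | hexnorm w <= r])).
  apply: open_nbhs_nbhs; split.
    apply: closed_openC; apply: closed_torus_image; first exact: closed_hexnorm_le.
    by move=> w /= wr; apply: (le_trans wr); rewrite /r; lra.
  move=> [w /= wr /torus_map_eq[i [j e]]].
  have w1 : hexnorm w <= 1 by apply: (le_trans wr); rewrite /r; lra.
  have [wv|wv] := EM (w = v); first by move: wr; rewrite wv /r; lra.
  have [k [u [u2 wE _]]] := lattice_hexagon w1 v1 e wv.
  by move: wr; rewrite wE hexnorm_rotz hexnorm_edge0 // /r; lra.
apply: filterS h => x xr /torus_map_surj[w w1 wx]; exists w; split=> //.
by rewrite ltNge; apply/negP => wr; apply: xr; exists w.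
Qed.

(** The image of the outer part of the hexagon is closed and misses the
    puncture. *)
Lemma torus_near r : 0 < r -> \forall x \near puncture, torus (R:=R) x ->
  exists w, [/\ hexnorm w < r, hexnorm w <= 1 & torus_map w = x].
Proof.
move=> r0.
have h : nbhs puncture (~` (torus_map @` ([set w | hexnorm w <= 1] `&` [set w | r <= hexnorm w]))).
  apply: open_nbhs_nbhs; split.
    apply: closed_openC; apply: closed_torus_image; last by move=> w [].
    by apply: closedI; [exact: closed_hexnorm_le|exact: closed_hexnorm_ge].
  move=> [w /= [w1 wr] /(torus_map_puncture w1) w0].
  by move: wr; rewrite w0 hexnorm0; lra.
apply: filterS h => x xr /torus_map_surj[w w1 wx]; exists w; split=> //.
by rewrite ltNge; apply/negP => wr; apply: xr; exists w.
Qed.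

End Torus.

(** * The regular hexagon *)

Section HexagonModel.
Variable R : realType.
Implicit Types (v w : R * R).
Local Notation sqrt3 := (Num.sqrt 3 : R).

(** The map (s, t) -> (1 + w)(s + t w) with w = exp(i pi / 3), which sends the
    plane hexagon to the regular one. *)
Definition hexlin v : R[i] := Complex (3 / 2 * v.1) (sqrt3 / 2 * v.1 + sqrt3 * v.2).
Definition hexlinV (z : R[i]) : R * R :=
  (2 / 3 * complex.Re z, complex.Im z / sqrt3 - complex.Re z / 3).

Lemma sqrt3_sqr : sqrt3 ^+ 2 = 3. Proof. by rewrite sqr_sqrtr //; lra. Qed.
Lemma sqrt3_gt0 : 0 < sqrt3. Proof. by rewrite sqrtr_gt0; lra. Qed.

Lemma hexlinK : cancel hexlin hexlinV.
Proof.
case=> s t; rewrite /hexlin /hexlinV /=; congr pair; first by field.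
by have := lt0r_neq0 sqrt3_gt0 => h; field.
Qed.
Lemma hexlinVK : cancel hexlinV hexlin.
Proof.
case=> s t; rewrite /hexlin /hexlinV /=; congr Complex; first by field.
by have := lt0r_neq0 sqrt3_gt0 => h; field.
Qed.

Lemma continuous_hexlin : continuous hexlin.
Proof.
have c1 := @continuous_fst_R R; have c2 := @continuous_snd_R R.
have c k : continuous (fun _ : R * R => k : R) by exact: cont_cst.
by apply: continuous_Complex; [|apply: contD]; apply: contM.
Qed.
Lemma continuous_hexlinV : continuous hexlinV.
Proof.
have c1 := @continuous_Re R; have c2 := @continuous_Im R.
have c k : continuous (fun _ : R[i] => k : R) by exact: cont_cst.
by apply: continuous_pair; [|apply: contD; [|apply: contN]]; apply: contM.
Qed.

(** From sin (3 x) = 0 at x = pi / 3. *)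
Lemma cos_sin_pi3 : cos (pi / 3) = 1 / 2 :> R /\ sin (pi / 3) = sqrt3 / 2 :> R.
Proof.
have pi0 := pi_gt0 R.
set c := cos (pi / 3); set s := sin (pi / 3).
have c0 : 0 < c by apply: cos_gt0_pihalf; apply/andP; split; lra.
have s0 : 0 < s by apply: sin_gt0_pi; apply/andP; split; lra.
have cs : c ^+ 2 + s ^+ 2 = 1 by exact: cos2Dsin2.
have s3 : sin (pi / 3 + pi / 3 + pi / 3) = 0 :> R.
  by rewrite (_ : _ + _ = pi) ?sinpi //; lra.
have c12 : c = 1 / 2.
  move: s3; rewrite sinD sinD cosD -/c -/s => h.
  have : s * (2 * c - 1) * (2 * c + 1) = 0.
    have e : s ^+ 2 = 1 - c ^+ 2 by lra.
    transitivity (s * (3 * c ^+ 2 - s ^+ 2)); last by rewrite -[RHS]h; ring.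
    by rewrite e; ring.
  move/eqP; rewrite !mulf_eq0 => /orP[/orP[/eqP|/eqP]|/eqP]; lra.
split=> //.
have : s ^+ 2 = (sqrt3 / 2) ^+ 2 by rewrite expr_div_n sqrt3_sqr; move: cs; rewrite c12 => cs; lra.
move/eqP; rewrite eqf_sqr => /orP[/eqP //|/eqP h].
by have := sqrt3_gt0; lra.
Qed.

Definition vertex0 : R * R := (2 / 3, - (1 / 3)).

Lemma hex_vertexE k : hex_vertex R k = hexlin (rotz k vertex0).
Proof.
have [c3 s3] := cos_sin_pi3; have q3 := sqrt3_sqr; have q0 := sqrt3_gt0.
(* Om is the multiplication by exp(i pi / 3). *)
pose Om (z : R[i]) : R[i] := Complex (1 / 2 * complex.Re z - sqrt3 / 2 * complex.Im z)
  (sqrt3 / 2 * complex.Re z + 1 / 2 * complex.Im z).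
have step n : hex_vertex R (n + 1) = Om (hex_vertex R n).
  rewrite /hex_vertex (_ : (n + 1)%:~R * pi / 3 = n%:~R * pi / 3 + pi / 3); last first.
    by rewrite rmorphD /=; field.
  by rewrite cosD sinD c3 s3 /Om /=; congr Complex; ring.
have stepL v : hexlin (rot v) = Om (hexlin v).
  case: v => s t; rewrite /hexlin /rot /Om /=; congr Complex; last by field.
  by transitivity (3 / 4 * s - sqrt3 ^+ 2 * (s / 4 + t / 2)); [rewrite q3; field|field].
have Om_inj : injective Om.
  move=> [a b] [a' b'] /= [e1 e2].
  have ea : a = a'.
    have h1 : 1 / 2 * (1 / 2 * a - sqrt3 / 2 * b) + sqrt3 / 2 * (sqrt3 / 2 * a + 1 / 2 * b)
      = 1 / 2 * (1 / 2 * a' - sqrt3 / 2 * b') + sqrt3 / 2 * (sqrt3 / 2 * a' + 1 / 2 * b').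
      by rewrite e1 e2.
    have r x y : 1 / 2 * (1 / 2 * x - sqrt3 / 2 * y) + sqrt3 / 2 * (sqrt3 / 2 * x + 1 / 2 * y) = x.
      by transitivity (x / 4 + sqrt3 ^+ 2 * x / 4); [field|rewrite q3; field].
    by rewrite !r in h1.
  by rewrite ea in e2 *; congr Complex; lra.
elim/int_ind: k => [|k IH|k IH].
- rewrite rotz0 /hex_vertex mul0r mul0r cos0 sin0 /hexlin /vertex0 /=.
  by congr Complex; field.
- by rewrite (_ : Posz k.+1 = k%:Z + 1) ?step ?rotzS ?stepL ?IH //; lia.
- apply: Om_inj; rewrite -step -stepL -rotzS.
  by rewrite (_ : - Posz k.+1 + 1 = - k%:Z) //; lia.
Qed.

Lemma hexlin_comb (a b : R) v w :
  real_complex R a * hexlin v + real_complex R b * hexlin w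
   = hexlin (a * v.1 + b * w.1, a * v.2 + b * w.2).
Proof. by rewrite /hexlin; simpc; apply/eqP; rewrite eq_complex /=; apply/andP; split; apply/eqP; ring. Qed.

Lemma edge0_interp t : edge0 (t - 1 / 2) =
  ((1 - t) * vertex0.1 + t * (rot vertex0).1, (1 - t) * vertex0.2 + t * (rot vertex0).2) :> R * R.
Proof. by rewrite /edge0 /vertex0 /rot /=; congr pair; field. Qed.

Lemma rotz_comb k (a b : R) v w :
  rotz k (a * v.1 + b * w.1, a * v.2 + b * w.2) =
  (a * (rotz k v).1 + b * (rotz k w).1, a * (rotz k v).2 + b * (rotz k w).2).
Proof.
rewrite /rotz; elim: (absz _) => //= m ->.
by rewrite /rot /=; congr pair; ring.
Qed.

Lemma hex_edgeP k z : hex_edge (R:=R) k z <->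
  exists2 u : R, `|u| <= 1 / 2 & z = hexlin (rotz k (edge0 u)).
Proof.
have key t : real_complex R (1 - t) * hex_vertex R k + real_complex R t * hex_vertex R (k + 1)
    = hexlin (rotz k (edge0 (t - 1 / 2))).
  by rewrite !hex_vertexE hexlin_comb edge0_interp rotz_comb rotzD.
split=> [[t /andP[t0 t1] ->]|[u]].
  by exists (t - 1 / 2); rewrite ?key // ler_norml; lra.
rewrite ler_norml => /andP[u0 u1] ->; exists (u + 1 / 2); last by rewrite key addrK.
by apply/andP; split; lra.
Qed.

Lemma hex_vertex_sum (t : 'I_6 -> R) : \sum_k real_complex R (t k) * hex_vertex R (k : nat)%:Z =
   hexlin (2 / 3 * t ord0 + 1 / 3 * t (inord 1) - 1 / 3 * t (inord 2) - 2 / 3 * t (inord 3)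
            - 1 / 3 * t (inord 4) + 1 / 3 * t (inord 5),
           - (1 / 3) * t ord0 + 1 / 3 * t (inord 1) + 2 / 3 * t (inord 2) + 1 / 3 * t (inord 3)
            - 1 / 3 * t (inord 4) - 2 / 3 * t (inord 5)).
Proof.
rewrite !big_ord_recl big_ord0 addr0.
rewrite !hex_vertexE /=.
have o (k : nat) (i : 'I_6) : val i = k -> i = inord k.
  by move=> <-; rewrite inord_val.
rewrite (o 1%N (lift ord0 ord0)) // (o 2%N (lift ord0 (lift ord0 ord0))) //.
rewrite (o 3%N (lift ord0 (lift ord0 (lift ord0 ord0)))) //.
rewrite (o 4%N (lift ord0 (lift ord0 (lift ord0 (lift ord0 ord0))))) //.
rewrite (o 5%N (lift ord0 (lift ord0 (lift ord0 (lift ord0 (lift ord0 ord0)))))) //.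
move: (t _) (t (inord 1)) (t (inord 2)) (t (inord 3)) (t (inord 4)) (t (inord 5)).
move=> t0 t1 t2 t3 t4 t5.
rewrite /rotz /= /rot /vertex0 /hexlin /=; simpc.
by apply/eqP; rewrite eq_complex /=; apply/andP; split; apply/eqP; field.
Qed.

Lemma sum_ord6 (t : 'I_6 -> R) : \sum_k t k = t ord0 + t (inord 1) + t (inord 2) + t (inord 3)
    + t (inord 4) + t (inord 5).
Proof.
rewrite !big_ord_recl big_ord0 addr0 !addrA.
by congr (t _ + t _ + t _ + t _ + t _ + t _); apply: val_inj; rewrite /= inordK.
Qed.

Lemma hexagon_comb (a0 a1 a2 a3 a4 a5 : R) v : [/\ 0 <= a0, 0 <= a1, 0 <= a2 & 0 <= a3] ->
   0 <= a4 /\ 0 <= a5 -> a0 + a1 + a2 + a3 + a4 + a5 = 1 ->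
   v = (2 / 3 * a0 + 1 / 3 * a1 - 1 / 3 * a2 - 2 / 3 * a3 - 1 / 3 * a4 + 1 / 3 * a5,
        - (1 / 3) * a0 + 1 / 3 * a1 + 2 / 3 * a2 + 1 / 3 * a3 - 1 / 3 * a4 - 2 / 3 * a5) ->
   hexagon (hexlin v).
Proof.
move=> [p0 p1 p2 p3] [p4 p5] s1 ->.
pose t := fun k : 'I_6 => nth 0 [:: a0; a1; a2; a3; a4; a5] k.
exists t; rewrite sum_ord6 hex_vertex_sum /t !inordK //=; split=> //.
by case=> [[|[|[|[|[|[|//]]]]]] ?].
Qed.

(** Gauge at most one means that the point is in the convex hull: in each of
    the six cones it is a combination of two consecutive vertices, and the
    remaining weight is shared between two opposite vertices. *)
Lemma hexagonP z : hexagon z <-> hexnorm (hexlinV z) <= 1.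
Proof.
split.
  move=> [t [t0]]; rewrite sum_ord6 hex_vertex_sum => ts ->; rewrite hexlinK; apply/hexnorm_le => /=.
  have h0 := t0 ord0; have h1 := t0 (inord 1); have h2 := t0 (inord 2).
  have h3 := t0 (inord 3); have h4 := t0 (inord 4); have h5 := t0 (inord 5).
  by split; [| | | |apply/andP; split]; lra.
rewrite -[z in hexagon z]hexlinVK; case: (hexlinV z) => s t /hexnorm_le /= [h1 h2 h3 h4 /andP[h5 h6]].
have [q0|q0] := leP 0 (s + 2 * t); have [r0|r0] := leP 0 (s - t).
- set m := (1 - (2 * s + t)) / 2.
  by apply: (@hexagon_comb (s - t + m) (s + 2 * t) 0 m 0 0); rewrite /m; [split|split| |congr pair]; lra.
- have [p0|p0] := leP 0 (2 * s + t).
    set m := (1 - (s + 2 * t)) / 2.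
    by apply: (@hexagon_comb 0 (2 * s + t + m) (t - s) 0 m 0); rewrite /m; [split|split| |congr pair]; lra.
  set m := (1 - (t - s)) / 2.
  by apply: (@hexagon_comb 0 0 (s + 2 * t + m) (- (2 * s + t)) 0 m); rewrite /m; [split|split| |congr pair]; lra.
- have [p0|p0] := leP 0 (2 * s + t).
    set m := (1 - (s - t)) / 2.
    by apply: (@hexagon_comb (2 * s + t) 0 m 0 0 (- (s + 2 * t) + m)); rewrite /m; [split|split| |congr pair]; lra.
  set m := (1 - (- (s + 2 * t))) / 2.
  by apply: (@hexagon_comb 0 m 0 0 (- (2 * s + t) + m) (s - t)); rewrite /m; [split|split| |congr pair]; lra.
- set m := (1 - (- (2 * s + t))) / 2.
  by apply: (@hexagon_comb m 0 0 (t - s + m) (- (s + 2 * t)) 0); rewrite /m; [split|split| |congr pair]; lra.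
Qed.

End HexagonModel.

(** * Uniformization of the punctured hexagon and of the modular torus *)

Section Uniformization.
Variable R : realType.
Local Notation H := (HH R).
Local Notation G' := (derived_subgroup PSL2Z).
Local Notation SL' := (derived_subgroup SL2Z).
Implicit Types (z w : H) (M N : SL2Z) (v : R * R).

Lemma polar_subproof (p : R * R) : 0 < Num.sqrt (Num.max p.2 1 - distZ2 p.1).
Proof.
have /andP[_ d] := distZ2_bounds p.1.
have : 1 <= Num.max p.2 1 by rewrite le_max lexx orbT.
by rewrite sqrtr_gt0 => h; lra.
Qed.
(** The point of H~ with real part p.1 and with rho equal to p.2. Truncating
    p.2 at 1 makes it a total continuous map, whose images of boxes provide
    the compact sets used below. *)
Definition polar (p : R * R) : H := mkH p.1 (polar_subproof p).

Lemma rho_polar p : rho (polar p) = Num.max p.2 1.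
Proof.
have h := polar_subproof p; rewrite sqrtr_gt0 in h.
by rewrite /rho /polar Rez_mkH Imz_mkH sqr_sqrtr ?(ltW h) // addrC subrK.
Qed.

Lemma Htilde_polar p : Htilde R (polar p).
Proof. by apply/HtildeP; rewrite rho_polar le_max lexx orbT. Qed.

Lemma hexmap_polar p : hexmap (polar p) = scale (Num.max p.2 1)^-1 (hexb p.1).
Proof. by rewrite /hexmap rho_polar. Qed.

Lemma continuous_polar : continuous polar.
Proof.
have c1 := @continuous_fst_R R; have c2 := @continuous_snd_R R.
apply: continuous_to_HH => //.
have cs : continuous (fun p : R * R => Num.max p.2 1 - distZ2 p.1).
  apply: contD; first by apply: continuous_maxr => //; exact: cont_cst.
  by apply: contN; exact: (cont_comp c1 (@continuous_distZ2 R)).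
exact: (cont_comp cs (@sqrt_continuous R)).
Qed.

Definition period_box (r : R) : set (R * R) := [set` `[(0 : R), 6]] `*` [set` `[(1 : R), r]].

Lemma compact_box r : compact (period_box r).
Proof. by apply: compact_setX; exact: segment_compact. Qed.

Lemma polar_hexmap v t : 0 < t -> t <= hexnorm v -> hexnorm v <= 1 ->
  exists2 p, period_box t^-1 p & hexmap (polar p) = v /\ rho (polar p) = (hexnorm v)^-1.
Proof.
move=> t0 tv v1; have [x vE] := hexb_polar v; have v0 : 0 < hexnorm v by lra.
have i1 : 1 <= (hexnorm v)^-1 by rewrite invf_ge1.
(* Reduce the real part to [0, 6]. *)
pose q := Num.floor (x / 6).
have /andP[q1 q2] := floor_itv (x / 6); rewrite -/q in q1 q2; rewrite rmorphD /= in q2.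
exists (x - 6 * q%:~R, (hexnorm v)^-1).
  split; rewrite /= in_itv /=; apply/andP; split; try lra.
  by rewrite lef_pV2.
rewrite hexmap_polar rho_polar /= (max_idPl i1) invrK; split=> //.
have -> : x - 6 * q%:~R = x + (6 * (- q))%:~R by rewrite rmorphM rmorphN /=; ring.
by rewrite hexb6.
Qed.

Definition Htpolar (p : R * R) : set_type (Htilde R) := exist _ (polar p) (mem_set (Htilde_polar p)).

Lemma continuous_Htpolar : continuous Htpolar.
Proof. by apply: continuous_to_set_type; exact: continuous_polar. Qed.

Lemma HtE (x : set_type (Htilde R)) : Htilde R (val x).
Proof. exact: set_mem (valP x). Qed.

(** Composing hexmap with the projection of the plane to the torus makes it
    insensitive to the side pairings. *)
Definition tmap z : R[i] * R[i] := torus_map (hexmap z).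

Lemma continuous_tmap : continuous tmap.
Proof. exact: (cont_comp (@continuous_hexmap R) (@continuous_torus_map R)). Qed.

Lemma hexmap6 (q : int) z : hexmap (actSL (expgz matA (6 * q)) z) = hexmap z.
Proof. by rewrite hexmap_expA (_ : - (6 * q) = 0 + 6 * (- q)) ?rotz6 //; lia. Qed.

Lemma tmap6 (q : int) z : tmap (actSL (expgz matA (6 * q)) z) = tmap z.
Proof. by rewrite /tmap hexmap6. Qed.

Lemma tmap_side k z : Hside R k z -> tmap (actSL (fmat k) z) = tmap z.
Proof.
move=> /fmat_side_hexmap[_ e]; rewrite /tmap e; apply/torus_map_eq.
have [i [j ij]] := @rotz10_int R k; exists (- i), (- j).
rewrite addrAC subrr add0r ij !rmorphN /=.
by [].
Qed.

Lemma tmap_derived M z : SL' M -> Htilde R z -> Htilde R (actSL M z) -> tmap (actSL M z) = tmap z.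
Proof.
move=> dM hz hw; case: (derived_pair dM hz hw) => [[q ->]|[k [q [hk ->]]]].
  exact: tmap6.
by rewrite tmap6 tmap_side.
Qed.

Lemma hexmap_inj z w : hexmap z = hexmap w -> exists q : int, w = actSL (expgz matA (6 * q)) z.
Proof.
move=> e; have rr : rho z = rho w.
  by apply: invr_inj; rewrite -!hexnorm_hexmap e.
have : hexb (Rez z) = hexb (Rez w).
  have h := lt0r_neq0 (rho_gt0 z).
  move: e; rewrite /hexmap -rr /scale => -[/(mulfI (invr_neq0 h)) e1 /(mulfI (invr_neq0 h)) e2].
  by case: (hexb _) (hexb _) e1 e2 => a b [a' b'] /= -> ->.
move=> /hexb_inj[q qE]; exists (- q); apply: HH_ext.
  by rewrite Rez_expA qE mulrN rmorphN opprK.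
rewrite Imz_expA; move: rr; rewrite /rho qE distZ2D => /addrI/eqP.
by rewrite eqrXn2 // => [/eqP -> //| |]; rewrite ltW // Imz_gt0.
Qed.

Lemma hexnorm_Htilde z : Htilde R z -> hexnorm (hexmap z) <= 1.
Proof. by move=> /HtildeP h; rewrite hexnorm_hexmap invf_le1 // (lt_le_trans ltr01). Qed.

(** A nonzero lattice vector between two points of the hexagon joins two
    opposite edges, where it comes from a side pairing. *)
Lemma tmap_inj z w : Htilde R z -> Htilde R w -> tmap z = tmap w ->
  (exists q : int, w = actSL (expgz matA (6 * q)) z) \/
  (exists k q q', Hside R k (actSL (expgz matA (6 * q')) z) /\
     w = actSL (expgz matA (6 * q)) (actSL (fmat k) (actSL (expgz matA (6 * q')) z))).
Proof.
move=> hz hw /torus_map_eq[i [j e]].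
have [/hexmap_inj|ne] := EM (hexmap z = hexmap w); [by left|right].
have [k [u [u2 zE wE]]] := lattice_hexagon (hexnorm_Htilde hz) (hexnorm_Htilde hw) e ne.
have rz : rho z = 1.
  by apply: invr_inj; rewrite -hexnorm_hexmap zE hexnorm_rotz hexnorm_edge0 // invr1.
(* z lies on side k up to a translation by a multiple of 6. *)
have ku : `|k%:~R + u - k%:~R| <= 1 / 2 by rewrite addrAC subrr add0r.
have s1 (p : R * R) : scale 1 p = p by case: p => a b; rewrite /scale !mul1r.
have : hexb (Rez z) = hexb (k%:~R + u).
  by rewrite (hexbE ku) addrAC subrr add0r -zE /hexmap rz invr1 s1.
move=> /hexb_inj[q qE].
have hs : Hside R k (actSL (expgz matA (6 * (- q))) z).
  apply/HsideP; rewrite rho_expA; split=> //.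
  by rewrite Rez_expA mulrN rmorphN opprK -qE.
have [_ fE] := fmat_side_hexmap hs.
have [q' q'E] : exists q' : int, w = actSL (expgz matA (6 * q')) (actSL (fmat k) (actSL (expgz matA (6 * - q)) z)).
  by apply: hexmap_inj; rewrite fE hexmap6 wE.
by exists k, q', (- q).
Qed.

Lemma tmap_puncture z : Htilde R z -> tmap z <> puncture R.
Proof.
move=> hz /(torus_map_puncture (hexnorm_Htilde hz)) h.
have := hexnorm_hexmap z; rewrite h hexnorm0 => /esym/eqP; rewrite invr_eq0.
by rewrite (gt_eqF (rho_gt0 z)).
Qed.

Definition reducer z : SL2Z := sval (cid2 (reduce_derived z)).
Lemma reducer_derived z : SL' (reducer z).
Proof. by rewrite /reducer; case: cid2. Qed.
Lemma reducer_Htilde z : Htilde R (actSL (reducer z) z).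
Proof. by rewrite /reducer; case: cid2. Qed.

(** The extension to the half-plane that is invariant under the derived
    subgroup: move the point to H~ first. *)
Definition umap z : R[i] * R[i] := tmap (actSL (reducer z) z).

(** The value does not depend on the element of the derived subgroup that is
    used to reach H~. *)
Lemma umapE M z : SL' M -> Htilde R (actSL M z) -> umap z = tmap (actSL M z).
Proof.
move=> dM hM; have dG := derived_is_subgroup SL2Z.
have dN : SL' (M * (reducer z)^-1)%g.
  by apply: (subgroupM dG) => //; apply: (subgroupV dG); exact: reducer_derived.
have e : actSL M z = actSL (M * (reducer z)^-1)%g (actSL (reducer z) z).
  by rewrite act_mul actK.
by rewrite /umap e (tmap_derived dN (reducer_Htilde z)) // -e.
Qed.

Lemma umap_Htilde z : Htilde R z -> umap z = tmap z.
Proof.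
move=> hz; rewrite -{2}[z]act_1; apply: umapE; first exact: subgroup1 (derived_is_subgroup _).
by rewrite act_1.
Qed.

Lemma umap_act M z : SL' M -> umap (actSL M z) = umap z.
Proof.
move=> dM; have dG := derived_is_subgroup SL2Z.
rewrite [RHS](@umapE (reducer (actSL M z) * M)%g).
- by rewrite act_mul.
- by apply: (subgroupM dG) => //; exact: reducer_derived.
- by rewrite act_mul; exact: reducer_Htilde.
Qed.

Lemma closed_Htilde M : closed [set z | Htilde R (actSL M z)].
Proof.
have -> : [set z | Htilde R (actSL M z)] = (fun z => rho (actSL M z)) @^-1` [set r : R | 1 <= r].
  by apply/seteqP; split=> z /HtildeP.
apply: closed_comp; last exact: closed_ge.
by move=> z _; exact: (cont_comp (@continuous_act R M) (@continuous_rho R)).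
Qed.

(** Points above height 1 / 3 that are not in H~ are in a tile adjacent to it,
    glued along the side below which they lie. *)
Lemma Htilde_S_cover z : 1 / 3 < Imz z -> Htilde R z \/
  Htilde R (actSL (fmat (nint (Rez z) - 3))^-1%g z).
Proof.
move=> y3; set n := nint (Rez z); have hn := nint_norm (Rez z); rewrite -/n in hn.
have [h|h] := leP 1 (rho z); [by left; apply/HtildeP|right].
have hS : Htilde R (actSL matS (actSL (expgz matA n) z)).
  apply: act_S_Htilde; rewrite ?Imz_expA ?Rez_expA //.
  by rewrite -(rhoE hn) ltW.
apply/(Htilde_expA (n - 3)); rewrite -!act_mul in hS *.
rewrite (act_sign z (N := (matS * expgz matA n)%g)) //.
apply/eq_up_to_signP; right.
rewrite (mulSL_mat2 (val_expA _) (invSL_mat2 (val_fmat _))) (mulSL_mat2 val_matS (val_expA n)).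
by rewrite mat2_opp; congr mat2; ring.
Qed.

(** Near a point of H~, the half-plane is covered by H~ and three adjacent
    tiles; on each of them umap is the composition of an element of the group
    and of tmap, which is continuous everywhere. *)
Lemma continuous_umap_Htilde z : Htilde R z -> {for z, continuous umap}.
Proof.
move=> hz; have dG := derived_is_subgroup SL2Z.
have y3 : 1 / 3 < Imz z by have := Htilde_high hz; have := Imz_gt0 z; nra.
pose n := nint (Rez z); pose g k := ((fmat (n + k - 3))^-1)%g.
have dg k : SL' (g k) by apply: (subgroupV dG); exact: fmat_in_derived.
refine (@continuous_at_patch H _ SL2Z [:: 1%g; g (- 1); g 0; g 1]
  (fun M => [set w | Htilde R (actSL M w)]) (fun M w => tmap (actSL M w)) umap z _ _ _ _).
- by move=> M _; exact: closed_Htilde.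
- by move=> M _ _; exact: (cont_comp (@continuous_act R M) continuous_tmap).
- move=> M w hM hw; apply: umapE => //.
  by case: hM => [<-|[<-|[<-|[<-|//]]]] //; exact: subgroup1.
have n1 : \forall w \near z, `|Rez z - Rez w| < 1 / 2.
  by apply: near_dist_lt; [exact: continuous_Rez|lra].
have n2 : \forall w \near z, 1 / 3 < Imz w.
  have e0 : 0 < Imz z - 1 / 3 by lra.
  have := near_dist_lt z (@continuous_Imz R) e0.
  by apply: (@filterS _ _ (nbhs_filter z)) => w; rewrite ltr_norml; lra.
apply: (@filterS2 _ _ (nbhs_filter z) _ _ _ _ n1 n2) => w w1 w2.
have [h|h] := Htilde_S_cover w2.
  by exists 1%g; [left|rewrite /= act_1].
exists (g (nint (Rez w) - n)); last by rewrite /= /g (addrC n) subrK.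
have [->|[->|->]] := nint_near w1; rewrite -/n.
- by right; left; congr g; lia.
- by right; right; left; congr g; lia.
- by right; right; right; left; congr g; lia.
Qed.

Lemma continuous_umap : continuous umap.
Proof.
move=> z; set M := reducer z.
have -> : umap = umap \o actSL M.
  by apply/funext => w /=; rewrite umap_act //; exact: reducer_derived.
apply: (@continuous_comp _ _ _ (@actSL R M) umap z); first exact: continuous_act.
by apply: continuous_umap_Htilde; exact: reducer_Htilde.
Qed.

Local Notation Tp := (@torus R `\ puncture R).

Lemma umap_torus z : umap z \in Tp.
Proof.
rewrite inE; split; first exact: torus_mapP.
by apply: tmap_puncture; exact: reducer_Htilde.
Qed.
Definition utorus z : set_type Tp := exist _ (umap z) (umap_torus z).
Definition ttorus (x : set_type (Htilde R)) : set_type Tp := utorus (val x).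

Lemma continuous_utorus : continuous utorus.
Proof. by apply: continuous_to_set_type; exact: continuous_umap. Qed.
Lemma continuous_ttorus : continuous ttorus.
Proof. exact: (cont_comp (@continuous_val _ _) continuous_utorus). Qed.

Lemma torus_cover (y : set_type Tp) : exists2 t : R, 0 < t &
  \forall y' \near y, exists2 p, period_box t^-1 p & ttorus (Htpolar p) = y'.
Proof.
have [ty ny] : Tp (val y) by exact: set_mem (valP y).
have [v v1 vy] := torus_map_surj ty.
have v0 : 0 < hexnorm v.
  rewrite lt_def hexnorm_ge0 andbT; apply/eqP => /hexnorm_eq0 e.
  by apply: ny; rewrite -vy e.
exists (hexnorm v / 2); first by lra.
have := torus_far v1 v0; rewrite vy => /nbhs_set_type.
apply: filterS => y' /= h.
have [ty' _] : Tp (val y') by exact: set_mem (valP y').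
have [w [w1 w2 wy]] := h ty'.
have t0 : 0 < hexnorm v / 2 by lra.
have [p pb [pw _]] := polar_hexmap t0 (ltW w1) w2.
exists p => //; apply: val_inj => /=.
by rewrite umap_Htilde ?/tmap ?pw //; exact: Htilde_polar.
Qed.

Lemma torus_pt_hausdorff : hausdorff_space (set_type Tp).
Proof. apply: set_type_hausdorff; exact: complex2_hausdorff. Qed.

Lemma utorus_quotient : quotient_map utorus.
Proof.
apply: compact_covering_quotient_map.
- exact: torus_pt_hausdorff.
- exact: continuous_utorus.
- move=> y; have [t _ /nbhs_singleton [p _ <-]] := torus_cover y.
  by exists (polar p).
- move=> y; have [t _ h] := torus_cover y; exists (polar @` period_box t^-1).
    by apply: continuous_compact; [apply: continuous_subspaceT; exact: continuous_polar|exact: compact_box].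
  apply: filterS h => y' [p pb <-]; exists (polar p) => //; by exists p.
Qed.

Lemma ttorus_quotient : quotient_map ttorus.
Proof.
apply: compact_covering_quotient_map.
- exact: torus_pt_hausdorff.
- exact: continuous_ttorus.
- move=> y; have [t _ /nbhs_singleton [p _ <-]] := torus_cover y.
  by exists (Htpolar p).
- move=> y; have [t _ h] := torus_cover y; exists (Htpolar @` period_box t^-1).
    by apply: continuous_compact; [apply: continuous_subspaceT; exact: continuous_Htpolar|exact: compact_box].
  apply: filterS h => y' [p pb <-]; exists (Htpolar p) => //; by exists p.
Qed.

Lemma utorus_orbit z w : orbit_rel G' z w -> utorus z = utorus w.
Proof.
case=> g; rewrite derived_PSL2Z => -[M dM <-] <-; apply: val_inj => /=.
by rewrite actG_projG umap_act.
Qed.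

Lemma derivedSL_expA6 (q : int) : G' (projG (expgz matA (6 * q))).
Proof. by apply/derivedG_expA; exists q. Qed.

Lemma utorus_inj z w : utorus z = utorus w -> orbit_rel G' z w.
Proof.
move=> /(congr1 val) /= e.
have dG := derived_is_subgroup PSL2Z.
have dr u : G' (projG (reducer u)) by rewrite derived_PSL2Z; exists (reducer u) => //; exact: reducer_derived.
have df k : G' (projG (fmat k)) by rewrite derived_PSL2Z; exists (fmat k) => //; exact: fmat_in_derived.
have key : orbit_rel G' (actSL (reducer z) z) (actSL (reducer w) w).
  case: (tmap_inj (reducer_Htilde z) (reducer_Htilde w) e) => [[q ->]|[k [q [q' [_ ->]]]]].
    by exists (projG (expgz matA (6 * q))); [exact: derivedSL_expA6|exact: actG_projG].
  exists (projG (expgz matA (6 * q)) * projG (fmat k) * projG (expgz matA (6 * q')))%g.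
    by apply: (subgroupM dG); [apply: (subgroupM dG)|] => //; exact: derivedSL_expA6.
  by rewrite !actG_mul !actG_projG.
case: key => g Gg gE.
exists ((projG (reducer w))^-1 * g * projG (reducer z))%g.
  by apply: (subgroupM dG) => //; apply: (subgroupM dG) => //; exact: (subgroupV dG).
by rewrite !actG_mul (actG_projG (reducer z)) gE -actG_projG actGK.
Qed.

Lemma torus_homeo : exists2 phi : quotient_HH R G' -> set_type Tp, homeomorphism phi &
  forall z, phi (glue_pi (orbit_rel G') z) = utorus z.
Proof.
apply: gluing_homeo; first exact: utorus_quotient.
  exact: utorus_orbit.
by move=> z w /utorus_inj h; exact: Relations.Relation_Operators.rst_step.
Qed.

Local Notation cusp := (projG cuspSL).

Lemma once_punctured_torus_derived : once_punctured_torus_with_cusp R G' cusp.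
Proof.
split; first exact: covering_derived.
have [phi hphi phiE] := torus_homeo.
exists (puncture R), phi; split=> //; first exact: torus_mapP.
exists [set z | 2 < Imz z].
  apply: cusp_region_high => //; first by lra.
  by rewrite derived_PSL2Z; exists cuspSL => //; exact: cuspSL_derived.
(* Gauge below 1 / 6 means rho > 6, hence a height above 2. *)
have r0 : 0 < 1 / 6 :> R by lra.
have := torus_near r0; apply: filterS => x h [tx nx].
have [v [v1 v2 vx]] := h tx.
have v0 : 0 < hexnorm v.
  rewrite lt_def hexnorm_ge0 andbT; apply/eqP => /hexnorm_eq0 e.
  by apply: nx; rewrite -vx e.
have [p _ [pv rp]] := polar_hexmap v0 (lexx _) v2.
exists (polar p).
  rewrite /=; move: rp; rewrite /rho; have /andP[_ d] := distZ2_bounds (Rez (polar p)).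
  have : 6 < (hexnorm v)^-1 by rewrite -[6]invrK ltf_pV2 ?posrE ?invr_gt0 //; lra.
  by have := Imz_gt0 (polar p); move: (Imz _) => y y0; nra.
by rewrite phiE /= umap_Htilde ?/tmap ?pv //; exact: Htilde_polar.
Qed.

Local Notation hexG := (generated [set cusp]).
Local Notation Hexp := (@hexagon R `\ (0 : R[i])).

Lemma hexlin0 : hexlin (0, 0) = 0 :> R[i].
Proof. by rewrite /hexlin /= !mulr0 addr0. Qed.

Lemma hexpt_subproof (x : set_type (Htilde R)) : hexlin (hexmap (val x)) \in Hexp.
Proof.
rewrite inE; split; first by apply/hexagonP; rewrite hexlinK; exact: hexnorm_Htilde (HtE x).
rewrite /= -hexlin0 => /(can_inj (@hexlinK R)) e.
have := hexnorm_hexmap (val x); rewrite e hexnorm0 => /esym/eqP.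
by rewrite invr_eq0 (gt_eqF (rho_gt0 _)).
Qed.
Definition hexpt (x : set_type (Htilde R)) : set_type Hexp := exist _ (hexlin (hexmap (val x))) (hexpt_subproof x).

Lemma continuous_hexpt : continuous hexpt.
Proof.
apply: continuous_to_set_type.
exact: (cont_comp (cont_comp (@continuous_val _ _) (@continuous_hexmap R)) (@continuous_hexlin R)).
Qed.

Lemma hexpt_cover (y : set_type Hexp) : exists2 t : R, 0 < t &
  \forall y' \near y, exists2 p, period_box t^-1 p & hexpt (Htpolar p) = y'.
Proof.
have [/hexagonP hy ny] : Hexp (val y) by exact: set_mem (valP y).
set v := hexlinV (val y) in hy.
have v0 : 0 < hexnorm v.
  rewrite lt_def hexnorm_ge0 andbT; apply/eqP => /hexnorm_eq0 e.
  by apply: ny; rewrite /= -(hexlinVK (val y)) -/v e hexlin0.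
exists (hexnorm v / 2); first by lra.
have cn : continuous (fun y' : set_type Hexp => hexnorm (hexlinV (val y'))).
  exact: (cont_comp (cont_comp (@continuous_val _ _) (@continuous_hexlinV R)) (@continuous_hexnorm R)).
have e0 : 0 < hexnorm v / 2 by lra.
have := near_dist_lt y cn e0.
apply: (@filterS _ _ (nbhs_filter y)) => y'; rewrite ltr_norml => /andP[h1 h2].
have [/hexagonP hy' _] : Hexp (val y') by exact: set_mem (valP y').
have h3 : hexnorm v / 2 <= hexnorm (hexlinV (val y')) by lra.
have [p pb [pw _]] := polar_hexmap e0 h3 hy'.
by exists p => //; apply: val_inj => /=; rewrite pw hexlinVK.
Qed.

Lemma hexpt_quotient : quotient_map hexpt.
Proof.
apply: compact_covering_quotient_map.
- by apply: set_type_hausdorff; exact: complex_hausdorff.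
- exact: continuous_hexpt.
- move=> y; have [t _ /nbhs_singleton [p _ <-]] := hexpt_cover y.
  by exists (Htpolar p).
- move=> y; have [t _ h] := hexpt_cover y; exists (Htpolar @` period_box t^-1).
    by apply: continuous_compact; [apply: continuous_subspaceT; exact: continuous_Htpolar|exact: compact_box].
  apply: filterS h => y' [p pb <-]; exists (Htpolar p) => //; by exists p.
Qed.

Lemma hexG_act g z : hexG g -> exists q : int, actG g z = actSL (expgz matA (6 * q)) z.
Proof. by move=> /hexgroupP[q ->]; exists q; exact: actG_projG. Qed.

Lemma hexpt_orbit (x y : set_type (Htilde R)) :
  orbit_rel hexG (val x) (val y) <-> hexpt x = hexpt y.
Proof.
split.
  case=> g /(@hexG_act _ (val x)) [q e] h; apply: val_inj => /=.
  by rewrite -h e hexmap6.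
move=> /(congr1 val) /= /(can_inj (@hexlinK R)) /hexmap_inj[q e].
by exists (projG (expgz matA (6 * q))); [apply/hexgroupP; exists q|rewrite actG_projG].
Qed.

Lemma hexagon_homeo : exists2 psi : quotient_part (Htilde R) hexG -> set_type Hexp,
  homeomorphism psi & forall x, psi (glue_pi _ x) = hexpt x.
Proof.
apply: gluing_homeo; first exact: hexpt_quotient.
  by move=> x y /hexpt_orbit.
by move=> x y /hexpt_orbit h; exact: Relations.Relation_Operators.rst_step.
Qed.

Lemma hexmap_side k z : Hside R k z -> hexmap z = rotz k (edge0 (Rez z - k%:~R)).
Proof.
move=> /HsideP[h r1]; rewrite /hexmap r1 invr1 (hexbE h).
by case: (rotz _ _) => a b; rewrite /scale !mul1r.
Qed.

Lemma punctured_hexagon : punctured_hyperbolic_hexagon (Htilde R) hexG (Hside R) cusp.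
Proof.
have hG : is_subgroup hexG := generated_subgroup _.
split.
- by apply: covering_sub => //; exact: hexgroup_derived.
- by move=> g z /(@hexG_act _ z) [q ->] /Htilde_expA.
- move=> k; split; last exact: geodesic_Hside.
  by move=> z /HsideP[_ r1]; apply/HtildeP; rewrite r1.
have [psi hpsi psiE] := hexagon_homeo; exists psi; split=> //.
- move=> k; split.
  + move=> x /= hx; rewrite psiE /=; apply/hex_edgeP.
    exists (Rez (val x) - k%:~R); first by case/HsideP: hx.
    by rewrite (hexmap_side hx).
  + move=> x y; rewrite !inE => hx hy; rewrite !psiE /= => /(can_inj (@hexlinK R)).
    rewrite (hexmap_side hx) (hexmap_side hy) => /(congr1 (rotz (- k))); rewrite !rotzK => -[_ e].
    have ex : Rez (val x) = Rez (val y) by lra.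
    apply: val_inj; apply: HH_ext => //.
    case/HsideP: hx => h r1; case/HsideP: hy => h' r2.
    move: r1; rewrite -r2 (rhoE h) (rhoE h') ex => /addrI /eqP.
    by rewrite eqrXn2 // => [/eqP -> //| |]; rewrite ltW // Imz_gt0.
  + move=> _ /hex_edgeP[u u2 ->].
    have hs : Hside R k (polar (k%:~R + u, 1)).
      apply/HsideP; rewrite rho_polar /= maxxx; split=> //.
      by rewrite Rez_mkH /= addrAC subrr add0r.
    exists (Htpolar (k%:~R + u, 1)); first exact: hs.
    by rewrite psiE /= (hexmap_side hs) Rez_mkH /= addrAC subrr add0r.
- exists [set z | 2 < Imz z].
    split.
      apply: cusp_region_high => //; first by lra.
      + exact: sub_generated.
      + exact: hexgroup_derived.
    move=> z /= hz; apply/HtildeP; rewrite /rho.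
    by have /andP[d _] := distZ2_bounds (Rez z); nra.
  have cn : continuous (fun w : R[i] => hexnorm (hexlinV w)).
    exact: (cont_comp (@continuous_hexlinV R) (@continuous_hexnorm R)).
  have z0 : hexlinV 0 = (0, 0) :> R * R by rewrite -hexlin0 hexlinK.
  have e0 : 0 < 1 / 6 :> R by lra.
  have := near_dist_lt (0 : R[i]) cn e0.
  apply: (@filterS _ _ (nbhs_filter (0 : R[i]))) => w; rewrite z0 hexnorm0 sub0r normrN.
  rewrite ger0_norm ?hexnorm_ge0 // => w6 [/hexagonP w1 w0].
  set v := hexlinV w in w6 w1.
  have v0 : 0 < hexnorm v.
    rewrite lt_def hexnorm_ge0 andbT; apply/eqP => /hexnorm_eq0 e.
    by apply: w0; rewrite /= -(hexlinVK w) -/v e hexlin0.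
  have [p _ [pv rp]] := polar_hexmap v0 (lexx _) w1.
  exists (Htpolar p); last by rewrite psiE /= pv hexlinVK.
  rewrite /=; move: rp; rewrite /rho; have /andP[_ d] := distZ2_bounds (Rez (polar p)).
  have : 6 < (hexnorm v)^-1 by rewrite -[6]invrK ltf_pV2 ?posrE ?invr_gt0 //; lra.
  by have := Imz_gt0 (polar p); move: (Imz _) => y y0; nra.
Qed.

Local Notation pairing := (side_pairing (X := Htilde R) (Gam := hexG) (Hside R) (fun n => projG (fmat n))).

(** Both sides are compared with the punctured torus: the glued hexagon
    through the restriction of umap to H~, and the orbit space through umap. *)
Lemma pairing_homeo : exists2 Phi : gluing pairing -> quotient_HH R G', homeomorphism Phi &
  forall x : set_type (Htilde R),
    Phi (glue_pi pairing (glue_pi _ x)) = glue_pi (orbit_rel G') (val x).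
Proof.
have [phi hphi phiE] := torus_homeo.
have orbE (x y : set_type (Htilde R)) : orbit_rel hexG (val x) (val y) -> ttorus x = ttorus y.
  by case=> g /hexgroup_derived Gg gE; apply: utorus_orbit; exists g.
have [f1 f1q f1E] := gluing_factor ttorus_quotient orbE.
have [phi1 hphi1 phi1E] : exists2 phi1 : gluing pairing -> set_type Tp, homeomorphism phi1 &
    forall u, phi1 (glue_pi pairing u) = f1 u.
  apply: gluing_homeo => //.
    move=> u v [k [x [y [hx yE -> ->]]]]; rewrite !f1E; apply: val_inj => /=.
    rewrite !umap_Htilde; [|exact: HtE|exact: HtE].
    by rewrite yE actG_projG tmap_side.
  move=> u v; have [x <-] := glue_pi_surj u; have [y <-] := glue_pi_surj v.
  rewrite !f1E => /(congr1 val) /=; rewrite !umap_Htilde; [|exact: HtE|exact: HtE].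
  have hexE (x' y' : set_type (Htilde R)) (q : int) : val y' = actSL (expgz matA (6 * q)) (val x') ->
      glue_pi (fun x y : set_type (Htilde R) => orbit_rel hexG (val x) (val y)) x' = glue_pi _ y'.
    move=> e; apply/glue_pi_eq; apply: Relations.Relation_Operators.rst_step.
    by exists (projG (expgz matA (6 * q))); [apply/hexgroupP; exists q|rewrite actG_projG].
  move=> /(tmap_inj (HtE x) (HtE y)) [[q e]|[k [q [q' [hs e]]]]].
    by rewrite (hexE x y q e); exact: Relations.Relation_Operators.rst_refl.
  have [hs' _] := fmat_side_hexmap hs.
  have h1 : Htilde R (actSL (expgz matA (6 * q')) (val x)).
    by case/HsideP: hs => _ r1; apply/HtildeP; rewrite r1.
  have h2 : Htilde R (actSL (fmat k) (actSL (expgz matA (6 * q')) (val x))).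
    by case/HsideP: hs' => _ r1; apply/HtildeP; rewrite r1.
  pose x' : set_type (Htilde R) := exist _ (actSL (expgz matA (6 * q')) (val x)) (mem_set h1).
  pose y' : set_type (Htilde R) := exist _ (actSL (fmat k) (actSL (expgz matA (6 * q')) (val x))) (mem_set h2).
  rewrite (hexE x x' q') // -(hexE y' y q) //.
  apply: Relations.Relation_Operators.rst_step; exists k, x', y'; split=> //.
  by rewrite actG_projG.
have [Phi hPhi PhiE] := homeomorphism_comp_inv hphi1 hphi.
exists Phi => // x.
have [_ [phi' [_ phiK _]]] := hphi.
by apply: (can_inj phiK); rewrite PhiE phi1E f1E phiE.
Qed.

End Uniformization.

Theorem mainTheorem3 (R : realType) :
  let fG (n : int) : PSL2Z := projG (fmat n) in
  let cSL : SL2Z := (expgz matA (- 6) * matS ^+ 2)%g in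
  let c : PSL2Z := projG cSL in
  let G' : set PSL2Z := derived_subgroup PSL2Z in
  let SL' : set SL2Z := derived_subgroup SL2Z in
  let hexG : set PSL2Z := projG @` generated [set cSL] in
  let pairing := side_pairing (X := Htilde R) (Gam := hexG) (Hside R) fG in
  val matS = mat2 0 (-1) 1 0 /\
  (* 1 *)
  (G' = generated [set fG (- 2); fG (- 1)] /\ has_index G' 6) /\
  (* 2 *)
  [/\ once_punctured_torus_with_cusp R G' c,
      punctured_hyperbolic_hexagon (Htilde R) hexG (Hside R) c,
      forall n : int,
        G' (fG n) /\ actG (fG n) @` Hside R n = Hside R (n + 3),
      exists2 Phi : gluing pairing -> quotient_HH R G', homeomorphism Phi &
        forall x : set_type (Htilde R),
          Phi (glue_pi pairing (glue_pi _ x)) = glue_pi (orbit_rel G') (val x) &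
      cSL = [~ (fmat (- 1))^-1, fmat (- 2)]%g] /\
  (* 3 *)
  [/\ set_inj SL' projG,
      freely_generated SL'
        (fun b : bool => if b then fmat (- 2) else fmat (- 1)),
      fmat (- 2) = (matB * matA^-1)%g /\ val (fmat (- 2)) = mat2 1 1 1 2 &
      fmat (- 1) = (matA^-1 * matB)%g /\ val (fmat (- 1)) = mat2 2 1 1 1].
Proof.
move=> fG cSL c G' SL' hexG pairing.
have hexGE : hexG = generated [set c] by exact: hexgroupE.
split; first exact: val_matS.
split; first by split; [exact: derived_PSL2Z_generated|exact: derivedG_index].
split; split.
- exact: once_punctured_torus_derived.
- by rewrite hexGE; exact: punctured_hexagon.
- move=> n; split; last exact: side_fmat_image.
  by rewrite /G' derived_PSL2Z; exists (fmat n) => //; exact: fmat_in_derived.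
- by rewrite /pairing hexGE; exact: pairing_homeo.
- exact: cuspSLE.
- exact: projG_inj_derived.
- exact: derived_freely_generated.
- by split; [exact: fm2E|exact: val_fm2].
- by split; [exact: fm1E|exact: val_fm1].
Qed.
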